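(* Let $T\in(0,\infty)$, let $(c_n)_n$ be a sequence with $c_n>0$ and $c_n\to0$, let $p,q\ge1$ with $1/p+1/q=1$, let $x\in\mathbb{L}^S_p((c_n)_n)$, let $L$ be the $L^p$-interval crossing local time of $x$ along $(c_n)_n$, and let $(\phi^n,-x^n)$ be the solution to the Skorokhod problem for $x$ on $[-c_n/2,c_n/2]$. If $f\in W^{2,q}(\mathbb{R})$, then the limit $$\int_0^t f'(x_{s-})\,\mathrm{d}x_s:=\lim_{n\to\infty}\int_0^t f'(x^n_{s-})\,\mathrm{d}x_s,\qquad t\in[0,T],$$ exists and is finite, and with this definition the pathwise Tanaka--Meyer formula $$f(x_t)-f(x_0)=\int_0^t f'(x_{s-})\,\mathrm{d}x_s+\frac12\int_{\mathbb{R}}L_t(x,u)\,f''(u)\,\mathrm{d}u+J_t^f(x),\qquad t\in[0,T],$$ holds, where $J_t^f(x)=\sum_{0<s\le t}\big(\Delta f(x_s)-f'(x_{s-})\Delta x_s\big)$.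
   Context: $D([0,T];\mathbb{R})$ is the space of càdlàg functions $x:[0,T]\to\mathbb{R}$; $x_{t-}$ is the left limit, $x_{0-}:=x_0$, $\Delta x_t:=x_t-x_{t-}$, $\Delta f(x_s):=f(x_s)-f(x_{s-})$. $V^1([0,T];\mathbb{R})$ and $V^+([0,T];\mathbb{R})$ are the subsets of $D([0,T];\mathbb{R})$ of functions of bounded variation and of non-decreasing functions. $\int_0^t$ stands for $\int_{(0,t]}$. Skorokhod problem: given $x\in D([0,T];\mathbb{R})$ and $\varepsilon>0$, a pair $(\phi^\varepsilon,-x^\varepsilon)\in D([0,T];\mathbb{R})\times V^1([0,T];\mathbb{R})$ is a solution to the Skorokhod problem on $[-\varepsilon/2,\varepsilon/2]$ if (i) $x_t-x^\varepsilon_t=\phi^\varepsilon_t\in[-\varepsilon/2,\varepsilon/2]$ for all $t\in[0,T]$; (ii) $x^\varepsilon=x^{\varepsilon\uparrow}-x^{\varepsilon\downarrow}$ with $x^{\varepsilon\uparrow},x^{\varepsilon\downarrow}\in V^+([0,T];\mathbb{R})$ whose associated measures $\mathrm{d}x^{\varepsilon\uparrow}$, $\mathrm{d}x^{\varepsilon\downarrow}$ are supported in $\{t:\phi^\varepsilon_t=\varepsilon/2\}$ and $\{t:\phi^\varepsilon_t=-\varepsilon/2\}$ respectively; (iii) $\phi^\varepsilon_0=0$. A solution exists and is unique, and $x^\varepsilon$ is piecewise monotonic (there is a finite partition of $[0,T]$ into intervals on each of which $x^\varepsilon$ is monotone). For $f\in W^{2,q}(\mathbb{R})$ ($f$ being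 the continuously differentiable representative) the function $f'(x^\varepsilon_\cdot)$ has finite variation and one defines $$\int_0^t f'(x^\varepsilon_{s-})\,\mathrm{d}x_s:=f'(x^\varepsilon_t)x_t-f'(x^\varepsilon_0)x_0-\int_0^t x_{s-}\,\mathrm{d}f'(x^\varepsilon_s)-\sum_{0<s\le t}\Delta x_s\,\Delta f'(x^\varepsilon_s),$$ with a Lebesgue--Stieltjes integral on the right. Crossings: for $z\in\mathbb{R}$, $\varepsilon>0$, $t\in(0,T]$, $\mathrm{u}^{z,\varepsilon}(x,[0,t]):=\sup_{n}\sup_{0\le t_1<s_1<\dots<t_n<s_n\le t}\sum_{i=1}^n\mathbf{1}_{\{x_{t_i}\le z-\varepsilon/2,\ x_{s_i}\ge z+\varepsilon/2\}}$ is the number of upcrossings, the number of downcrossings $\mathrm{d}^{z,\varepsilon}(x,[0,t])$ is defined analogously (with $x_{t_i}\ge z+\varepsilon/2$ and $x_{s_i}\le z-\varepsilon/2$), and $\mathrm{n}^{z,\varepsilon}:=\mathrm{u}^{z,\varepsilon}+\mathrm{d}^{z,\varepsilon}$. For $a,b\in\mathbb{R}$ put $\langle a,b\rangle:=[a,b)$ if $a\le b$ and $[b,a)$ if $a>b$; $J_t(x,u):=\sum_{0<s\le t}|x_s-u|\,\mathbf{1}_{\langle x_{s-},x_s\rangle}(u)$. $\mathbb{L}^S_p((c_n)_n)$ is the set of $x\in D([0,T];\mathbb{R})$ such that for all $0<t\le T$: (i) the functions $z\mapsto c_n\cdot\mathrm{n}^{z,c_n}(x,[0,t])$ converge weakly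 in $L^p(\mathbb{R})$ as $n\to\infty$; (ii) the functions $z\mapsto J_t(x^n,z)$ converge weakly in $L^p(\mathbb{R})$ to $J_t(x,\cdot)$ as $n\to\infty$. The $L^p$-interval crossing local time of $x$ along $(c_n)_n$ is the function $L:[0,T]\times\mathbb{R}\to\mathbb{R}$ such that $L_t(x,\cdot)$ is the weak limit in (i) for $t\in(0,T]$, with $L_0:=0$. *)

(* Defs.v *)
From HB Require Import structures.
From mathcomp Require Import all_boot all_order all_algebra.
From mathcomp Require Import all_classical all_reals all_analysis.
From mathcomp Require Import measurable_realfun.

Set Implicit Arguments.
Unset Strict Implicit.
Unset Printing Implicit Defensive.

Import Order.TTheory GRing.Theory Num.Theory.
Import numFieldNormedType.Exports.

Local Open Scope classical_set_scope.
Local Open Scope ring_scope.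

(* Paths on [0, T] are total functions R -> R; every definition below depends
   only on their values on [0, T]. *)

Section Paths.
Context {R : realType}.
Implicit Types (T t s u : R) (x y g h : R -> R).

Definition cadlag T x :=
  (forall t, t \in `[0, T[ -> x @ t^'+ --> x t) /\
  (forall t, t \in `]0, T] -> cvg (x @ t^'-)).

(* x_{t-}, with the convention x_{0-} = x_0 *)
Definition left_limit x t : R := if t == 0 then x 0 else lim (x @ t^'-).

Definition jump x t : R := x t - left_limit x t.

(* Delta f(x_t) *)
Definition jump_of (f : R -> R) x t : R := f (x t) - f (left_limit x t).

Definition cadlag_bv T x := cadlag T x /\ bounded_variation 0 T x.

Definition cadlag_nondecreasing T x :=
  cadlag T x /\ {in `[0, T] &, {homo x : s t / s <= t}}.

(* Unconditional sum of a real family; meaningful for summable families. *)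
Definition real_sum (D : set R) (a : R -> R) : R :=
  fine (\esum_(s in D) (Num.max (a s) 0)%:E) -
  fine (\esum_(s in D) (Num.max (- a s) 0)%:E).

End Paths.

Section Stieltjes.
Context {R : realType}.
Implicit Types (T t s u : R) (x y g h : R -> R).

(* g extended from [0, T] to the real line by the constants g 0 and g T, so
   that the measure has no mass outside ]0, T], in particular no atom at 0
   (this is the convention g_{0-} = g_0). *)
Definition freeze T g : R -> R := fun s => g (Num.max 0 (Num.min s T)).

Lemma freezeE T g t : t \in `[0, T] -> freeze T g t = g t.
Proof.
by rewrite in_itv/= => /andP[t0 tT]; rewrite /freeze min_l// max_r.
Qed.

Lemma freeze_nondecreasing T g : cadlag_nondecreasing T g ->
  nondecreasing (freeze T g).
Proof.
move=> [_ ndg] s t st; rewrite /freeze.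
have [T0|T0] := ltP T 0.
  by rewrite !max_l// ge_min (ltW T0) orbT.
have c0T r : Num.max 0 (Num.min r T) \in `[0, T].
  by rewrite in_itv/= le_max lexx ge_max T0 ge_min lexx orbT.
have minst : Num.min s T <= Num.min t T.
  by rewrite le_min !ge_min st lexx orbT.
by apply: ndg => //; rewrite ge_max !le_max lexx minst orbT.
Qed.

Lemma freeze_right_continuous T g : cadlag_nondecreasing T g ->
  right_continuous (freeze T g).
Proof.
move=> [[rcg _] _] t.
have [t0|t0] := ltP t 0.
  apply: cvg_near_cst; near=> s.
  have s0 : s <= 0 by apply: ltW; near: s; exact: nbhs_right_lt.
  by rewrite /freeze !max_l// ge_min ?s0 ?(ltW t0).
have [Tt|tT] := leP T t.
  apply: cvg_near_cst; near=> s.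
  have ts : t <= s by apply: ltW; near: s; exact: nbhs_right_gt.
  by rewrite /freeze (min_r (le_trans Tt ts)) (min_r Tt).
rewrite freezeE ?in_itv/= ?t0 ?(ltW tT)//.
apply: cvg_trans (rcg t _); last by rewrite in_itv/= t0.
apply: near_eq_cvg; near=> s.
rewrite freezeE// in_itv/=; apply/andP; split; apply: ltW.
  by apply: le_lt_trans t0 _; near: s; exact: nbhs_right_gt.
by near: s; exact: nbhs_right_lt.
Unshelve. all: by end_near. Qed.

Definition freeze_cumulative T g (H : cadlag_nondecreasing T g) :
    cumulative R R :=
  HB.pack (freeze T g) (isCumulative.Build R _ R (freeze T g)
    (freeze_nondecreasing H) (freeze_right_continuous H)).

(* dg for g in V^+([0, T]) *)
Definition stieltjes_measure T g : {measure set (measurableTypeR R) -> \bar R} :=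
  if pselect (cadlag_nondecreasing T g) is left H
  then lebesgue_stieltjes_measure (freeze_cumulative H) else mzero.

(* int_(0,t] h dg for g in V^1([0, T]), through the Jordan decomposition
   of g by its positive and negative variations. *)
Definition stieltjes_integral T g h t : R :=
  \int[stieltjes_measure T (fine \o pos_tv 0 g)]_(s in `]0, t]) h s -
  \int[stieltjes_measure T (fine \o neg_tv 0 g)]_(s in `]0, t]) h s.

Lemma stieltjes_measure_itv T g (a b : R) : cadlag_nondecreasing T g ->
  0 <= a -> a <= b -> b <= T ->
  stieltjes_measure T g `]a, b]%classic = (g b - g a)%:E.
Proof.
move=> Hg a0 ab bT; rewrite /stieltjes_measure; case: pselect => // H.
transitivity (wlength (freeze_cumulative H) `]a, b]%classic).
  exact: (measurable_mu_extE (wlength (freeze_cumulative H)) (is_ocitv a b)).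
rewrite wlength_itv_bnd//= !freezeE// in_itv/=.
  by rewrite a0 (le_trans ab).
by rewrite (le_trans a0 ab).
Qed.

Lemma neg_tv_cadlag_nondecreasing T g : cadlag_bv T g ->
  cadlag_nondecreasing T (fine \o neg_tv 0 g).
Proof.
move=> [[rcg _] bvg]; have nd := fine_neg_tv_nondecreasing bvg.
split => //; split => [t|t]; rewrite in_itv/= => /andP[t0 tT].
  by apply: (neg_tv_right_continuous t0 tT bvg); apply: rcg; rewrite in_itv/= t0.
pose n := fine \o neg_tv 0 g.
apply: (@nondecreasing_at_left_is_cvgr _ n).
  near=> c => x y; rewrite !in_itv/= => /andP[cx xt] /andP[cy yt] xy.
  have c0 : 0 < c by near: c; exact: nbhs_left_gt.
  by apply: nd => //; rewrite in_itv/=;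
    rewrite (ltW (lt_trans c0 _))//= ltW// (lt_le_trans _ tT).
near=> c; exists (n t) => _ [x /=] /[!in_itv]/= /andP[cx xt] <-.
have c0 : 0 < c by near: c; exact: nbhs_left_gt.
by apply: nd; rewrite ?in_itv/= ?(ltW t0)//= ?(ltW (lt_trans c0 _))//= ltW//
  (lt_le_trans _ tT).
Unshelve. all: by end_near. Qed.

Lemma cadlag_bvN T g : cadlag_bv T g -> cadlag_bv T (\- g).
Proof.
move=> [[rcg llg] bvg]; split; last exact: bounded_variationN.
split=> t tT; first exact: cvgN (rcg t tT).
exact: is_cvgN (llg t tT).
Qed.

Lemma pos_tv_cadlag_nondecreasing T g : cadlag_bv T g ->
  cadlag_nondecreasing T (fine \o pos_tv 0 g).
Proof. by move=> /cadlag_bvN; exact: neg_tv_cadlag_nondecreasing. Qed.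

End Stieltjes.

Section Skorokhod.
Context {R : realType}.
Implicit Types (T t eps : R) (x y phi : R -> R).

(* (phi, - y) solves the Skorokhod problem for x on [-eps/2, eps/2].  A measure
   is supported in a (not necessarily closed) set when the complement has
   measure zero. *)
Definition skorokhod_solution T x eps phi y :=
  [/\ cadlag T phi /\ cadlag_bv T (\- y),
      forall t, t \in `[0, T] ->
        x t - y t = phi t /\ phi t \in `[- (eps / 2), eps / 2],
      exists yu yd : R -> R,
        [/\ cadlag_nondecreasing T yu,
            cadlag_nondecreasing T yd,
            forall t, t \in `[0, T] -> y t = yu t - yd t,
            stieltjes_measure T yu
              [set t | t \in `]0, T] /\ phi t <> eps / 2] = 0%E &
            stieltjes_measure T yd
              [set t | t \in `]0, T] /\ phi t <> - (eps / 2)] = 0%E] &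
      phi 0 = 0].

(* int_0^t f'(y_{s-}) dx_s, defined by integration by parts *)
Definition deriv_integral T (f : R -> R) y x t : R :=
  derive1 f (y t) * x t - derive1 f (y 0) * x 0
  - stieltjes_integral T (derive1 f \o y) (left_limit x) t
  - real_sum `]0, t] (fun s => jump x s * jump_of (derive1 f) y s).

End Skorokhod.

Section Crossings.
Context {R : realType}.
Implicit Types (t z u eps : R) (x : R -> R).

(* 0 <= a_0 < b_0 < a_1 < ... < a_{n-1} < b_{n-1} <= t *)
Definition crossing_times t (n : nat) (a b : nat -> R) :=
  forall i, (i < n)%N ->
    [/\ 0 <= a i, a i < b i, b i <= t & (i.+1 < n)%N -> b i < a i.+1].

Definition upcrossings x z eps t : \bar R :=
  ereal_sup [set k | exists n (a b : nat -> R), crossing_times t n a b /\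
    k = (\sum_(i < n)
           ((x (a i) <= z - eps / 2) && (z + eps / 2 <= x (b i)))%:R)%:E].

Definition downcrossings x z eps t : \bar R :=
  ereal_sup [set k | exists n (a b : nat -> R), crossing_times t n a b /\
    k = (\sum_(i < n)
           ((z + eps / 2 <= x (a i)) && (x (b i) <= z - eps / 2))%:R)%:E].

Definition crossings x z eps t : \bar R :=
  (upcrossings x z eps t + downcrossings x z eps t)%E.

(* <a, b> *)
Definition between (a b : R) : set R :=
  if a <= b then [set` `[a, b[] else [set` `[b, a[].

Definition jump_overshoot x t u : \bar R :=
  \esum_(s in `]0, t])
    (`|x s - u| * \1_(between (left_limit x s) (x s)) u)%:E.

Definition tanaka_jump_term (f x : R -> R) (s : R) : R :=
  jump_of f x s - derive1 f (left_limit x s) * jump x s.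

Definition tanaka_jump (f x : R -> R) t : R :=
  real_sum `]0, t] (tanaka_jump_term f x).

End Crossings.

Section LpNotions.
Context {R : realType}.
Local Notation mu := (@lebesgue_measure R).

(* Extended-real valued because jump_overshoot may be infinite on a null set *)
Definition in_Lp (p : \bar R) (h : R -> \bar R) :=
  measurable_fun setT h /\ ('N[mu]_p [h] < +oo)%E.

(* Weak convergence in L^p against the dual L^q, where 1/p + 1/q = 1
   (weak-star convergence if p = +oo). *)
Definition weak_Lp_cvg (p q : \bar R) (h : nat -> R -> \bar R)
    (l : R -> \bar R) :=
  [/\ forall n, in_Lp p (h n), in_Lp p l &
      forall g : R -> R, g \in Lfun mu q ->
        (\int[mu]_u (h n u * (g u)%:E))%E @[n --> \oo]
          --> (\int[mu]_u (l u * (g u)%:E))%E].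

(* C_c^oo(R) *)
Definition test_function (eta : R -> R) :=
  (forall n u, derivable (derive1n n eta) u 1) /\
  (exists M : R, forall u, M < `|u| -> eta u = 0).

Definition weak_derivative (k : nat) (f g : R -> R) :=
  [/\ locally_integrable setT f, locally_integrable setT g &
      forall eta, test_function eta ->
        \int[mu]_u (f u * derive1n k eta u) =
        (-1) ^+ k * \int[mu]_u (g u * eta u)].

(* W^{k,q}(R) *)
Definition sobolev (k : nat) (q : \bar R) (f : R -> R) :=
  f \in Lfun mu q /\
  forall j, (0 < j <= k)%N ->
    exists2 g : R -> R, g \in Lfun mu q & weak_derivative j f g.

End LpNotions.

Section LocalTime.
Context {R : realType}.
Implicit Types (T t : R) (p q : \bar R) (c : nat -> R) (x : R -> R).

Definition scaled_crossings c x t (n : nat) (z : R) : \bar R :=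
  ((c n)%:E * crossings x z (c n) t)%E.

(* The class L^S_p((c_n)_n), where q is the conjugate exponent of p *)
Definition LS_class T p q c x :=
  [/\ cadlag T x,
      forall t, t \in `]0, T] ->
        exists l : R -> R, weak_Lp_cvg p q (scaled_crossings c x t) (EFin \o l) &
      forall phi xn : nat -> R -> R,
        (forall n, skorokhod_solution T x (c n) (phi n) (xn n)) ->
        forall t, t \in `]0, T] ->
          weak_Lp_cvg p q (fun n => jump_overshoot (xn n) t)
            (jump_overshoot x t)].

Definition interval_crossing_local_time T p q c x (L : R -> R -> R) :=
  (forall u, L 0 u = 0) /\
  forall t, t \in `]0, T] ->
    weak_Lp_cvg p q (scaled_crossings c x t) (EFin \o L t).

End LocalTime.

(* Main.v *)
(* Fix n and write y = x^n, phi = x - y, c = c_n.  Since f'(b) - f'(a) is the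
   integral of f'' over [a, b[ (signed), every Riemann-Stieltjes sum of x against
   f'(y) is the integral over u of f''(u) times the same sum against the level
   indicator 1_{u < y}.  Splitting x = u + (y - u) + phi in the latter, the first
   part telescopes, the second only sees the jumps of y across u and tends to the
   overshoot J_t(y, u), and the third is c / 2 times the number of changes of
   1_{u < y}, because y moves up only where phi = c / 2 and down only where
   phi = - c / 2.  For almost every u this number of changes differs from the
   number of crossings of the band [u - c / 2, u + c / 2] by x at most by one, so
   integration by parts gives
     | int f'(y_-) dx - (f(y_t) - f(y_0) + f'(y_t) phi_t - int J_t(y, u) f''(u) du
         - 1/2 int c n^{u, c} f''(u) du) |  <=  c / 2 * int_K |f''|
   with K compact and independent of n.  The weak convergence of the crossing
   counts and of the overshoots lets n tend to infinity, and the Taylor formula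
   applied to each jump identifies int J_t(x, u) f''(u) du with the sum of the
   jump terms. *)

Require Import Defs.
From HB Require Import structures.
From mathcomp Require Import all_boot all_order all_algebra.
From mathcomp Require Import all_classical all_reals all_analysis.
From mathcomp Require Import measurable_realfun ess_sup_inf.
From mathcomp Require Import ring lra zify.

Set Implicit Arguments.
Unset Strict Implicit.
Unset Printing Implicit Defensive.

Import Order.TTheory GRing.Theory Num.Theory.
Import numFieldNormedType.Exports.

Local Open Scope classical_set_scope.
Local Open Scope ring_scope.

(** * Smooth bump functions *)

Section SmoothBump.
Context {R : realType}.
Implicit Types (p : {poly R}) (x : R).

(** For fixed [n] the comparison is made level by level along partitions that become finer and
    finer, and it holds for almost every level only. Two countable sets of levels are discarded: the
    values and left limits of [y] at partition points, and the values of local extrema of [y]. At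
    the latter [x] may complete a crossing of the band while [y] merely touches [u], so that no
    change of the indicator is seen. Domination comes from the oscillation of [x]: on a suitable
    finite partition [x] oscillates by at most [c / 2] on each interval, so the number of
    alternations across a band of width [c] is bounded uniformly in [u]. The same bound gives the
    finite variation of [f'(y)]. The integral of the left limits of [x] plus the sum of products of
    jumps weighs a jump of [f'(y)] at [r] by the value of [x] at [r]; hence every partition interval
    from [s] to [r] is split at [r-]. The error [c / 2] does not disappear under refinement, so
    dominated convergence is applied only to the excess over [c / 2]; the error is removed at the
    end by [c_n -> 0]. *)

Lemma is_derive_quadratic (F : R -> R) (C x0 : R) :
  (forall x, `|F x - F x0| <= C * (x - x0) ^+ 2) -> is_derive x0 1 F 0.
Proof.
move=> FC.
have C0 : 0 <= C.
  have := FC (x0 + 1); rewrite addrAC subrr add0r expr1n mulr1.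
  exact: le_trans.
apply/is_derive1_caratheodory.
exists (fun z => if z == x0 then 0 else (F z - F x0) / (z - x0)); split.
- move=> z; case: eqP => [->|/eqP]; first by rewrite !subrr mulr0.
  by rewrite -subr_eq0 => /divfK->.
- rewrite /prop_for /continuous_at eqxx; apply/cvgr0Pnorm_le => e e0; near=> z.
  case: ifPn => [_|zx0]; first by rewrite normr0 ltW.
  rewrite normrM normfV ler_pdivrMr ?normr_gt0 ?subr_eq0//.
  apply: le_trans (FC z) _; rewrite -real_normK ?num_real// expr2 mulrA.
  apply: ler_wpM2r => //.
  have : `|x0 - z| <= e / (C + 1).
    apply: ltW; near: z; apply: (@nbhsx_ballx _ _ x0 (e / (C + 1))).
    by rewrite divr_gt0//; lra.
  rewrite ler_pdivlMr; last lra.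
  rewrite distrC mulrC; apply: le_trans.
  by rewrite ler_wpM2r// lerDl.
- by rewrite eqxx.
Unshelve. all: by end_near. Qed.

(* The derivatives of exp (-1 / (x (1 - x))) on ]0, 1[, extended by 0, all have
   this form. *)
Definition bump_family p k x : R :=
  if 0 < x < 1 then p.[x] * (x * (1 - x)) ^- k * expR (- (x * (1 - x))^-1)
  else 0.

Lemma bump_familyE p k x : 0 < x < 1 ->
  bump_family p k x = p.[x] * (x * (1 - x)) ^- k * expR (- (x * (1 - x))^-1).
Proof. by rewrite /bump_family => ->. Qed.

(** With [w = x (1 - x)], the exponential series gives [exp (1/w) >= (1/w)^(k+2) / (k+2)!], hence
    [w^-k exp (-1/w) <= (k+2)! w^2]; the polynomial is at most the sum of its absolute coefficients.
    The square makes the derivative vanish at both endpoints. *)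
Lemma bump_family_le p k : exists2 C, 0 <= C &
  forall x, 0 < x < 1 -> `|bump_family p k x| <= C * (x * (1 - x)) ^+ 2.
Proof.
pose A := \sum_(i < size p) `|p`_i|.
exists (A * (k.+2)`!%:R); first by rewrite mulr_ge0// sumr_ge0.
move=> x /[dup] x01 /andP[x0 x1]; rewrite bump_familyE// !normrM -mulrA -mulrA.
have x1' : 0 < 1 - x by rewrite subr_gt0.
have w0 : 0 < x * (1 - x) by rewrite mulr_gt0.
apply: ler_pM => //.
  rewrite horner_coef; apply: le_trans (ler_norm_sum _ _ _) _.
  apply: ler_sum => i _; rewrite normrM ler_piMr// normrX exprn_ile1//.
  by rewrite ger0_norm ltW.
rewrite gtr0_norm ?invr_gt0 ?exprn_gt0// gtr0_norm ?expR_gt0// expRN.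
rewrite -invfM invf_ple ?posrE ?mulr_gt0 ?exprn_gt0 ?expR_gt0 ?ltr0n ?fact_gt0//.
rewrite invfM mulrC.
apply: (@le_trans _ _ ((x * (1 - x)) ^+ k *
    ((x * (1 - x))^-1 ^+ k.+2 / (k.+2)`!%:R))); last first.
  rewrite ler_pM2l; last exact: exprn_gt0.
  apply: le_trans (@expR_ge1Dxn R _ k.+1 _).
    by rewrite lerDr.
  by rewrite invr_ge0 ltW.
rewrite mulrA ler_pM2r ?invr_gt0 ?ltr0n ?fact_gt0//.
move: w0; move: (x * (1 - x)) => w w0.
suff -> : w ^+ k * w^-1 ^+ k.+2 = w ^- 2 by [].
rewrite exprVn -(addn2 k) exprD invfM mulrA divff ?mul1r// expf_neq0//.
by rewrite gt_eqF.
Qed.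

Lemma bump_family_out p k x : ~~ (0 < x < 1) -> bump_family p k x = 0.
Proof. by rewrite /bump_family => /negbTE ->. Qed.

(** The numerator left after differentiating [p w^-k exp (-1/w)] and factoring out
    [w^-(k+2) exp (-1/w)]. *)
Definition bump_family' p k : {poly R} :=
  let w := 'X * (1 - 'X) : {poly R} in
  p^`() * w ^+ 2 - (p * w * w^`()) *+ k + p * w^`().

Lemma bump_family_edge p k x0 : x0 = 0 \/ x0 = 1 ->
  is_derive x0 1 (bump_family p k) 0.
Proof.
move=> x0E; have [C C0 FC] := bump_family_le p k.
apply: (@is_derive_quadratic _ C) => x.
rewrite [bump_family p k x0]bump_family_out ?subr0; last first.
  by case: x0E => ->; rewrite ltxx ?andbF.
have [x01|x01] := boolP (0 < x < 1); last first.
  by rewrite bump_family_out// normr0 mulr_ge0// sqr_ge0.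
apply: le_trans (FC _ x01) _; apply: ler_wpM2l => //.
move/andP: x01 => [x_gt0 x_lt1].
have w_ge0 : 0 <= x * (1 - x) by rewrite mulr_ge0// ?subr_ge0 ltW.
case: x0E => ->; first by rewrite subr0 ler_sqr ?nnegrE// ?ltW//; nra.
by rewrite -[leRHS]sqrrN opprB ler_sqr ?nnegrE ?subr_ge0// ?ltW//; nra.
Qed.

Lemma is_derive_bump_family p k x :
  is_derive x 1 (bump_family p k) (bump_family (bump_family' p k) k.+2 x).
Proof.
have [/andP[x0 x1]|] := boolP (0 < x < 1); last first.
  move=> nx01; rewrite (bump_family_out _ _ nx01).
  have [x0E|] := pselect (x = 0 \/ x = 1); first exact: bump_family_edge.
  move=> x01; apply: (@near_eq_is_derive _ _ _ (cst 0)).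
    have : x < 0 \/ 1 < x.
      case: (ltgtP x 0) => [|x0|x0]; [by left| |by exfalso; apply: x01; left].
      by right; case: (ltgtP x 1) => // x1;
        [rewrite x0 x1 in nx01|exfalso; apply: x01; right].
    case => xx; near=> y; rewrite bump_family_out//.
      rewrite negb_and -leNgt ltW//.
      by near: y; exact: lt_nbhsl.
    rewrite negb_and -!leNgt orbC ltW//.
    by near: y; exact: lt_nbhsr.
have [w wdef] : exists w : {poly R}, w = 'X * (1 - 'X) by exists ('X * (1 - 'X)).
have wE y : w.[y] = y * (1 - y) by rewrite wdef !hornerE.
have w0 : w.[x] != 0 by rewrite wE mulf_neq0// ?subr_eq0 gt_eqF.
have Dw := is_derive_poly w x.
have DV := is_deriveV w0 Dw.
have DE := @is_derive1_comp _ expR (fun y => - (w.[y])^-1) x _ _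
  (is_derive_expR _) (is_deriveN DV).
have D := is_deriveM (is_deriveM (is_derive_poly p x) (is_deriveX k DV)) DE.
apply: near_eq_is_derive (is_derive_eq D _).
  near=> y; rewrite bump_familyE -?wE.
    by rewrite !fctE/= exprVn.
  by apply/andP; split; near: y; [exact: lt_nbhsr|exact: lt_nbhsl].
rewrite bump_familyE ?x0// -wE /bump_family' -wdef !fctE/= /GRing.scale/=.
rewrite !(hornerD, hornerN, hornerMn, hornerM, horner_exp) !exprVn.
clear D DE DV Dw wdef wE.
move: (expR (- w.[x]^-1)) p^`().[x] w^`().[x] p.[x] w.[x] w0 => E p' w' P W W0.
rewrite -mulr_natl; case: k => [|k]; first by rewrite !expr0; field.
by rewrite !exprS/=; field; rewrite W0 expf_neq0.
Unshelve. all: by end_near. Qed.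

Definition bump := bump_family 1 0.

Lemma derive1n_bump n : exists p k, derive1n n bump = bump_family p k.
Proof.
elim: n => [|n [p [k IH]]]; first by exists 1, 0%N.
exists (bump_family' p k), k.+2; rewrite derive1nS IH.
apply/funext => x; rewrite derive1E.
by have [_ ->] := is_derive_bump_family p k x.
Qed.

Lemma derivable_derive1n_bump n x : derivable (derive1n n bump) x 1.
Proof.
have [p [k ->]] := derive1n_bump n.
by have [] := is_derive_bump_family p k x.
Qed.

Lemma continuous_bump : continuous bump.
Proof.
by move=> x; apply/differentiable_continuous/derivable1_diffP;
  exact: (@derivable_derive1n_bump 0%N x).
Qed.

Lemma bump_ge0 x : 0 <= bump x.
Proof.
rewrite /bump /bump_family; case: ifP => // _.
by rewrite hornerC expr0 invr1 !mul1r expR_ge0.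
Qed.

Lemma bump_gt0 x : 0 < x < 1 -> 0 < bump x.
Proof.
by move=> x01; rewrite /bump bump_familyE// hornerC expr0 invr1 !mul1r expR_gt0.
Qed.

Lemma bump_out x : ~~ (0 < x < 1) -> bump x = 0.
Proof. exact: bump_family_out. Qed.

Local Notation mu := (@lebesgue_measure R).

Lemma integrable_bump : mu.-integrable setT (EFin \o bump).
Proof.
have -> : EFin \o bump = (EFin \o bump) \_ `[0, 1].
  apply/funext => x; rewrite patchE; case: ifPn => //= /negP xn.
  rewrite bump_out//; apply/negP => /andP[x0 x1]; apply: xn.
  by rewrite inE/= in_itv/= !ltW.
apply/integrable_restrict => //; rewrite setTI.
apply: continuous_compact_integrable; first exact: segment_compact.
exact: continuous_subspaceT continuous_bump.
Qed.

(** A smooth transition from [0] up to the point [0] to the constant [step 1 > 0] from [1] on. It is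
    not normalised, so the limits below carry a factor [step 1]. *)
Definition step x := \int[mu]_(t in `]-oo, x]) bump t.

Lemma derivable_step x : derivable step x 1 /\ derive1 step x = bump x.
Proof.
apply: (@continuous_FTC1 _ bump -oo%O x (x + 1)) => //.
- by rewrite ltrDl.
- by apply: integrableS integrable_bump.
- by rewrite ltNyr.
- exact: continuous_bump.
Qed.

Lemma derive1_step : derive1 step = bump.
Proof. by apply/funext => x; have [] := derivable_step x. Qed.

Lemma is_derive_step x : is_derive x 1 step (bump x).
Proof. by have [d e] := derivable_step x; apply: DeriveDef; [exact: d|rewrite -derive1E]. Qed.

Lemma continuous_step : continuous step.
Proof.
by move=> x; apply/differentiable_continuous/derivable1_diffP; case: (derivable_step x).
Qed.

Lemma step0 x : x <= 0 -> step x = 0.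
Proof.
move=> x0; rewrite /step; under eq_Rintegral.
  move=> t; rewrite inE/= in_itv/= => tx; rewrite bump_out; last first.
    by rewrite negb_and -leNgt (le_trans tx).
  over.
by rewrite Rintegral_cst// mul0r.
Qed.

Lemma stepB x y : x < y -> exists2 c, c \in `]x, y[ & step y - step x = bump c * (y - x).
Proof.
move=> xy; apply: (@MVT R step bump x y xy (fun z _ => is_derive_step z)).
exact/continuous_subspaceT/continuous_step.
Qed.

Lemma step_nondecreasing : {homo step : x y / x <= y}.
Proof.
move=> x y; rewrite le_eqVlt => /predU1P[->//|xy].
have [c _ e] := stepB xy.
by rewrite -subr_ge0 e mulr_ge0 ?bump_ge0// subr_ge0 ltW.
Qed.

Lemma step_gt1 x : 1 <= x -> step x = step 1.
Proof.
rewrite le_eqVlt => /predU1P[->//|x1].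
have [c /[!in_itv]/= /andP[c1 _]] := stepB x1.
rewrite bump_out ?mul0r; first by move/eqP; rewrite subr_eq0 => /eqP.
by rewrite negb_and -!leNgt (ltW c1) orbT.
Qed.

Lemma step1_gt0 : 0 < step 1.
Proof.
have [c /[!in_itv]/= c01] := stepB (@ltr01 R).
by rewrite (@step0 0)// !subr0 => ->; rewrite mulr1 bump_gt0.
Qed.

Lemma step_ge0 x : 0 <= step x.
Proof.
by have [x0|/ltW x0] := leP x 0; [rewrite step0|rewrite -(@step0 0)// step_nondecreasing].
Qed.

Lemma step_le1 x : step x <= step 1.
Proof.
by have [x1|/ltW x1] := leP x 1; [rewrite step_nondecreasing|rewrite step_gt1].
Qed.

Definition smooth (h : R -> R) := forall n u, derivable (derive1n n h) u 1.

Lemma smooth_step : smooth step.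
Proof.
move=> [|n] u; first by have [] := derivable_step u.
rewrite /derive1n iterSr derive1_step; exact: derivable_derive1n_bump.
Qed.

Lemma derive1n_step_out n x : ~~ (0 < x < 1) -> derive1n n.+1 step x = 0.
Proof.
rewrite /derive1n iterSr derive1_step -/(derive1n n bump).
have [p [k ->]] := derive1n_bump n; exact: bump_family_out.
Qed.

Lemma derive1n_affine (h : R -> R) a d n : smooth h ->
  derive1n n (fun u => h (d * (u - a))) =
  fun u => d ^+ n * derive1n n h (d * (u - a)).
Proof.
move=> sh; elim: n => [|n IH]; first by apply/funext => u; rewrite expr0 mul1r.
rewrite derive1nS IH; apply/funext => u.
have Dh : is_derive (d * (u - a)) 1 (derive1n n h) (derive1n n.+1 h (d * (u - a))).
  by split; [exact: sh|rewrite derive1nS derive1E].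
have Da : is_derive u 1 (fun u : R => d * (u - a)) d.
  by apply: is_derive_eq; rewrite /GRing.scale/= subr0 mulr1.
have := is_deriveZ (d ^+ n) (@is_derive1_comp _ _ (fun u : R => d * (u - a)) _ _ _ Dh Da).
rewrite derive1E => -[_ ->].
by rewrite exprSr -mulrA [d * derive1n _ _ _]mulrC.
Qed.

Lemma smooth_affine (h : R -> R) a d : smooth h ->
  smooth (fun u => h (d * (u - a))).
Proof.
move=> sh n u; rewrite derive1n_affine//.
have Dh : is_derive (d * (u - a)) 1 (derive1n n h) (derive1n n.+1 h (d * (u - a))).
  by split; [exact: sh|rewrite derive1nS derive1E].
have Da : is_derive u 1 (fun u : R => d * (u - a)) d.
  by apply: is_derive_eq; rewrite /GRing.scale/= subr0 mulr1.
by have [] := is_deriveZ (d ^+ n) (@is_derive1_comp _ _ (fun u : R => d * (u - a)) _ _ _ Dh Da).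
Qed.

Lemma derive1nB (h k : R -> R) n : smooth h -> smooth k ->
  derive1n n (h \- k) = derive1n n h \- derive1n n k.
Proof.
move=> sh sk; elim: n => [//|n IH]; rewrite !derive1nS IH.
apply/funext => u; rewrite derive1E deriveB; [|exact: sh|exact: sk].
by rewrite -!derive1E.
Qed.

Lemma smoothB (h k : R -> R) : smooth h -> smooth k -> smooth (h \- k).
Proof. by move=> sh sk n u; rewrite derive1nB//; exact: derivableB. Qed.

End SmoothBump.

(** * Integration against a weak second derivative *)

Section RDominated.
Context d (T : measurableType d) {R : realType}.
Variable mu : {measure set T -> \bar R}.

Lemma Rintegral_dominated_cvg (D : set T) (h : nat -> T -> R) (l g : T -> R) :
  measurable D -> (forall n, measurable_fun D (h n)) -> measurable_fun D l ->
  {ae mu, forall x, D x -> h ^~ x @ \oo --> l x} ->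
  mu.-integrable D (EFin \o g) ->
  {ae mu, forall x, D x -> forall n, `|h n x| <= g x} ->
  (\int[mu]_(x in D) h n x) @[n --> \oo] --> \int[mu]_(x in D) l x.
Proof.
move=> mD mh ml hl ig hg.
have [|||||il _ cv] := @dominated_convergence _ _ _ mu D mD
  (fun n => EFin \o h n) (EFin \o l) (EFin \o g).
- by move=> n; exact/measurable_EFinP.
- exact/measurable_EFinP.
- apply: filterS hl => x hx Dx; apply: cvg_EFin; last exact: hx.
  exact: nearW.
- by [].
- by apply: filterS hg => x hx n Dx; rewrite /= lee_fin; exact: hx.
apply: fine_cvg; rewrite fineK//.
exact: integrable_fin_num.
Qed.

Lemma ae_eq_Rintegral (D : set T) (f g : T -> R) : measurable D ->
  measurable_fun D f -> measurable_fun D g ->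
  {ae mu, forall x, D x -> f x = g x} ->
  \int[mu]_(x in D) f x = \int[mu]_(x in D) g x.
Proof.
move=> mD mf mg fg; congr fine; apply: ae_eq_integral => //.
- exact/measurable_EFinP.
- exact/measurable_EFinP.
- by apply: filterS fg => x /[apply] /= ->.
Qed.

Lemma ae_le_Rintegral (D : set T) (f g : T -> R) : measurable D ->
  mu.-integrable D (EFin \o f) -> mu.-integrable D (EFin \o g) ->
  {ae mu, forall x, D x -> f x <= g x} ->
  \int[mu]_(x in D) f x <= \int[mu]_(x in D) g x.
Proof.
move=> mD fi gi fg.
have mf : measurable_fun D f by apply/measurable_EFinP; exact: measurable_int fi.
have mg : measurable_fun D g by apply/measurable_EFinP; exact: measurable_int gi.
rewrite -subr_ge0 -RintegralB//.
rewrite (@ae_eq_Rintegral _ _ (fun x => Num.max (g x - f x) 0))//.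
- by apply: Rintegral_ge0 => x _; rewrite le_max lexx orbT.
- exact: measurable_funB.
- by apply: measurable_maxr => //; exact: measurable_funB.
- by apply: filterS fg => x /[apply] xfg; rewrite max_l// subr_ge0.
Qed.

Lemma integrableZl_EFin (D : set T) (f : T -> R) k : measurable D ->
  mu.-integrable D (EFin \o f) -> mu.-integrable D (EFin \o (fun x => k * f x)).
Proof. by move=> mD /(integrableZl mD k). Qed.

End RDominated.

Section WeakDerivative.
Context {R : realType}.
Implicit Types (f g : R -> R) (a b d u : R).
Local Notation mu := (@lebesgue_measure R).

(** As [d] grows this tends pointwise to [step 1] times the indicator of []a, b]]: each transition
    starts at its endpoint and takes place to the right of it. *)
Definition mollified_itv a b (d : R) u := step (d * (u - a)) - step (d * (u - b)).

Lemma mollified_itv_test a b d : a < b -> 1 <= d ->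
  test_function (mollified_itv a b d).
Proof.
move=> ab d1; split.
  by apply: smoothB; apply: smooth_affine; exact: smooth_step.
have d0 : 0 < d by lra.
exists (`|a| + `|b| + 1) => u; rewrite lter_normr => /orP[ua|ua].
  have ua' : a + 1 <= u by have := ler_norm a; have := normr_ge0 b; lra.
  have ub' : b + 1 <= u by have := ler_norm b; have := normr_ge0 a; lra.
  by rewrite /mollified_itv step_gt1 ?[step (_ * (u - b))]step_gt1 ?subrr//; nra.
have ua' : u <= a by have := ler_norm (- a); rewrite normrN; have := normr_ge0 b; lra.
have ub' : u <= b by lra.
by rewrite /mollified_itv step0 ?[step (_ * (u - b))]step0 ?subrr//; nra.
Qed.

Lemma is_derive_mollified_itv a b d u : is_derive u 1 (mollified_itv a b d)
  (d * bump (d * (u - a)) - d * bump (d * (u - b))).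
Proof.
have H z : is_derive u 1 (fun u : R => step (d * (u - z))) (d * bump (d * (u - z))).
  have Da : is_derive u 1 (fun u : R => d * (u - z)) d.
    by apply: is_derive_eq; rewrite /GRing.scale/= subr0 mulr1.
  rewrite mulrC.
  exact: (@is_derive1_comp _ _ (fun u : R => d * (u - z)) _ _ _ (is_derive_step _) Da).
exact: is_deriveB.
Qed.

Lemma derive1_mollified_itv a b d : derive1 (mollified_itv a b d) =
  (fun u => d * bump (d * (u - a)) - d * bump (d * (u - b))).
Proof.
apply/funext => u; rewrite derive1E.
by have [_ ->] := is_derive_mollified_itv a b d u.
Qed.

Lemma derivable_oo_LR (F : R -> R) a b : (forall u, derivable F u 1) ->
  derivable_oo_LRcontinuous F a b.
Proof.
move=> dF; have cF : continuous F.
  by move=> u; apply/differentiable_continuous/derivable1_diffP; exact: dF.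
split; first by move=> u _; exact: dF.
  exact: cvg_at_right_filter (cF a).
exact: cvg_at_left_filter (cF b).
Qed.

Lemma near_infty_ltS (z : R) : \forall n \near \oo, z < n.+1%:R.
Proof.
near=> n; apply: (@lt_trans _ _ n%:R); last by rewrite ltr_nat.
by near: n; exact: nbhs_infty_gtr.
Unshelve. all: by end_near. Qed.

(* The approximate identity d * bump (d (u - a)), of mass step 1, is located in [a, a + 1/d] *)
Lemma cvg_bump_mean (h : R -> R) a A B : continuous h -> A < a -> a < B ->
  (\int[mu]_(u in `[A, B]) (h u * (n.+1%:R * bump (n.+1%:R * (u - a)))))
    @[n --> \oo] --> h a * step 1.
Proof.
move=> ch Aa aB; pose k n u : R := n.+1%:R * bump (n.+1%:R * (u - a)).
have AB : A < B by exact: lt_trans aB.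
have Dk n u : is_derive u 1 (fun u : R => n.+1%:R * (u - a)) n.+1%:R.
  by apply: is_derive_eq; rewrite /GRing.scale/= subr0 mulr1.
have ck n : continuous (k n).
  move=> u; apply: cvgM; first exact: cvg_cst.
  apply: (@continuous_comp _ _ _ (fun u : R => n.+1%:R * (u - a)) bump).
    apply/differentiable_continuous/derivable1_diffP.
    by have [] := Dk n u.
  exact: continuous_bump.
have ik n (h' : R -> R) : continuous h' ->
    mu.-integrable `[A, B] (EFin \o (fun u => h' u * k n u)).
  move=> ch'; apply: continuous_compact_integrable; first exact: segment_compact.
  by apply: continuous_subspaceT => u; apply: cvgM; [exact: ch'|exact: ck].
have ccst (c : R) : continuous (cst c : R -> R) by move=> ?; exact: cvg_cst.
have ik1 n : mu.-integrable `[A, B] (EFin \o k n).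
  apply: continuous_compact_integrable; first exact: segment_compact.
  exact: continuous_subspaceT.
have k_mass : \forall n \near \oo, \int[mu]_(u in `[A, B]) k n u = step 1.
  near=> n.
  have Ds u : is_derive u 1 (fun u => step (n.+1%:R * (u - a))) (k n u).
    rewrite /k mulrC.
    exact: (@is_derive1_comp _ _ (fun u : R => n.+1%:R * (u - a)) _ _ _ (is_derive_step _) (Dk _ _)).
  rewrite /Rintegral (@continuous_FTC2 _ _ (fun u => step (n.+1%:R * (u - a))))//=.
  - rewrite [step (_ * (A - a))]step0 ?subr0; last by rewrite mulr_ge0_le0// subr_le0 ltW.
    apply: step_gt1; rewrite -ler_pdivrMr ?subr_gt0//; apply: ltW.
    by rewrite mul1r; near: n; exact: near_infty_ltS.
  - exact: continuous_subspaceT.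
  - by apply: derivable_oo_LR => u; have [] := Ds u.
  - by move=> u _; rewrite derive1E; have [_ ->] := Ds u.
apply/cvgrPdist_le => e e0.
have e1 : 0 < e / step 1 by rewrite divr_gt0// step1_gt0.
have /cvgrPdist_le/(_ _ e1)/= := ch a.
move=> /(@nbhs_ballP _ R)[r/= r0 hr].
near=> n.
have mass : \int[mu]_(u in `[A, B]) k n u = step 1 by near: n.
rewrite -mass -RintegralZl//.
rewrite -RintegralB//; [|exact: ik (ccst _)|exact: ik].
have iB : mu.-integrable `[A, B] (EFin \o (fun u => h a * k n u - h u * k n u)).
  rewrite (_ : EFin \o _ = EFin \o (fun u => (h a - h u) * k n u)); last first.
    by apply/funext => u; rewrite /= mulrBl.
  by apply: (@ik n (fun u => h a - h u)) => u; apply: cvgB; [exact: cvg_cst|exact: ch].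
apply: le_trans (le_normr_Rintegral _ _) _ => //.
apply: (@le_trans _ _ (\int[mu]_(u in `[A, B]) (e / step 1 * k n u))).
  apply: le_Rintegral => //; [exact: integrable_norm|exact: ik (ccst _)|].
  move=> u _; rewrite -mulrBl normrM [X in _ * X]ger0_norm; last first.
    by rewrite mulr_ge0// bump_ge0.
  have [au|] := boolP (0 < n.+1%:R * (u - a) < 1); last first.
    by move=> out; rewrite /k bump_out// !mulr0.
  apply: ler_wpM2r; first by rewrite mulr_ge0// bump_ge0.
  apply: hr; rewrite /ball/=; move: au => /andP[]; rewrite pmulr_rgt0// => au.
  rewrite mulrC -ltr_pdivlMr// => ua; rewrite distrC gtr0_norm//.
  apply: lt_trans ua _; rewrite mul1r invf_plt ?posrE//.
  by near: n; exact: near_infty_ltS.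
rewrite RintegralZl//.
by rewrite mass divfK// gt_eqF// step1_gt0.
Unshelve. all: by end_near. Qed.

Lemma Rintegral_support (D : set R) f : (forall u, ~ D u -> f u = 0) ->
  \int[mu]_u f u = \int[mu]_(u in D) f u.
Proof.
move=> fD; rewrite [RHS]Rintegral_mkcond; congr Rintegral.
apply/funext => u; rewrite patchE; case: ifPn => // /negP uD.
by apply: fD => Du; apply: uD; rewrite inE.
Qed.

Lemma locally_integrable_itv f a b : locally_integrable setT f ->
  mu.-integrable `[a, b] (EFin \o f).
Proof.
move=> [mf _ lf]; apply/integrableP; split.
  by apply/measurable_EFinP; exact: measurable_funS mf.
by apply: lf => //; exact: segment_compact.
Qed.

(** The weak equation is tested against mollified indicators of []a, b]]. As [f] is C^1, one
    derivative moves back to [f] by classical integration by parts; then [f'] is integrated against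
    approximate Dirac masses at [a] and [b], while [g] is integrated against the mollified
    indicator. The factor [step 1] cancels. *)
Lemma weak_derivative2_increment f g a b : (forall u, derivable f u 1) ->
  continuous (derive1 f) -> weak_derivative 2 f g -> a < b ->
  derive1 f b - derive1 f a = \int[mu]_(u in `]a, b]) g u.
Proof.
(* For [d >= 1] the transitions end at most one unit to the right of [a] and [b]; at [A] and [B] the
   derivative of the test function vanishes and there is no boundary term. *)
move=> df cf [lf lg wf] ab; pose A := a - 1; pose B := b + 2.
have [Aa aB] : A < a /\ a < B by rewrite /A /B; lra.
have [Ab bB] : A < b /\ b < B by rewrite /A /B; lra.
have AB : A < B by exact: lt_trans aB.
pose eta n := mollified_itv a b n.+1%:R.
have n1 n : 1 <= n.+1%:R :> R by rewrite ler1n.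
have teta n : test_function (eta n) by exact: mollified_itv_test.
have eta_le n u : `|eta n u| <= step 1.
  rewrite /eta /mollified_itv ler_norml.
  have := step_ge0 (n.+1%:R * (u - a)); have := step_le1 (n.+1%:R * (u - a)).
  have := step_ge0 (n.+1%:R * (u - b)); have := step_le1 (n.+1%:R * (u - b)).
  by move=> *; apply/andP; split; lra.
have ceta n : continuous (eta n).
  by move=> u; apply/differentiable_continuous/derivable1_diffP; exact: ((teta n).1 0%N).
have ceta' n : continuous (derive1 (eta n)).
  by move=> u; apply/differentiable_continuous/derivable1_diffP; exact: ((teta n).1 1%N).
have ceta'' n : continuous (derive1n 2 (eta n)).
  by move=> u; apply/differentiable_continuous/derivable1_diffP; exact: ((teta n).1 2%N).
have out n u z : ~ `[A, B]%classic u -> z = a \/ z = b -> ~~ (0 < n.+1%:R * (u - z) < 1).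
  rewrite /= in_itv/= => /negP uAB zab; apply: contra uAB => /andP[].
  rewrite pmulr_rgt0// subr_gt0 => zu; rewrite -ltr_pdivlMl// mulr1 => uz.
  have : n.+1%:R^-1 <= 1 :> R by rewrite invf_le1.
  move: uz; move: (n.+1%:R^-1) => v uz.
  by move: zu uz; rewrite /A /B; case: zab => -> zu uz i1; apply/andP; split; lra.
have eta''out n u : ~ `[A, B]%classic u -> derive1n 2 (eta n) u = 0.
  move=> uAB; rewrite /eta /mollified_itv derive1nB; try
    by apply: smooth_affine; exact: smooth_step.
  rewrite !derive1n_affine; try exact: smooth_step.
  have H z : z = a \/ z = b -> derive1n 2 (@step R) (n.+1%:R * (u - z)) = 0.
    by move=> zab; apply: (@derive1n_step_out _ 1); exact: out.
  transitivity (0 - 0 : R); last by rewrite subrr.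
  by congr (_ - _); rewrite H ?mulr0//; [left|right].
have eta'A n z : z = A \/ z = B -> derive1 (eta n) z = 0.
  move=> zAB; rewrite /eta derive1_mollified_itv !bump_out ?mulr0 ?subrr//.
    rewrite negb_and -!leNgt; case: zAB => ->.
      by rewrite pmulr_rle0// subr_le0 ltW.
    by apply/orP; right; have := n1 n; rewrite /B; nra.
  rewrite negb_and -!leNgt; case: zAB => ->.
    by rewrite pmulr_rle0// subr_le0 ltW.
  by apply/orP; right; have := n1 n; rewrite /B; nra.
have etaout n u : ~ `[A, B]%classic u -> eta n u = 0.
  rewrite /= in_itv/= => /negP; rewrite negb_and -!ltNge => /orP[uA|Bu].
    rewrite /eta /mollified_itv !step0 ?subrr//; rewrite mulr_ge0_le0//; lra.
  rewrite /eta /mollified_itv step_gt1 ?[step (_ * (u - b))]step_gt1 ?subrr//;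
    have := n1 n; rewrite /B in Bu; nra.
have E n : \int[mu]_(u in `[A, B]) (derive1 f u * derive1 (eta n) u) =
    - \int[mu]_(u in `[A, B]) (g u * eta n u).
  have := wf _ (teta n); rewrite expr2 mulrNN mulr1 mul1r.
  rewrite (@Rintegral_support `[A, B]); last by move=> u uAB; rewrite eta''out ?mulr0.
  rewrite (@Rintegral_support `[A, B] (fun u => g u * _)); last by move=> u uAB; rewrite etaout ?mulr0.
  rewrite (@Rintegration_by_parts _ f (derive1 (eta n)) (derive1 f)).
  - rewrite (eta'A _ A (or_introl erefl)) (eta'A _ B (or_intror erefl)).
    by rewrite !mulr0 subr0 sub0r => <-; rewrite opprK.
  - exact: AB.
  - exact: continuous_subspaceT cf.
  - exact: derivable_oo_LR df.
  - by move=> u _; reflexivity.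
  - exact: continuous_subspaceT (ceta'' n).
  - by apply: derivable_oo_LR => u; exact: ((teta n).1 1%N).
  - by move=> u _; reflexivity.
have ibump n z : mu.-integrable `[A, B]
    (EFin \o (fun u => derive1 f u * (n.+1%:R * bump (n.+1%:R * (u - z))))).
  apply: continuous_compact_integrable; first exact: segment_compact.
  apply: continuous_subspaceT => u; apply: cvgM; first exact: cf.
  apply: cvgM; first exact: cvg_cst.
  apply: (@continuous_comp _ _ _ (fun u : R => n.+1%:R * (u - z)) bump).
    by apply: cvgM; [exact: cvg_cst|apply: cvgB; [exact: cvg_id|exact: cvg_cst]].
  exact: continuous_bump.
have L1 : \int[mu]_(u in `[A, B]) (derive1 f u * derive1 (eta n) u) @[n --> \oo] -->
    derive1 f a * step 1 - derive1 f b * step 1.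
  apply: cvg_trans (cvgB (cvg_bump_mean cf Aa aB) (cvg_bump_mean cf Ab bB)).
  apply: near_eq_cvg; apply/nearW => n.
  rewrite !fctE/= -RintegralB//; apply: eq_Rintegral => u _.
  by rewrite derive1_mollified_itv/=; ring.
have L2 : \int[mu]_(u in `[A, B]) (g u * eta n u) @[n --> \oo] -->
    \int[mu]_(u in `[A, B]) (step 1 * (g \_ `]a, b]) u).
  have ig := locally_integrable_itv A B lg.
  have mg : measurable_fun `[A, B] g by apply/measurable_EFinP; exact: measurable_int ig.
  apply: (@Rintegral_dominated_cvg _ _ _ mu `[A, B]%classic
    (fun n u => g u * eta n u) (fun u => step 1 * (g \_ `]a, b]) u)
    (fun u => step 1 * `|g u|)) => //.
  - move=> n; apply: measurable_funM => //; apply: measurable_funTS.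
    exact: continuous_measurable_fun.
  - apply: measurable_funM => //; apply/measurable_restrict => //.
    by apply: measurable_funS mg => //; exact: measurableI.
  - apply/aeW => u uAB.
    rewrite patchE mem_setE in_itv/= (_ : point = 0 :> R)//; case: (leP u a) => au/=.
      apply: cvg_near_cst; apply/nearW => n.
      rewrite /eta /mollified_itv [step (_ * (u - a))]step0; last first.
        by rewrite mulr_ge0_le0// subr_le0.
      rewrite [step (_ * (u - b))]step0; last first.
        by rewrite mulr_ge0_le0// subr_le0 (le_trans au)// ltW.
      by rewrite subrr !mulr0.
    have sa : \forall n \near \oo, step (n.+1%:R * (u - a)) = step 1.
      near=> n; apply: step_gt1; rewrite -ler_pdivrMr ?subr_gt0//; apply: ltW.
      by rewrite mul1r; near: n; exact: near_infty_ltS.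
    case: (leP u b) => ub.
      apply: cvg_near_cst; near=> n; rewrite /eta /mollified_itv.
      rewrite (step0 (x := _ * (u - b))) ?subr0; last by rewrite mulr_ge0_le0// subr_le0.
      by rewrite mulrC; congr (_ * _); near: n.
    apply: cvg_near_cst; near=> n; rewrite /eta /mollified_itv.
    rewrite (near sa n)//.
    rewrite step_gt1 ?subrr ?mulr0// -ler_pdivrMr ?subr_gt0//; apply: ltW.
    by rewrite mul1r; near: n; exact: near_infty_ltS.
  - by apply: integrableZl_EFin => //; exact: integrable_norm.
  - by apply/aeW => u _ n; rewrite normrM mulrC ler_wpM2r.
have L3 : (- \int[mu]_(u in `[A, B]) (g u * eta n u)) @[n --> \oo] -->
    derive1 f a * step 1 - derive1 f b * step 1.
  by apply: cvg_trans L1; apply: near_eq_cvg; apply/nearW => n; rewrite /= E.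
have : derive1 f a * step 1 - derive1 f b * step 1 =
    - \int[mu]_(u in `[A, B]) (step 1 * (g \_ `]a, b]) u).
  by apply: (cvg_unique (@Rhausdorff R) L3); exact: cvgN L2.
rewrite RintegralZl//; last first.
  rewrite -restrict_EFin; apply/integrable_restrict => //.
  apply: integrableS (locally_integrable_itv A B lg) => //; exact: measurableI.
rewrite -Rintegral_mkcondr setIidr; last first.
  by move=> u/=; rewrite !in_itv/= => /andP[??]; apply/andP; split; lra.
rewrite -mulrBl mulrC -mulrN => /(mulfI (lt0r_neq0 step1_gt0)) e.
by rewrite -[RHS]opprK -e opprB.
Unshelve. all: by end_near. Qed.

End WeakDerivative.

(** * Taylor expansion with a locally integrable second derivative *)

Section Taylor.
Context {R : realType}.
Implicit Types (f g k : R -> R) (a b u A B M : R).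
Local Notation mu := (@lebesgue_measure R).

Lemma integrable_bounded_support k g A B M : measurable_fun setT k ->
  (forall u, `|k u| <= M) -> (forall u, ~ `[A, B]%classic u -> k u = 0) ->
  locally_integrable setT g -> mu.-integrable setT (EFin \o (k \* g)).
Proof.
move=> mk kM kAB lg; have mg : measurable_fun setT g by case: lg.
have : mu.-integrable setT (EFin \o ((fun u => M * `|g u|) \_ `[A, B])).
  rewrite -restrict_EFin; apply/integrable_restrict => //; rewrite setTI.
  by apply: integrableZl_EFin => //; exact: integrable_norm (locally_integrable_itv A B lg).
apply: le_integrable => //.
  by apply/measurable_EFinP; exact: measurable_funM.
move=> u _ /=; rewrite lee_fin patchE; case: ifPn => [_|/negP uAB].
  by rewrite normrM [leRHS]ger0_norm ?ler_wpM2r// mulr_ge0// (le_trans _ (kM u)).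
by rewrite kAB ?mul0r// => uAB'; apply: uAB; rewrite inE.
Qed.

Lemma le_Rintegral_bounded_support k g A B M : measurable_fun setT k ->
  (forall u, `|k u| <= M) -> (forall u, ~ `[A, B]%classic u -> k u = 0) ->
  locally_integrable setT g ->
  `|\int[mu]_u (k u * g u)| <= M * \int[mu]_(u in `[A, B]) `|g u|.
Proof.
move=> mk kM kAB lg.
have ik := integrable_bounded_support mk kM kAB lg.
apply: le_trans (le_normr_Rintegral _ ik) _ => //.
rewrite (@Rintegral_support _ `[A, B]); last first.
  by move=> u uAB; rewrite /= kAB// mul0r normr0.
rewrite -RintegralZl//; last exact: integrable_norm (locally_integrable_itv A B lg).
apply: le_Rintegral => //.
- by apply: integrableS (integrable_norm ik).
- by apply: integrableZl_EFin => //; exact: integrable_norm (locally_integrable_itv A B lg).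
- by move=> u _; rewrite normrM ler_wpM2r.
Qed.

(** Dominated convergence on shrinking intervals: the restrictions of [|g|] tend to [0] at every
    point other than [z]. *)
Lemma locally_integrable_small g z e : locally_integrable setT g -> 0 < e ->
  exists2 r, 0 < r & \int[mu]_(u in `[z - r, z + r]) `|g u| <= e.
Proof.
move=> lg e0; have mg : measurable_fun setT g by case: lg.
pose I n := `[z - n.+1%:R^-1, z + n.+1%:R^-1]%classic.
have : \int[mu]_(u in `[z - 1, z + 1]) ((Num.norm \o g) \_ (I n)) u @[n --> \oo] -->
    \int[mu]_(u in `[z - 1, z + 1]) (cst 0 u : R).
  apply: (@Rintegral_dominated_cvg _ _ _ mu `[z - 1, z + 1]%classic
    (fun n u => ((Num.norm \o g) \_ (I n)) u) (cst 0) (Num.norm \o g)) => //.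
  - move=> n; apply/measurable_restrict => //.
      exact: measurable_itv.
    by apply: measurableT_comp => //; exact: measurable_funTS.
  - exists [set z]; split => //; first exact: lebesgue_measure_set1.
    move=> u /=; apply: contra_notP => uz _.
    apply: cvg_near_cst; near=> n; rewrite patchE ifF//; apply/negbTE.
    rewrite notin_setE /I/= in_itv/= -ler_distlC; apply/negP; rewrite -ltNge.
    have zu : 0 < `|z - u| by rewrite normr_gt0 subr_eq0 eq_sym; exact/eqP.
    rewrite invf_plt ?posrE//.
    by near: n; exact: near_infty_ltS.
  - by have /integrable_norm := locally_integrable_itv (z - 1) (z + 1) lg.
  - apply/aeW => u _ n; rewrite patchE; case: ifPn => _; rewrite ?normr0//=.
    by rewrite normr_id.
rewrite Rintegral_cst// mul0r => /cvgrPdist_le/(_ _ e0)[N _ /(_ _ (leqnn N))].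
rewrite sub0r normrN => /ler_normlW hN; exists N.+1%:R^-1; first by rewrite invr_gt0.
apply: le_trans hN; rewrite -Rintegral_mkcondr setIidr// => u.
have n1 : N.+1%:R^-1 <= 1 :> R by rewrite invf_le1// ler1n.
rewrite /I/= !in_itv/=; move: (N.+1%:R^-1) n1 => v v1 /andP[? ?].
by apply/andP; split; lra.
Unshelve. all: by end_near. Qed.

Lemma dist_min_max (z w u : R) : `[Num.min z w, Num.max z w]%classic u ->
  `|w - u| <= `|w - z| /\ `|z - u| <= `|w - z|.
Proof.
rewrite /= in_itv/=; case: (leP z w) => zw /andP[? ?].
  rewrite (@ger0_norm _ (w - z)) ?subr_ge0// !ler_norml.
  by split; apply/andP; split; lra.
have wz : w - z <= 0 by lra.
rewrite (@ler0_norm _ (w - z))// !ler_norml.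
by split; apply/andP; split; lra.
Qed.

(** The oriented indicator: [1] on [[a, b[] if [a <= b], and [-1] on [[b, a[] otherwise. As a
    difference of half-lines it is additive in the endpoints without any case distinction. *)
Definition signed_itv a b u : R := (u < b)%R%:R - (u < a)%R%:R.

Lemma measurable_signed_itv a b : measurable_fun setT (signed_itv a b).
Proof.
have H c : measurable_fun setT (fun u : R => (u < c)%R%:R : R).
  rewrite (_ : (fun u => _) = \1_[set` `]-oo, c[]); first exact: measurable_indic.
  by apply/funext => u; rewrite indicE mem_setE in_itv.
exact: measurable_funB.
Qed.

Lemma signed_itv_le1 a b u : `|signed_itv a b u| <= 1.
Proof.
by rewrite /signed_itv; case: (u < b); case: (u < a);
  rewrite ?subrr ?subr0 ?sub0r ?normrN ?normr0 ?normr1.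
Qed.

Lemma signed_itv_out a b u : u < Num.min a b \/ Num.max a b <= u ->
  signed_itv a b u = 0.
Proof.
rewrite /signed_itv lt_min ge_max => -[/andP[-> ->]|/andP[]]; first by rewrite subrr.
by move=> au bu; rewrite !ltNge au bu subrr.
Qed.

Lemma signed_itvD b a c u :
  signed_itv a b u + signed_itv b c u = signed_itv a c u.
Proof. by rewrite /signed_itv; ring. Qed.

Lemma signed_itvN a b u : signed_itv b a u = - signed_itv a b u.
Proof. by rewrite /signed_itv opprB. Qed.

Lemma signed_itv_out_cc a b u :
  ~ `[Num.min a b, Num.max a b]%classic u -> signed_itv a b u = 0.
Proof.
rewrite /= in_itv/= => /negP; rewrite negb_and -!ltNge => /orP[?|?];
  apply: signed_itv_out; by [left|right; exact: ltW].
Qed.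

Lemma integrable_signed_itv k g a b M : measurable_fun setT k ->
  (forall u, `[Num.min a b, Num.max a b]%classic u -> `|k u| <= M) ->
  locally_integrable setT g ->
  mu.-integrable setT (EFin \o ((k \* signed_itv a b) \* g)).
Proof.
move=> mk kM lg.
apply: (@integrable_bounded_support _ _ (Num.min a b) (Num.max a b) M) => //.
- by apply: measurable_funM => //; exact: measurable_signed_itv.
- move=> u /=; have [uab|uab] := pselect (`[Num.min a b, Num.max a b]%classic u).
    by rewrite normrM -[leRHS]mulr1 ler_pM ?kM// signed_itv_le1.
  rewrite signed_itv_out_cc// mulr0 normr0.
  by apply: (le_trans (normr_ge0 _) (kM (Num.min a b) _)); rewrite /= in_itv/= lexx le_max ge_min lexx.
- by move=> u uab /=; rewrite signed_itv_out_cc// mulr0.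
Qed.

Lemma integrable_signed_itv1 g a b : locally_integrable setT g ->
  mu.-integrable setT (EFin \o (signed_itv a b \* g)).
Proof.
move=> lg.
have := @integrable_signed_itv (cst 1) g a b 1 (measurable_cst _) _ lg.
rewrite (_ : cst 1 \* signed_itv a b = signed_itv a b).
  by apply => u _ /=; rewrite normr1.
by apply/funext => u; rewrite /= mul1r.
Qed.

Lemma weak_derivative2_signed f g a b : (forall u, derivable f u 1) ->
  continuous (derive1 f) -> weak_derivative 2 f g ->
  derive1 f b - derive1 f a = \int[mu]_u (signed_itv a b u * g u).
Proof.
move=> df cf wf.
have lg : locally_integrable setT g by case: wf.
have mg : measurable_fun setT g by case: lg.
have H a' b' : a' < b' -> derive1 f b' - derive1 f a' = \int[mu]_u (signed_itv a' b' u * g u).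
  move=> ab; rewrite (weak_derivative2_increment df cf wf ab).
  rewrite Rintegral_itv_obnd_cbnd; last first.
    by apply/integrableS/(locally_integrable_itv a' b' lg) => //; exact: subset_itv_oc_cc.
  rewrite -Rintegral_itv_bndo_bndc; last first.
    by apply/integrableS/(locally_integrable_itv a' b' lg) => //; exact: subset_itv_co_cc.
  rewrite Rintegral_mkcond; apply: eq_Rintegral => u _.
  rewrite patchE mem_setE in_itv/= /signed_itv.
  have [au|ua] := leP a' u; last by rewrite (lt_trans ua ab) subrr mul0r.
  by rewrite subr0; case: (u < b'); rewrite ?mul1r ?mul0r.
have [ab|ba|->] := ltgtP a b; first exact: H.
  rewrite -opprB H// -mulN1r -RintegralZl//; last exact: integrable_signed_itv1.
  by apply: eq_Rintegral => u _; rewrite (signed_itvN a b) !mulNr mul1r opprK.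
rewrite subrr; under eq_Rintegral do rewrite /signed_itv subrr mul0r.
by rewrite Rintegral_cst// mul0r.
Qed.

Lemma taylor_signed f g a b : (forall u, derivable f u 1) ->
  continuous (derive1 f) -> weak_derivative 2 f g ->
  f b - f a - derive1 f a * (b - a) =
  \int[mu]_u ((b - u) * signed_itv a b u * g u).
Proof.
move=> df cf wf.
have lg : locally_integrable setT g by case: wf.
pose H z := \int[mu]_u ((z - u) * signed_itv a z u * g u).
have mB z : measurable_fun setT (fun u : R => z - u).
  by apply: measurable_funB => //; exact: measurable_id.
have iB z w w' : mu.-integrable setT (EFin \o ((fun u => z - u) \* signed_itv w w' \* g)).
  apply: (@integrable_signed_itv _ _ _ _ (`|z - Num.min w w'| + `|z - Num.max w w'|)) => //.
  move=> u /=; rewrite in_itv/= => /andP[]; move: (Num.min _ _) (Num.max _ _) => m M mu' uM.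
  rewrite ler_norml; have := ler_norm (z - m); have := ler_norm (-(z - M)).
  rewrite normrN; have := normr_ge0 (z - m); have := normr_ge0 (z - M).
  by move=> *; apply/andP; split; lra.
have HB z w : H w - H z = (w - z) * (derive1 f z - derive1 f a) +
    \int[mu]_u ((w - u) * signed_itv z w u * g u).
  rewrite (weak_derivative2_signed _ _ df cf wf) -RintegralZl//; last exact: integrable_signed_itv1.
  rewrite -RintegralB//; [|exact: iB|exact: iB].
  rewrite -RintegralD//; last 2 first.
  - by apply: integrableZl_EFin => //; exact: integrable_signed_itv1.
  - exact: iB.
  by apply: eq_Rintegral => u _; rewrite -(signed_itvD z a w) /=; ring.
have dH (z : R) : is_derive z 1 H (derive1 f z - derive1 f a).
  apply/is_derive1_caratheodory.
  exists (fun w => if w == z then derive1 f z - derive1 f a else (H w - H z) / (w - z)); split.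
  - move=> w; case: eqP => [->|/eqP]; first by rewrite !subrr mulr0.
    by rewrite -subr_eq0 => /divfK->.
  - rewrite /prop_for /continuous_at eqxx; apply/cvgrPdist_le => e e0.
    have [r r0 hr] := locally_integrable_small z lg e0.
    near=> w; case: ifPn => [_|wz]; first by rewrite subrr normr0 ltW.
    rewrite HB mulrDl mulrAC divff ?subr_eq0// mul1r opprD addrA subrr sub0r normrN.
    have wr : `|z - w| < r by near: w; exact: (@nbhsx_ballx _ _ z).
    rewrite normrM normfV ler_pdivrMr ?normr_gt0 ?subr_eq0// mulrC.
    apply: le_trans (@le_Rintegral_bounded_support _ _ (z - r) (z + r) `|w - z| _ _ _ lg) _.
    + by apply: measurable_funM => //; exact: measurable_signed_itv.
    + move=> u /=; have [uab|uab] := pselect (`[Num.min z w, Num.max z w]%classic u).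
        by rewrite normrM -[leRHS]mulr1 ler_pM// ?signed_itv_le1//; case: (dist_min_max uab).
      by rewrite signed_itv_out_cc// mulr0 normr0.
    + move=> u uzr; rewrite signed_itv_out_cc ?mulr0//; apply: contra_not uzr => /dist_min_max[_ zu].
      by rewrite /= in_itv/= -ler_distlC (le_trans zu)// distrC ltW.
    + by rewrite ler_wpM2l.
  - by rewrite eqxx.
have dK (z : R) : is_derive z 1 (fun z => f z - derive1 f a * (z - a) - H z) 0.
  have Df : is_derive z 1 f (derive1 f z) by apply: DeriveDef; rewrite ?derive1E.
  have Dl : is_derive z 1 (fun z : R => derive1 f a * (z - a)) (derive1 f a).
    by apply: is_derive_eq; rewrite /GRing.scale/= subr0 mulr1.
  have := is_deriveB (is_deriveB Df Dl) (dH z).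
  by rewrite subrr.
have := is_derive_0_is_cst b a dK.
rewrite subrr mulr0 subr0 -/(H b) => e.
have Ha : H a = 0.
  rewrite /H; under eq_Rintegral do rewrite /signed_itv subrr mulr0 mul0r.
  by rewrite Rintegral_cst// mul0r.
by move: e; rewrite Ha subr0 => /eqP; rewrite subr_eq => /eqP e; rewrite addrAC e; ring.
Unshelve. all: by end_near. Qed.

End Taylor.

(** * Fine partitions for right-continuous paths with left limits *)

Section Partitions.
Context {R : realType}.
Implicit Types (a b s t T eps u h : R) (x y : R -> R) (Q : R -> R -> Prop).

(** [Q s t] stands for a smallness property of the interval from [s] to [t]: inherited by
    subintervals and true near each point on each side separately. Nothing is asked of intervals
    containing the point in their interior, since a jump may sit there. *)
Definition locally_fine a b Q :=
  [/\ forall s t s' t', s <= s' -> s' < t' -> t' <= t -> Q s t -> Q s' t',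
      forall s, a <= s -> s < b -> exists2 t, s < t & Q s t &
      forall t, a < t -> t <= b -> exists2 s, s < t & Q s t].

Lemma locally_fineI a b Q Q' : locally_fine a b Q -> locally_fine a b Q' ->
  locally_fine a b (fun s t => Q s t /\ Q' s t).
Proof.
move=> [Qh Qr Ql] [Qh' Qr' Ql']; split.
- by move=> s t s' t' ss' st' tt' [q q']; split; [exact: Qh q|exact: Qh' q'].
- move=> s sa sb; have [t st q] := Qr _ sa sb; have [t' st' q'] := Qr' _ sa sb.
  exists (Num.min t t'); first by rewrite lt_min st.
  by split; [apply: Qh q|apply: Qh' q'] => //; rewrite ?lt_min ?st// ge_min lexx ?orbT.
- move=> t ta tb; have [s st q] := Ql _ ta tb; have [s' st' q'] := Ql' _ ta tb.
  exists (Num.max s s'); first by rewrite gt_max st.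
  by split; [apply: Qh q|apply: Qh' q'] => //; rewrite ?gt_max ?st// le_max lexx ?orbT.
Qed.

(** The starting point is kept outside the list: the partition points are [s :: P] and the right end
    is [last s P]. *)
Fixpoint chain Q s (P : seq R) : Prop :=
  if P is r :: P' then [/\ s < r, Q s r & chain Q r P'] else True.

Lemma chain_rcons Q s P r : chain Q s P -> last s P < r -> Q (last s P) r ->
  chain Q s (rcons P r).
Proof. by elim: P s => [|v P IH] s //= [sv q c] vr qr; split => //; exact: IH. Qed.

Lemma sub_chain Q Q' s P : (forall a b, Q a b -> Q' a b) -> chain Q s P -> chain Q' s P.
Proof. by move=> QQ'; elim: P s => [//|v P IH] s /= [sv /QQ' q /IH]. Qed.

Lemma chain_path Q s P : chain Q s P -> path <%R s P.
Proof. by elim: P s => [//|v P IH] s /= [-> _ /IH]. Qed.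

Lemma chain_le Q s P : chain Q s P -> s <= last s P.
Proof.
elim: P s => [//|v P IH] s /= [sv _ /IH]; apply: le_trans; exact: ltW.
Qed.

Lemma chain_mem Q s P r : chain Q s P -> r \in P -> s < r <= last s P.
Proof.
elim: P s => [//|v P IH] s /= [sv _ c]; rewrite inE => /predU1P[->|rP].
  by rewrite sv (chain_le c).
by have /andP[vr ->] := IH _ c rP; rewrite (lt_trans sv vr).
Qed.

(** A compactness argument in Cousin's manner. The supremum of the points reachable from [a] is
    itself reachable, by smallness on its left; were it below [b], smallness on its right would
    allow one more step. *)
Lemma locally_fine_chain a b Q : a <= b -> locally_fine a b Q ->
  exists2 P, chain Q a P & last a P = b.
Proof.
move=> ab [Qh Qr Ql].
pose S := [set s | s <= b /\ exists2 P, chain Q a P & last a P = s].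
have Sa : S a by split => //; exists [::].
have Sb : has_sup S by split; [exists a|exists b => s []].
have aS : a <= sup S by apply: ub_le_sup => //; exact: Sb.2.
have Sle : sup S <= b by apply: ge_sup; [exists a|move=> s []].
have SS : S (sup S).
  split => //; move: aS; rewrite le_eqVlt => /predU1P[<-|aS]; first by exists [::].
  have [s sS q] := Ql _ aS Sle.
  have Ss0 : 0 < sup S - s by rewrite subr_gt0.
  have [r Sr] := sup_adherent Ss0 Sb; rewrite subKr => sr.
  have rS : r <= sup S by apply: ub_le_sup => //; exact: Sb.2.
  have [_ [P cP lP]] := Sr; move: rS; rewrite le_eqVlt => /predU1P[<-|rS]; first by exists P.
  exists (rcons P (sup S)); last by rewrite last_rcons.
  apply: chain_rcons => //; rewrite lP//.
  by apply: Qh q => //; exact: ltW.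
have [_ [P cP lP]] := SS; exists P => //; rewrite lP.
move: Sle; rewrite le_eqVlt => /predU1P[//|Sltb].
have [t St q] := Qr _ aS Sltb.
have : S (Num.min t b).
  split; first by rewrite ge_min lexx orbT.
  exists (rcons P (Num.min t b)); last by rewrite last_rcons.
  apply: chain_rcons => //; rewrite lP ?lt_min ?St//.
  by apply: Qh q => //; rewrite ?lt_min ?St// ge_min lexx.
move=> /(ub_le_sup Sb.2); rewrite leNgt => /negP; case.
by rewrite lt_min St.
Qed.

(** The right end is excluded, so a jump at [t] is not seen; large jumps of a path are absorbed by
    the partition points. *)
Definition osc_le x eps s t := forall r r', s <= r < t -> s <= r' < t ->
  `|x r - x r'| <= eps.

Lemma cadlag_osc T x eps : cadlag T x -> 0 < eps -> locally_fine 0 T (osc_le x eps).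
Proof.
move=> [xr xl] e0; have e20 : 0 < eps / 2 by rewrite divr_gt0.
have split_le v r r' : `|v - x r| <= eps / 2 -> `|v - x r'| <= eps / 2 -> `|x r - x r'| <= eps.
  move=> h h'; rewrite -(subrKA v) (splitr eps).
  by apply: le_trans (ler_normD _ _) _; apply: lerD => //; rewrite distrC.
split.
- move=> s t s' t' ss' st' tt' q r r' /andP[? ?] /andP[? ?].
  by apply: q; apply/andP; split; lra.
- move=> s s0 sT; have /xr/cvgrPdist_le/(_ _ e20) : s \in `[0, T[ by rewrite in_itv/= s0.
  rewrite near_withinE => /(@nbhs_ballP _ R)[d/= d0 hd].
  exists (s + d); first by rewrite ltrDl.
  have H r : s <= r < s + d -> `|x s - x r| <= eps / 2.
    move=> /andP[]; rewrite le_eqVlt => /predU1P[<- _|sr rd].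
      by rewrite subrr normr0 ltW.
    by apply: hd => //; rewrite /ball/= distrC gtr0_norm ?subr_gt0// ltrBlDl.
  by move=> r r' /H hr /H hr'; exact: split_le hr hr'.
- move=> t t0 tT; have /xl/cvg_ex[v /cvgrPdist_le/(_ _ e20)] : t \in `]0, T] by rewrite in_itv/= t0.
  rewrite near_withinE => /(@nbhs_ballP _ R)[d/= d0 hd].
  exists (t - d / 2); first by rewrite ltrBlDr ltrDl divr_gt0.
  have H r : t - d / 2 <= r < t -> `|v - x r| <= eps / 2.
    move=> /andP[tr rt]; apply: hd => //.
    by rewrite /ball/= gtr0_norm ?subr_gt0//; lra.
  by move=> r r' /H hr /H hr'; exact: split_le hr hr'.
Qed.

Lemma mesh_fine a b eps : 0 < eps -> locally_fine a b (fun s t => t - s <= eps).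
Proof.
move=> e0; split.
- by move=> s t s' t' *; lra.
- by move=> s _ _; exists (s + eps); lra.
- by move=> t _ _; exists (t - eps); lra.
Qed.

End Partitions.

(** * Left limits and jumps *)

Section LeftLimit.
Context {R : realType}.
Implicit Types (a b s t T eps u h : R) (x y : R -> R).

Lemma left_limit_cvg T x t : cadlag T x -> 0 < t -> t <= T ->
  x @ t^'- --> left_limit x t.
Proof.
move=> [_ xl] t0 tT; rewrite /left_limit gt_eqF//; apply: xl.
by rewrite in_itv/= t0.
Qed.

Lemma left_limit0 x : left_limit x 0 = x 0.
Proof. by rewrite /left_limit eqxx. Qed.

Lemma left_limit_unique T x t v : cadlag T x -> 0 < t -> t <= T ->
  x @ t^'- --> v -> left_limit x t = v.
Proof.
move=> cx t0 tT xv; apply: (cvg_unique (@Rhausdorff R) _ xv).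
exact: (left_limit_cvg cx t0 tT).
Qed.

Lemma left_limit_comp T x (F : R -> R) t : cadlag T x -> continuous F ->
  0 <= t -> t <= T -> cadlag T (F \o x) /\ left_limit (F \o x) t = F (left_limit x t).
Proof.
move=> cx cF t0 tT.
have cFx : cadlag T (F \o x).
  split => s sT; first by apply: continuous_cvg; [exact: cF|exact: cx.1].
  apply/cvg_ex; exists (F (lim (x @ s^'-))).
  by apply: continuous_cvg; [exact: cF|exact: cx.2].
split => //; move: t0; rewrite le_eqVlt => /predU1P[<-|t0].
  by rewrite !left_limit0.
apply: (left_limit_unique cFx t0 tT).
by apply: continuous_cvg; [exact: cF|exact: (left_limit_cvg cx t0 tT)].
Qed.

Lemma near_left_exists (D : R -> Prop) t a : a < t -> (\forall r \near t^'-, D r) ->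
  exists2 r, a < r < t & D r.
Proof.
move=> at_ Dt; near t^'- => r; exists r; last by near: r.
by apply/andP; split; near: r; [exact: nbhs_left_gt|exact: nbhs_left_lt].
Unshelve. all: by end_near. Qed.

Lemma left_limit_le T x t a v : cadlag T x -> 0 <= a -> a < t -> t <= T ->
  (forall r, a <= r < t -> x r <= v) -> left_limit x t <= v.
Proof.
move=> cx a0 at_ tT xv; have t0 : 0 < t by exact: le_lt_trans at_.
apply: (closed_cvg (fun w => w <= v)) (left_limit_cvg cx t0 tT).
  exact: closed_le.
near=> r; apply: xv; apply/andP; split.
  by apply: ltW; near: r; exact: nbhs_left_gt.
by near: r; exact: nbhs_left_lt.
Unshelve. all: by end_near. Qed.

Lemma left_limit_dist T x t a v w : cadlag T x -> 0 <= a -> a < t -> t <= T ->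
  (forall r, a <= r < t -> `|w - x r| <= v) -> `|w - left_limit x t| <= v.
Proof.
move=> cx a0 at_ tT xv; have t0 : 0 < t by exact: le_lt_trans at_.
apply: (closed_cvg (fun w' => `|w - w'| <= v)) (left_limit_cvg cx t0 tT).
  apply: (@closed_comp _ _ (fun w' => `|w - w'|) [set r | r <= v]); last exact: closed_le.
  by move=> r _; apply: cvg_norm; apply: cvgB; [exact: cvg_cst|exact: cvg_id].
near=> r; apply: xv; apply/andP; split.
  by apply: ltW; near: r; exact: nbhs_left_gt.
by near: r; exact: nbhs_left_lt.
Unshelve. all: by end_near. Qed.

Lemma osc_left_limit T x eps a t r : cadlag T x -> 0 <= a -> t <= T ->
  osc_le x eps a t -> a <= r < t -> `|x r - left_limit x t| <= eps.
Proof.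
move=> cx a0 tT q /[dup] /andP[ar rt] art.
apply: (left_limit_dist cx a0 (le_lt_trans ar rt) tT) => r' ar't.
exact: q.
Qed.

Lemma osc_jump T x eps a b s : cadlag T x -> 0 <= a -> b <= T ->
  osc_le x eps a b -> a < s < b -> `|jump x s| <= eps.
Proof.
move=> cx a0 bT q /andP[as_ sb]; rewrite /jump.
apply: (left_limit_dist cx a0 as_ (ltW (lt_le_trans sb bT))) => r /andP[ar rs].
by apply: q; apply/andP; split => //; [exact: ltW|exact: lt_trans sb].
Qed.

Lemma cadlag_bounded T x : cadlag T x -> 0 <= T ->
  exists B, forall s, 0 <= s <= T -> `|x s| <= B.
Proof.
move=> cx T0.
have [P cP lP] := locally_fine_chain T0 (cadlag_osc cx ltr01).
have [B hB] : exists B, forall s, 0 <= s <= last 0 P -> `|x s| <= B.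
  elim: P 0 cP {lP} => [|r P IH] a /= => [_|[ar q /IH[B hB]]].
    by exists `|x a| => s; rewrite -eq_le => /eqP <-.
  exists (Num.max B (`|x a| + 1)) => s /andP[as_ sP].
  rewrite le_max; have [rs|sr] := leP r s; first by rewrite hB ?rs.
  rewrite -[x s](subrK (x a)) addrC.
  by rewrite orbC (le_trans (ler_normD _ _))// lerD// q ?lexx ?as_.
by exists B => s; rewrite -lP; exact: hB.
Qed.

Lemma left_limitN T x t : cadlag T x -> 0 <= t -> t <= T ->
  left_limit (\- x) t = - left_limit x t.
Proof.
have cN : continuous (-%R : R -> R) by exact: opp_continuous.
by move=> cx t0 tT; have [_] := left_limit_comp cx cN t0 tT.
Qed.

End LeftLimit.

(** * Level changes of the reflected path and crossings *)

Section Alternating.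
Context {R : realType}.
Implicit Types (a b s t T eps u h c : R) (x y phi : R -> R).

(** What remains of the support condition: [y] can increase, continuously or by a jump, only while
    [phi] sits at the barrier [h]. The condition on decreases is the same property of [-y] and
    [-phi]. *)
Definition pushes_up T y phi h :=
  (forall a b, 0 <= a -> a < b -> b <= T -> y a < y b ->
    exists2 r, a < r <= b & phi r = h) /\
  (forall s, 0 < s -> s <= T -> left_limit y s < y s -> phi s = h).

(** The witness is the infimum [v] of the times after [a] at which [y] exceeds [u]. If [y v > u],
    then [y] jumps up at [v] and [phi v = h]. Otherwise [y v = u] by right continuity and [y] rises
    above [u] immediately after [v], so [phi] takes the value [h] arbitrarily soon after [v], and
    right continuity of [phi] concludes. *)
Lemma pushes_up_cross T y phi h a b u : cadlag T y -> cadlag T phi ->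
  pushes_up T y phi h -> 0 <= a -> a < b -> b <= T -> y a <= u -> u < y b ->
  exists2 s, a <= s <= b & u <= y s /\ phi s = h.
Proof.
move=> cy cphi [up jup] a0 ab bT yau uyb.
pose S := [set s | a <= s <= b /\ u < y s].
have Sb : S b by rewrite /S/= (ltW ab) lexx.
have infS : has_inf S by split; [exists b|exists a => s [/andP[]]].
pose v := inf S.
have av : a <= v by apply: lb_le_inf; [exists b|move=> s [/andP[]]].
have vb : v <= b by apply: ge_inf => //; exact: infS.2.
have lev r : a <= r -> r < v -> y r <= u.
  move=> ar rv; rewrite leNgt; apply/negP => ur.
  have : v <= r.
    apply: ge_inf; first exact: infS.2.
    by split => //; rewrite ar (ltW (lt_le_trans rv vb)).
  by rewrite leNgt rv.
exists v; first by rewrite av.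
have [uyv|yvu] := ltP u (y v).
  have {}av : a < v.
    by rewrite lt_neqAle av andbT; apply: contraTneq uyv => <-; rewrite -leNgt.
  have v0 : 0 < v by exact: le_lt_trans av.
  split; first exact: ltW.
  apply: jup => //; first exact: le_trans bT.
  apply: le_lt_trans uyv; apply: (left_limit_le cy a0 av (le_trans vb bT)).
  by move=> r /andP[]; exact: lev.
have {}vb : v < b.
  by rewrite lt_neqAle vb andbT; apply: contraTneq yvu => ->; rewrite -ltNge.
have v0 : 0 <= v by exact: le_trans av.
have vT : v < T by exact: lt_le_trans bT.
have near_S d : 0 < d -> exists2 s, v < s < v + d & [/\ s <= b & u < y s].
  move=> d0; have [s [/andP[as_ sb] us] svd] := inf_adherent d0 infS.
  exists s => //; rewrite svd andbT lt_neqAle.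
  apply/andP; split; last by apply: ge_inf; [exact: infS.2|split => //; rewrite as_].
  by apply: contraTneq us => <-; rewrite -leNgt.
have vin : v \in `[0, T[ by rewrite in_itv/= v0.
have uyv : u <= y v.
  rewrite leNgt; apply/negP => yvu'.
  have /cvgrPdist_lt/(_ (u - y v)) := cy.1 _ vin.
  rewrite subr_gt0 => /(_ yvu'); rewrite near_withinE => /(@nbhs_ballP _ R)[d/= d0 hd].
  have [s /andP[vs svd] [_ us]] := near_S _ d0.
  have := hd s; rewrite /ball/= distrC gtr0_norm ?subr_gt0// ltrBlDl => /(_ svd vs).
  by rewrite ltNge distrC => /negP; apply; apply: le_trans (ler_norm _); rewrite lerB// ltW.
split => //.
have {}yvu : y v = u by apply/eqP; rewrite eq_le yvu.
apply/eqP/negPn/negP => ne.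
have e0 : 0 < `|phi v - h| by rewrite normr_gt0 subr_eq0.
have /cvgrPdist_lt/(_ _ e0) := cphi.1 _ vin.
rewrite near_withinE => /(@nbhs_ballP _ R)[d/= d0 hd].
have [s /andP[vs svd] [sb us]] := near_S _ d0.
have [|r /andP[vr rs] phir] := up v s v0 vs (le_trans sb bT); first by rewrite yvu.
have := hd r; rewrite /ball/= distrC gtr0_norm ?subr_gt0// ltrBlDl.
by move=> /(_ (le_lt_trans rs svd) vr); rewrite phir ltxx.
Qed.

(* (t, true) stands for t and (t, false) for t- *)
Definition value y (p : R * bool) : R := if p.2 then y p.1 else left_limit y p.1.

Definition time_le (p p' : R * bool) :=
  (p.1 < p'.1) || (p.1 == p'.1) && (p.2 ==> p'.2).

Lemma time_le_fst p p' : time_le p p' -> p.1 <= p'.1.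
Proof. by move=> /orP[/ltW//|/andP[/eqP ->]]. Qed.

Lemma time_le_trans : transitive time_le.
Proof.
move=> [b b'] [a a'] [c c']; rewrite /time_le/= => /orP[ab|/andP[/eqP-> i1]].
  by move=> /orP[bc|/andP[/eqP<- _]]; rewrite ?ab// (lt_trans ab).
by move=> /orP[->//|/andP[/eqP-> i2]]; rewrite eqxx; case: a' b' c' i1 i2 => [] [] []//=; rewrite ?orbT.
Qed.

(** The same with endpoints of the form [t-]. If [y] is already above [u] at the starting time, it
    has jumped there and the jump clause of [pushes_up] applies; an endpoint [b-] is replaced by a
    time shortly before [b]. *)
Lemma pushes_up_cross2 T y phi h p p' u : cadlag T y -> cadlag T phi ->
  pushes_up T y phi h -> 0 <= p.1 -> p'.1 <= T -> time_le p p' ->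
  value y p < u -> u < value y p' ->
  exists2 s, p.1 <= s <= p'.1 & u <= y s /\ phi s = h.
Proof.
case: p p' => [a al] [b br] cy cphi push /= a0 bT; rewrite /time_le/= => ab yau uyb.
have ab1 : a <= b by move: ab => /orP[/ltW//|/andP[/eqP->]].
have [uya|yau'] := ltP u (y a).
  case: al yau ab => yau ab; first by move: yau; rewrite ltNge (ltW uya).
  exists a; first by rewrite lexx.
  split; first exact: ltW.
  move: a0; rewrite le_eqVlt => /predU1P[a0|a0].
    by move: yau; rewrite /value/= -a0 left_limit0 a0 ltNge (ltW uya).
  by apply: push.2 => //; [exact: le_trans bT|exact: lt_trans uya].
have [b' [ab' b'b uyb']] : exists b', [/\ a < b', b' <= b & u < y b'].
  case: br uyb ab => uyb ab.
    exists b; split => //; rewrite lt_neqAle ab1 andbT.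
    by apply: contraTneq uyb; rewrite /value/= => <-; rewrite -leNgt.
  have {ab ab1}ab : a < b.
    rewrite lt_neqAle ab1 andbT; apply/negP => /eqP aE; subst b.
    move: ab; rewrite ltxx eqxx/= implybF => /negbTE al0; subst al.
    by move: (lt_trans yau uyb); rewrite ltxx.
  have b0 : 0 < b by exact: le_lt_trans ab.
  have /cvgrPdist_lt/(_ (left_limit y b - u)) := left_limit_cvg cy b0 bT.
  rewrite subr_gt0 => /(_ uyb) /(near_left_exists ab)[r /andP[ar rb] hr].
  exists r; split => //; first exact: ltW.
  by rewrite ltNge; apply/negP => yru; move: hr; rewrite ltNge => /negP; apply;
    apply: le_trans (ler_norm _); rewrite lerB.
have [s /andP[as_ sb'] hs] := pushes_up_cross cy cphi push a0 ab' (le_trans b'b bT) yau' uyb'.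
by exists s => //; rewrite as_ (le_trans sb').
Qed.

Definition beyond x u h (b : bool) s := if b then u + h <= x s else x s <= u - h.

(** Alternating sequences treat both kinds of crossings together: with [A = beyond x u h] each pair
    of neighbours is a crossing, in alternating directions. *)
Fixpoint zigzag (A : bool -> R -> bool) (b : bool) (l : seq R) :=
  if l is s :: l' then A b s && zigzag A (~~ b) l' else true.

Lemma zigzag_cat A (b : bool) l l' : zigzag A b (l ++ l') =
  zigzag A b l && zigzag A (b (+) odd (size l)) l'.
Proof.
elim: l b => [|s l IH] b /=; first by rewrite addbF.
by rewrite IH andbA addbN addNb.
Qed.

Lemma zigzag_nth A (b : bool) l i : zigzag A b l -> (i < size l)%N ->
  A (b (+) odd i) (nth 0 l i).
Proof.
elim: l b i => [//|s l IH] b [|i] /= /andP[As al] il; first by rewrite addbF.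
by have := IH _ _ al il; rewrite addbN addNb.
Qed.

Fixpoint changes (z : R * bool -> bool) p (l : seq (R * bool)) : nat :=
  if l is p' :: l' then ((z p != z p') + changes z p' l')%N else 0%N.

(** Each change of the indicator of [u < y] forces [phi] onto the barrier of the matching sign at a
    time when [y] is on the matching side of [u], so [x = y + phi] is beyond the band there. The
    times so found are a priori only weakly ordered; neighbours are distinct because [x] cannot be
    on both sides of a band of positive width. *)
Lemma changes_zigzag T x y phi h u p l : 0 < h ->
  cadlag T y -> cadlag T phi -> (forall s, 0 <= s <= T -> x s = y s + phi s) ->
  pushes_up T y phi h -> pushes_up T (\- y) (\- phi) h ->
  path time_le p l -> 0 <= p.1 -> (last p l).1 <= T ->
  (forall p', p' \in p :: l -> value y p' != u) ->
  let z p' := u < value y p' in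
  exists l', [/\ size l' = changes z p l, sorted <%R l',
    forall s, s \in l' -> p.1 <= s <= (last p l).1 &
    zigzag (beyond x u h) (~~ z p) l'].
Proof.
move=> h0 cy cphi xE push pushN + + lT + z.
elim: l p lT => [|p' l IH] p /= lT; first by move=> _ _ _; exists [::].
move=> /andP[pp' pl] p0 yu.
have p'0 : 0 <= p'.1 by exact: le_trans (time_le_fst pp').
have p'T : p'.1 <= (last p' l).1.
  have := pl; rewrite path_sortedE; last exact: time_le_trans.
  move=> /andP[/allP pl' _]; case: (l) pl' => // q l'' pl'.
  by apply: time_le_fst; apply: pl'; rewrite /= mem_last.
have [//|l' [sl' sol' ml' al']] := IH p' lT pl p'0 _.
  by move=> q ql; apply: yu; rewrite inE ql orbT.
have [zE|zN] := eqVneq (z p) (z p').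
  exists l'; split => //; last by rewrite zE.
  move=> s /ml' /andP[ps ->]; rewrite andbT.
  by apply: le_trans ps; exact: time_le_fst.
have [s /andP[ps sp'] As] : exists2 s, p.1 <= s <= p'.1 & beyond x u h (~~ z p) s.
  have yp : value y p != u by apply: yu; rewrite inE eqxx.
  have yp' : value y p' != u by apply: yu; rewrite !inE eqxx orbT.
  case: (boolP (z p)) zN => zp; case: (boolP (z p')) => //= zp' _.
    have vN q : 0 <= q.1 -> q.1 <= T -> value (\- y) q = - value y q.
      by move=> q0 qT; rewrite /value; case: ifP => // _; rewrite (left_limitN cy).
    have pT : p.1 <= T by apply: le_trans lT; apply: le_trans p'T; exact: time_le_fst.
    have p'T' : p'.1 <= T by exact: le_trans lT.
    have [||||s pp [ys phis]] := @pushes_up_cross2 T (\- y) (\- phi) h p p' (- u) _ _ pushN p0 p'T' pp'.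
    - by apply: (left_limit_comp cy _ p0 pT).1; exact: opp_continuous.
    - by apply: (left_limit_comp cphi _ p0 pT).1; exact: opp_continuous.
    - by rewrite vN// ltrN2.
    - by rewrite vN// ltrN2 lt_neqAle yp' leNgt.
    move: ys phis => /= ys phis; exists s => //=; rewrite xE; first by lra.
    by move: pp => /andP[? ?]; apply/andP; split; lra.
  have [|s pp [ys phis]] := pushes_up_cross2 cy cphi push p0 (le_trans p'T lT) pp' _ zp'.
    by rewrite lt_neqAle yp leNgt.
  exists s => //=; rewrite xE; first by lra.
  by move: pp => /andP[? ?]; apply/andP; split; lra.
have {}zN : z p' = ~~ z p by move: zN; case: (z p); case: (z p').
exists (s :: l'); split.
- by rewrite /= sl'.
- move: sol' ml' al'; case: l' {sl'} => [//|r l' /= ->] ml' /andP[Ar _].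
  rewrite andbT; have /andP[p'r _] := ml' r (mem_head _ _).
  rewrite lt_neqAle (le_trans sp' p'r) andbT; apply/negP => /eqP sr; subst r.
  by move: As Ar; rewrite zN negbK; case: (z p) => /= ? ?; lra.
- move=> r; rewrite inE => /predU1P[->|/ml' /andP[p'r ->]].
    by rewrite ps (le_trans sp').
  by rewrite andbT (le_trans _ p'r)// time_le_fst.
- by rewrite /= As -zN.
Qed.

(** Neighbours in the zigzag differ in [x] by at least [2 h], more than the oscillation on one
    interval of the partition, so each interval holds at most one of them; the additional one may be
    the right end. *)
Lemma zigzag_bound x u h c s P (b : bool) l : c < h * 2 ->
  chain (osc_le x c) s P -> sorted <%R l ->
  (forall r, r \in l -> s <= r <= last s P) ->
  zigzag (beyond x u h) b l -> (size l <= (size P).+1)%N.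
Proof.
move=> ch; elim: P s b l => [|r P IH] s b l /=.
  move=> _; case: l => [//|v [//|w l]] /= /andP[vw _] ml.
  have /andP[sv _] := ml v (mem_head _ _).
  have /andP[_ ws] : s <= w <= s by apply: ml; rewrite !inE eqxx orbT.
  by move: (lt_le_trans vw ws); rewrite ltNge sv.
move=> [sr osc cP]; case: l => [//|v [//|w l]] /= /andP[vw swl] ml /and3P[Av Aw al].
have rw : r <= w.
  rewrite leNgt; apply/negP => wr.
  have /andP[sv _] := ml v (mem_head _ _).
  have := osc v w; rewrite sv (lt_trans vw wr) (le_trans sv (ltW vw)) wr => /(_ isT isT).
  rewrite ler_norml => /andP[? ?].
  by move: Av Aw; clear al; case: b => /= ? ?; lra.
rewrite ltnS; apply: (IH r (~~ b) (w :: l)) => //; last by rewrite /= Aw.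
move=> r' r'wl; have -> : r' <= last r P.
  by have /andP[_ ->] : s <= r' <= last r P by apply: ml; rewrite inE r'wl orbT.
rewrite andbT; apply: le_trans rw _; move: r'wl; rewrite inE => /predU1P[->//|r'l].
move: swl; rewrite path_sortedE; last exact: lt_trans.
by move=> /andP[/allP/(_ _ r'l)/ltW].
Qed.

End Alternating.

(** * Crossing counts in terms of alternating sequences *)

Section CrossingCounts.
Context {R : realType}.
Implicit Types (a b s t T eps u h c : R) (x y phi : R -> R).

(* Shifting the alternating times by one turns up-crossings into down-crossings. *)
Lemma zigzag_crossing_times t l (off n : nat) : sorted <%R l ->
  (forall s, s \in l -> 0 <= s <= t) -> (off + n.*2 <= size l)%N ->
  crossing_times t n (fun i => nth 0 l (off + i.*2)) (fun i => nth 0 l (off + i.*2).+1).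
Proof.
move=> sl ml nl i iN.
have lt1 : ((off + i.*2).+1 < size l)%N.
  by apply: leq_trans nl; rewrite -addnS -addnS leq_add2l -doubleS leq_double.
have lt0 := ltnW lt1.
split.
- by have /andP[] := ml _ (mem_nth 0 lt0).
- by apply: (sorted_ltn_nth lt_trans) => //; rewrite inE.
- by have /andP[] := ml _ (mem_nth 0 lt1).
- move=> i1; apply: (sorted_ltn_nth lt_trans) => //; rewrite ?inE.
    by apply: leq_trans nl; rewrite ltn_add2l ltn_double.
  by rewrite doubleS !addnS.
Qed.

Lemma zigzag_upcrossings x u c t l off n : sorted <%R l ->
  (forall s, s \in l -> 0 <= s <= t) -> (off + n.*2 <= size l)%N ->
  zigzag (beyond x u (c / 2)) (odd off) l -> (n%:R%:E <= upcrossings x u c t)%E.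
Proof.
move=> sl ml nl zl; apply: ereal_sup_ubound.
have ct := zigzag_crossing_times sl ml nl.
exists n, (fun i => nth 0 l (off + i.*2)), (fun i => nth 0 l (off + i.*2).+1); split => //.
congr EFin; transitivity (\sum_(i < n) (1 : R)); first by rewrite sumr_const card_ord.
apply: eq_bigr => i _.
have lt1 : ((off + i.*2).+1 < size l)%N.
  by apply: leq_trans nl; rewrite -addnS -addnS leq_add2l -doubleS leq_double.
have := zigzag_nth zl lt1; have := zigzag_nth zl (ltnW lt1).
by rewrite /= oddD odd_double addbF addbN addbb /= => -> ->.
Qed.

Lemma zigzag_downcrossings x u c t l off n : sorted <%R l ->
  (forall s, s \in l -> 0 <= s <= t) -> (off + n.*2 <= size l)%N ->
  zigzag (beyond x u (c / 2)) (~~ odd off) l -> (n%:R%:E <= downcrossings x u c t)%E.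
Proof.
move=> sl ml nl zl; apply: ereal_sup_ubound.
have ct := zigzag_crossing_times sl ml nl.
exists n, (fun i => nth 0 l (off + i.*2)), (fun i => nth 0 l (off + i.*2).+1); split => //.
congr EFin; transitivity (\sum_(i < n) (1 : R)); first by rewrite sumr_const card_ord.
apply: eq_bigr => i _.
have lt1 : ((off + i.*2).+1 < size l)%N.
  by apply: leq_trans nl; rewrite -addnS -addnS leq_add2l -doubleS leq_double.
have := zigzag_nth zl lt1; have := zigzag_nth zl (ltnW lt1).
by rewrite /= oddD odd_double addbF addbN addNb addbb /= => -> ->.
Qed.

(** Among [m] alternating points, the pairs starting at index [0] give [m / 2] crossings of one kind
    and those starting at index [1] give [(m - 1) / 2] of the other, both rounded down; together
    [m - 1]. *)
Lemma zigzag_crossings x u c t l (b : bool) : sorted <%R l ->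
  (forall s, s \in l -> 0 <= s <= t) ->
  zigzag (beyond x u (c / 2)) b l -> ((size l).-1%:R%:E <= crossings x u c t)%E.
Proof.
move=> sl ml zl; rewrite -[(size l).-1]odd_double_half.
pose n := (size l)./2; pose n' := (size l).-1./2.
have -> : (odd (size l).-1 + (size l).-1./2.*2 = n + n')%N.
  rewrite odd_double_half /n /n'; case: (size l) => [//|k] /=.
  by rewrite -[LHS]odd_double_half -addnn uphalf_half addnA.
have nl : (0 + n.*2 <= size l)%N by rewrite add0n -[leqRHS]odd_double_half leq_addl.
have n'l : (n' = 0%N) \/ (1 + n'.*2 <= size l)%N.
  rewrite /n'; case: (size l) => [|k]; [by left|right].
  by rewrite add1n ltnS /= -[leqRHS]odd_double_half leq_addl.
rewrite natrD EFinD /crossings; case: b zl => zl; last first.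
  apply: leeD; first exact: (zigzag_upcrossings sl ml nl).
  case: n'l => [->|n'l]; last exact: (zigzag_downcrossings sl ml n'l).
  exact: (@zigzag_downcrossings _ _ _ _ [::] 0 0).
rewrite addeC; apply: leeD; last exact: (zigzag_downcrossings sl ml nl).
case: n'l => [->|n'l]; last exact: (zigzag_upcrossings sl ml n'l).
exact: (@zigzag_upcrossings _ _ _ _ [::] 0 0).
Qed.

(** Only the pairs that realise a crossing are kept; concatenated in order they alternate by
    themselves. The bound by [g n.-1] is there for the induction, to append the next pair. *)
Lemma crossing_times_zigzag (A : bool -> R -> bool) (b : bool) t n f g :
  crossing_times t n f g -> exists l, [/\ sorted <%R l,
    forall s, s \in l -> 0 <= s <= t /\ ((0 < n)%N -> s <= g n.-1),
    zigzag A b l & size l = (\sum_(i < n) (A b (f i) && A (~~ b) (g i)))%N.*2].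
Proof.
elim: n => [|n IH] ct; first by exists [::]; split => //; rewrite big_ord0.
have ct' : crossing_times t n f g.
  move=> i iN; have [f0 fg gt gf] := ct i (ltnW iN); split => // i1.
  by apply: gf; rewrite ltnS ltnW.
have [l [sl ml zl szl]] := IH ct'.
have [f0 fg gt _] := ct n (ltnSn n).
have lf s : s \in l -> s < f n.
  move=> sl'; have [_] := ml _ sl'; have [n0|n0] := posnP n.
    by move: szl sl'; rewrite n0 big_ord0 => /eqP; rewrite size_eq0 => /eqP ->.
  move=> /(_ isT) sg; apply: le_lt_trans sg _.
  have [|_ _ _] := ct n.-1; first by rewrite prednK.
  by rewrite !prednK// => /(_ (ltnSn n)).
have gn : forall s, s \in l -> s <= g n.
  by move=> s /lf/ltW sf; apply: le_trans sf (ltW fg).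
rewrite big_ord_recr/=.
have [/andP[Af Ag]|_] := boolP (A b (f n) && A (~~ b) (g n)); last first.
  exists l; split => //; last by rewrite addn0.
  by move=> s sinl; split; [case: (ml s sinl)|move=> _; exact: gn].
exists (l ++ [:: f n; g n]); split.
- rewrite (sorted_pairwise lt_trans) pairwise_cat -(sorted_pairwise lt_trans) sl/= fg !andbT.
  by apply/allrelP => s r /lf sf; rewrite !inE => /pred2P[->//|->]; exact: lt_trans fg.
- move=> s; rewrite mem_cat !inE => /or3P[sinl|/eqP->|/eqP->].
  + by split; [case: (ml s sinl)|move=> _; exact: gn].
  + by rewrite f0 (le_trans (ltW fg))//; split => // _; exact: ltW.
  + by rewrite gt (le_trans f0 (ltW fg)); split.
- by rewrite zigzag_cat zl szl odd_double addbF /= Af Ag.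
- by rewrite size_cat szl /= doubleD.
Qed.

Lemma upcrossings_le x u c t K : (forall l, sorted <%R l ->
    (forall s, s \in l -> 0 <= s <= t) -> zigzag (beyond x u (c / 2)) false l ->
    (size l)%:R <= K) -> (upcrossings x u c t <= (K / 2)%:E)%E.
Proof.
move=> HK; apply: ge_ereal_sup => _ [n [f [g [ct ->]]]].
have [l [sl ml zl szl]] := crossing_times_zigzag (beyond x u (c / 2)) false ct.
rewrite lee_fin ler_pdivlMr//.
have := HK l sl _ zl; rewrite szl -mul2n natrM mulrC natr_sum; apply.
by move=> s /ml[].
Qed.

Lemma downcrossings_le x u c t K : (forall l, sorted <%R l ->
    (forall s, s \in l -> 0 <= s <= t) -> zigzag (beyond x u (c / 2)) true l ->
    (size l)%:R <= K) -> (downcrossings x u c t <= (K / 2)%:E)%E.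
Proof.
move=> HK; apply: ge_ereal_sup => _ [n [f [g [ct ->]]]].
have [l [sl ml zl szl]] := crossing_times_zigzag (beyond x u (c / 2)) true ct.
rewrite lee_fin ler_pdivlMr//.
have := HK l sl _ zl; rewrite szl -mul2n natrM mulrC natr_sum; apply.
by move=> s /ml[].
Qed.

(** Upcrossings use zigzags that start low and downcrossings those that start high, two points for
    each crossing; the total is therefore bounded by the average of the two lengths. *)
Lemma crossings_le x u c t K K' : (forall l (b : bool), sorted <%R l ->
    (forall s, s \in l -> 0 <= s <= t) -> zigzag (beyond x u (c / 2)) b l ->
    (size l)%:R <= if b then K else K') -> (crossings x u c t <= ((K + K') / 2)%:E)%E.
Proof.
move=> HK; rewrite mulrDl addrC EFinD; apply: leeD.
  by apply: upcrossings_le => l sl ml zl; exact: (HK l false).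
by apply: downcrossings_le => l sl ml zl; exact: (HK l true).
Qed.

End CrossingCounts.

(** * Level changes along fine partitions compared with crossings *)

Section SkorokhodCrossings.
Context {R : realType}.
Implicit Types (a b s t r u : R).

(** Each point is visited first as [r-] and then as [r], so that a jump straddling the level counts
    as a change of its own. *)
Fixpoint two_sided (P : seq R) : seq (R * bool) :=
  if P is r :: P' then [:: (r, false), (r, true) & two_sided P'] else [::].

Lemma mem_two_sided P r d : ((r, d) \in two_sided P) = (r \in P).
Proof.
elim: P => [//|v P IH] /=; rewrite !inE IH !xpair_eqE.
by case: (r == v) => //; case: (d).
Qed.

Lemma last_two_sided P s : last (s, true) (two_sided P) = (last s P, true).
Proof. by elim: P s => [//|v P IH] s /=. Qed.

Lemma path_two_sided P s : path <%R s P -> path (@time_le R) (s, true) (two_sided P).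
Proof.
elim: P s => [//|v P IH] s /= /andP[sv /IH ->].
by rewrite /time_le/= sv eqxx/= orbT.
Qed.

Lemma subseq_two_sided P : subseq [seq (r, true) | r <- P] (two_sided P).
Proof.
elim: P => [//|v P IH]; rewrite [two_sided _]/= map_cons.
by apply: (subseq_trans _ (subseq_cons _ _)); rewrite /= eqxx.
Qed.

(** The correction [z p == d] is the off-by-one: the first entry of the zigzag costs no change
    exactly when the initial state already has the required value. *)
Lemma subseq_changes (z : R * bool -> bool) (d : bool) (l : seq R) p Q :
  subseq [seq (r, true) | r <- l] Q ->
  zigzag (fun d r => z (r, true) == d) d l ->
  (size l <= changes z p Q + (z p == d))%N.
Proof.
elim: Q d l p => [|q Q IH] d [|r l] p //.
rewrite map_cons [subseq _ _]/=; case: ifP => [/eqP <-{q}|_].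
  move=> lQ /= /andP[/eqP zr zl].
  have := IH _ _ (r, true) lQ zl; rewrite zr.
  by case: (d) (z p) => [] []/=; lia.
rewrite -map_cons => lQ zl; apply: leq_trans (IH _ _ q lQ zl) _ => /=.
by case: (z p) (z q) d {zl} => [] [] [] /=; lia.
Qed.

Lemma sorted_sub_subseq (l P : seq R) : sorted <%R l -> sorted <%R P ->
  {subset l <= P} -> subseq l P.
Proof.
move=> sl sP lP; suff -> : l = [seq r <- P | r \in l] by exact: filter_subseq.
apply: lt_sorted_eq => //; first by apply: sorted_filter => //; exact: lt_trans.
by move=> r; rewrite mem_filter; case: (boolP (r \in l)) => // /lP ->.
Qed.

Lemma zigzag_changes (z : R * bool -> bool) (d : bool) (l : seq R) s P :
  path <%R s P -> sorted <%R l -> {subset l <= s :: P} ->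
  zigzag (fun d r => z (r, true) == d) d l ->
  (size l <= (changes z (s, true) (two_sided P)).+1)%N.
Proof.
move=> sP sl lP zl.
have := sorted_sub_subseq sl (sP : sorted <%R (s :: P)) lP.
case: l sl lP zl => [//|r l] sl lP zl; rewrite [subseq _ _]/=.
case: ifP => [/eqP rs|_] sub.
  subst r; move: zl => /= /andP[/eqP zr zl]; rewrite ltnS.
  have sub' : subseq [seq (r, true) | r <- l] (two_sided P).
    by apply: subseq_trans (subseq_two_sided P); exact: map_subseq.
  have := subseq_changes (s, true) sub' zl.
  by rewrite zr; case: (d) => /=; rewrite addn0.
have sub' : subseq [seq (r, true) | r <- r :: l] (two_sided P).
  by apply: subseq_trans (subseq_two_sided P); exact: map_subseq.
apply: leq_trans (subseq_changes (s, true) sub' zl) _.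
by rewrite -addn1 leq_add2l leq_b1.
Qed.

Lemma negligible_bigcup_count (I : countType) (F : I -> set R) :
  (forall i, (@lebesgue_measure R).-negligible (F i)) ->
  (@lebesgue_measure R).-negligible (\bigcup_i F i).
Proof.
move=> nF; apply: negligibleS (_ : (@lebesgue_measure R).-negligible
    (\bigcup_n (if unpickle n is Some i then F i else set0))).
  by move=> u [i _ Fi]; exists (pickle i) => //; rewrite pickleK.
apply: negligible_bigcup => n; case: unpickle => [i|]; first exact: nF.
exact: negligible_set0.
Qed.

Lemma chain_dense (e : R) s P v :
  chain (fun a b => b - a <= e) s P -> s <= v -> v < last s P ->
  exists2 r, r \in P & v < r <= v + e.
Proof.
elim: P s => [|r P IH] s /=; first by move=> _ sv; rewrite ltNge sv.
move=> [sr re cP] sv vl; have [vr|rv] := ltP v r.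
  by exists r; [rewrite mem_head|rewrite vr/=; lra].
by have [r' r'P hr'] := IH _ cP rv vl; exists r' => //; rewrite inE r'P orbT.
Qed.

Context (T t c : R) (x y phi : R -> R).
Context (c_gt0 : 0 < c) (t_gt0 : 0 < t) (t_le : t <= T).
Context (cx : cadlag T x) (cy : cadlag T y) (cphi : cadlag T phi).
Context (xE : forall s, 0 <= s <= T -> x s = y s + phi s).
Context (phi_le : forall s, 0 <= s <= T -> `|phi s| <= c / 2).
Context (push : pushes_up T y phi (c / 2)).
Context (pushN : pushes_up T (\- y) (\- phi) (c / 2)).

(** A consequence of [|phi| <= c / 2]. Only a weak inequality survives, which is why levels that [y]
    merely touches need a separate treatment. *)
Lemma beyond_level u (d : bool) s : 0 <= s <= T -> beyond x u (c / 2) d s ->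
  if d then u <= y s else y s <= u.
Proof.
move=> sT; rewrite /beyond xE//; have := phi_le sT; rewrite ler_norml => /andP[? ?].
by case: d => ?; lra.
Qed.

(** The oscillation [c / 2] is strictly below the band width [c], and the partition is chosen before
    the level: hence the uniformity in [u]. *)
Lemma zigzag_uniform_bound : exists M : nat, forall u (d : bool) l, sorted <%R l ->
  (forall s, s \in l -> 0 <= s <= t) -> zigzag (beyond x u (c / 2)) d l ->
  (size l <= M)%N.
Proof.
have c20 : 0 < c / 2 by rewrite divr_gt0.
have [P cP lP] := locally_fine_chain (ltW (lt_le_trans t_gt0 t_le)) (cadlag_osc cx c20).
exists (size P).+1 => u d l sl ml; apply: (zigzag_bound _ cP) => //.
  by lra.
by move=> s /ml /andP[-> st]; rewrite lP (le_trans st).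
Qed.

Lemma changes_bounds u (Q : seq (R * bool)) p : path (@time_le R) p Q ->
  0 <= p.1 -> (last p Q).1 <= t ->
  (forall p', p' \in p :: Q -> value y p' != u) ->
  ((changes (fun p' => u < value y p')%R p Q).-1%:R%:E <= crossings x u c t)%E /\
  forall M : nat, (forall (d : bool) l, sorted <%R l ->
    (forall s, s \in l -> 0 <= s <= t) -> zigzag (beyond x u (c / 2)) d l ->
    (size l <= M)%N) -> (changes (fun p' => u < value y p')%R p Q <= M)%N.
Proof.
move=> pQ p0 lt yu.
have c20 : 0 < c / 2 by rewrite divr_gt0.
have [l [<- sl ml zl]] := changes_zigzag c20 cy cphi xE push pushN pQ p0 (le_trans lt t_le) yu.
have ml' s : s \in l -> 0 <= s <= t.
  by move=> /ml /andP[ps sl']; rewrite (le_trans p0 ps) (le_trans sl' lt).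
split; first exact: zigzag_crossings ml' zl.
by move=> M; apply; [exact: sl|exact: ml'|exact: zl].
Qed.

(** Rational endpoints leave countably many windows, and within one window all minimal values
    coincide, as do all maximal ones; so only countably many levels occur. *)
Definition local_extrema : set R :=
  [set u | exists q q' : rat, exists s, [/\ ratr q < s < ratr q', y s = u &
    (forall r, ratr q < r < ratr q' -> y s <= y r) \/
    (forall r, ratr q < r < ratr q' -> y r <= y s)]].

Lemma local_extrema_negligible :
  (@lebesgue_measure R).-negligible local_extrema.
Proof.
pose E (d : bool) (q : rat * rat) : set R := [set u | exists s,
  [/\ ratr q.1 < s < ratr q.2, y s = u & forall r, ratr q.1 < r < ratr q.2 ->
    if d then y s <= y r else y r <= y s]].
have nE d q : (@lebesgue_measure R).-negligible (E d q).
  have [->|[u Eu]] : E d q = set0 \/ exists u, E d q u.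
    by have [/eqP|/set0P] := boolP (E d q == set0); [left|right].
    exact: negligible_set0.
  exists [set u]; split => //; first exact: lebesgue_measure_set1.
  move=> v [s [sq <- hs]]; have [s' [s'q <- hs']] := Eu => /=.
  have := hs _ s'q; have := hs' _ sq; case: (d) => h h';
    by apply/eqP; rewrite eq_le h h'.
apply: negligibleS (_ : (@lebesgue_measure R).-negligible
    (\bigcup_(i : bool * (rat * rat)) E i.1 i.2)).
  move=> u [q [q' [s [sq ys [hs|hs]]]]].
    by exists (true, (q, q')); [|exists s; split; [exact: sq|exact: ys|exact: hs]].
  by exists (false, (q, q')); [|exists s; split; [exact: sq|exact: ys|exact: hs]].
by apply: negligible_bigcup_count => -[d q]; exact: nE.
Qed.

Context (eps : nat -> R) (P : nat -> seq R).
Context (eps_cvg : eps n @[n --> \oo] --> 0).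
Context (P_mesh : forall k, chain (fun a b => b - a <= eps k) 0 (P k)).
Context (P_last : forall k, last 0 (P k) = t).

Definition partition_values : set R :=
  [set u | exists k p, p \in (0, true) :: two_sided (P k) /\ value y p = u].

Lemma partition_values_negligible :
  (@lebesgue_measure R).-negligible partition_values.
Proof.
apply: negligibleS (_ : (@lebesgue_measure R).-negligible (\bigcup_k \bigcup_i
    [set value y (nth (0, true) ((0, true) :: two_sided (P k)) i)])).
  move=> u [k [p [pP <-]]]; exists k => //; exists (index p ((0, true) :: two_sided (P k))) => //=.
  by rewrite nth_index.
apply: negligible_bigcup => k; apply: negligible_bigcup => i.
by exists [set value y (nth (0, true) ((0, true) :: two_sided (P k)) i)]; split => //;
  exact: lebesgue_measure_set1.
Qed.

Lemma last_mem_partition k : t \in P k.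
Proof.
have := P_last k; case: (P k) => [/= t0|r Q /= <-]; last exact: mem_last.
by move: t_gt0; rewrite -t0 ltxx.
Qed.

(** At [s] the path [y] is weakly on side [d] of [u]. If [y s = u], then [s] is no local extremum,
    so [y] is strictly on side [d] at some [s'] close by. Right continuity carries the strict
    inequality to a right neighbourhood, which contains a point of every sufficiently fine
    partition. The ends [0] and [t] are safe because they are partition points and [u] is not a
    value there. *)
Lemma beyond_partition u (d : bool) s delta : ~ partition_values u -> ~ local_extrema u ->
  0 <= s <= t -> beyond x u (c / 2) d s -> 0 < delta ->
  \forall k \near \oo, exists r, [/\ r \in 0 :: P k, `|r - s| < delta & (u < y r) = d].
Proof.
move=> pu lu /andP[s0 st] bs d0.
have ys := beyond_level (introT andP (conj s0 (le_trans st t_le))) bs.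
have pv p k : p \in (0, true) :: two_sided (P k) -> value y p != u.
  by move=> pP; apply/eqP => yp; apply: pu; exists k, p.
have yt : y t != u.
  by apply: (pv (t, true) 0%N); rewrite inE mem_two_sided last_mem_partition orbT.
have y0 : y 0 != u by apply: (pv (0, true) 0%N); rewrite mem_head.
have strict r : (if d then u <= y r else y r <= u) -> y r != u -> (u < y r) = d.
  by case: (d) => h ne; [rewrite lt_neqAle eq_sym ne|rewrite ltNge h].
move: st; rewrite le_eqVlt => /predU1P[st|st].
  subst s; apply: nearW => k; exists t; rewrite subrr normr0; split => //.
    by rewrite inE last_mem_partition orbT.
  exact: strict.
have [s' [s'0 s't s's hs']] : exists s', [/\ 0 <= s', s' < t, `|s' - s| < delta / 2 &
    if d then u < y s' else y s' < u].
  have [yu|yu] := eqVneq (y s) u; last first.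
    exists s; rewrite subrr normr0 divr_gt0//; split => //.
    by case: (d) ys => h; rewrite lt_neqAle ?yu// eq_sym yu.
  have {}s0 : 0 < s by rewrite lt_neqAle s0 andbT; apply: contra_neq y0 => ->.
  have [q hq] : exists q : rat, Num.max 0 (s - delta / 2) < ratr q < s.
    have /rat_in_itvoo[q] : Num.max 0 (s - delta / 2) < s by rewrite gt_max s0/=; lra.
    by rewrite in_itv/= => hq; exists q.
  have [q' hq'] : exists q' : rat, s < ratr q' < Num.min t (s + delta / 2).
    have /rat_in_itvoo[q'] : s < Num.min t (s + delta / 2) by rewrite lt_min st/=; lra.
    by rewrite in_itv/= => hq'; exists q'.
  move: hq hq'; rewrite gt_max lt_min => /andP[/andP[q0 qd] qs] /andP[sq' /andP[q't q'd]].
  have [r [qr rq' hr]] : exists r, [/\ ratr q < r, r < ratr q' & if d then u < y r else y r < u].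
    apply: contrapT => nr; apply: lu; exists q, q', s; split => //; first by rewrite qs.
    case: (d) nr => nr; [right|left] => r /andP[qr rq']; rewrite yu leNgt; apply/negP => h;
      by apply: nr; exists r.
  exists r; split => //; [exact: ltW (lt_trans q0 qr)|exact: lt_trans q't|].
  by rewrite ltr_norml; apply/andP; split; lra.
have s'T : s' \in `[0, T[ by rewrite in_itv/= s'0 (lt_le_trans s't t_le).
have e0 : 0 < `|y s' - u|.
  rewrite normr_gt0 subr_eq0; apply/eqP => yu.
  by move: hs'; rewrite yu ltxx; case: (d).
have /cvgrPdist_lt/(_ _ e0) := cy.1 _ s'T.
rewrite near_withinE => /(@nbhs_ballP _ R)[e/= e1 he].
have he' : 0 < Num.min e (delta / 2) by rewrite lt_min e1 divr_gt0.
near=> k.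
have ek : eps k < Num.min e (delta / 2).
  near: k; have /cvgrPdist_lt/(_ _ he') := eps_cvg; apply: filterS => k.
  by rewrite sub0r normrN; apply: le_lt_trans; exact: ler_norm.
have s'l : s' < last 0 (P k) by rewrite P_last.
have [r rP /andP[s'r rs']] := chain_dense (P_mesh k) s'0 s'l.
move: ek; rewrite lt_min => /andP[eke ekd].
exists r; split; first by rewrite inE rP orbT.
  by move: s's; rewrite !ltr_norml => /andP[? ?]; apply/andP; split; lra.
have := he r; rewrite /ball/= distrC gtr0_norm ?subr_gt0// => /(_ _ s'r).
have -> : r - s' < e by lra.
move=> /(_ isT); case: (d) hs' => hs'.
  by rewrite (@gtr0_norm _ (y s' - u)) ?subr_gt0// ltr_norml => /andP[? ?]; lra.
rewrite (@ltr0_norm _ (y s' - u)) ?subr_lt0// ltr_norml => /andP[? ?].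
by apply/negbTE; rewrite -leNgt; lra.
Unshelve. all: by end_near. Qed.

(** Neighbours [s] and [s'] each move by less than half of [s' - s], so the order survives. The
    clause on [head] hands the displacement of the first point through the induction. *)
Lemma zigzag_partition u (d : bool) l delta : ~ partition_values u -> ~ local_extrema u ->
  sorted <%R l -> (forall s, s \in l -> 0 <= s <= t) ->
  zigzag (beyond x u (c / 2)) d l -> 0 < delta ->
  \forall k \near \oo, exists l', [/\ size l' = size l, sorted <%R l',
    {subset l' <= 0 :: P k}, zigzag (fun d r => (u < y r) == d) d l' &
    forall s0, `|head s0 l' - head s0 l| < delta].
Proof.
move=> pu lu; elim: l d delta => [|s l IH] d delta sl ml.
  by move=> _ d0; apply: nearW => k; exists [::]; split => // s0; rewrite subrr normr0.
move=> /= /andP[bs zl] d0.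
pose delta' := if l is s' :: _ then Num.min delta ((s' - s) / 2) else delta.
have d'0 : 0 < delta'.
  rewrite /delta'; case: (l) sl => [//|s' ?] /= /andP[ss' _].
  by rewrite lt_min d0 divr_gt0// subr_gt0.
have d'd : delta' <= delta by rewrite /delta'; case: (l) => [//|s' ?]; rewrite ge_min lexx.
have H1 := beyond_partition pu lu (ml s (mem_head _ _)) bs d'0.
have H2 := IH (~~ d) delta' (path_sorted sl) (fun r rl => ml r (mem_behead (s := s :: l) rl)) zl d'0.
near=> k.
have [r [rP rs zr]] : exists r, [/\ r \in 0 :: P k, `|r - s| < delta' & (u < y r) = d].
  by near: k.
have [l' [sz sl' l'P zl' hl']] : exists l', [/\ size l' = size l, sorted <%R l',
    {subset l' <= 0 :: P k}, zigzag (fun d r => (u < y r) == d) (~~ d) l' &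
    forall s0, `|head s0 l' - head s0 l| < delta'].
  by near: k.
exists (r :: l'); split => //=.
- by rewrite sz.
- case: l' sz sl' hl' {l'P zl'} => [//|r' l'] sz sl' hl'; rewrite /= in sl' *; rewrite sl' andbT.
  move: sz sl rs hl'; rewrite /delta'; case: (l) => [//|s' l0] _ /= /andP[ss' _] rs /(_ 0)/=.
  move: rs; rewrite !lt_min !ltr_norml => /andP[_ /andP[? ?]] /andP[_ /andP[? ?]].
  by lra.
- by move=> v; rewrite inE => /predU1P[->//|/l'P].
- by rewrite zr eqxx.
- by move=> _; exact: lt_le_trans d'd.
Unshelve. all: by end_near. Qed.

Definition partition_changes k u :=
  changes (fun p => u < value y p)%R (0, true) (two_sided (P k)).

Lemma bounded_zigzag_max u (d : bool) : exists l, [/\ sorted <%R l,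
  forall s, s \in l -> 0 <= s <= t, zigzag (beyond x u (c / 2)) d l &
  forall l', sorted <%R l' -> (forall s, s \in l' -> 0 <= s <= t) ->
    zigzag (beyond x u (c / 2)) d l' -> (size l' <= size l)%N].
Proof.
have [M HM] := zigzag_uniform_bound.
pose p n := `[< exists l, [/\ sorted <%R l, forall s, s \in l -> 0 <= s <= t,
  zigzag (beyond x u (c / 2)) d l & size l = n] >].
have p0 : exists n, p n by exists 0%N; apply/asboolP; exists [::].
have pM n : p n -> (n <= M)%N by move=> /asboolP[l [sl ml zl <-]]; exact: HM ml zl.
case: (ex_maxnP p0 pM) => n /asboolP[l [sl ml zl <-]] nmax.
exists l; split => // l' sl' ml' zl'; apply: nmax; apply/asboolP; by exists l'.
Qed.

(** It suffices to transfer to the partition one longest zigzag of each kind; these exist since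
    lengths are bounded. Each then has at most one point more than there are changes, and so has the
    average of the lengths, which bounds the crossings. *)
Lemma crossings_le_partition_changes u : ~ partition_values u -> ~ local_extrema u ->
  \forall k \near \oo, (crossings x u c t <= (partition_changes k u).+1%:R%:E)%E.
Proof.
move=> pu lu.
have [l [sl ml zl lmax]] := bounded_zigzag_max u false.
have [l' [sl' ml' zl' l'max]] := bounded_zigzag_max u true.
have cle := @crossings_le R x u c t (size l')%:R (size l)%:R.
have := zigzag_partition pu lu sl ml zl ltr01.
have := zigzag_partition pu lu sl' ml' zl' ltr01.
apply: filterS2 => k [m' [sz' sm' m'P zm' _]] [m [sz sm mP zm _]].
have pk : path <%R 0 (P k) by exact: chain_path (P_mesh k).
have h := zigzag_changes pk sm mP (z := fun p => u < value y p)%R zm.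
have h' := zigzag_changes pk sm' m'P (z := fun p => u < value y p)%R zm'.
rewrite -/(partition_changes k u) in h h'.
apply: le_trans (cle _) _.
  by move=> l0 d sl0 ml0 zl0; case: d zl0 => zl0; rewrite ler_nat; [exact: l'max|exact: lmax].
rewrite lee_fin ler_pdivrMr// -natrD -natrM ler_nat -sz -sz'.
by rewrite muln2 -addnn; exact: leq_add.
Qed.

(** The last clause localises a count defined through [x] by the range of [y]: [x] cannot be beyond
    the band on a side of [u] that [y] never reaches, and a crossing needs both sides. *)
Lemma crossings_bounded : exists M : R, forall u,
  [/\ (0 <= crossings x u c t)%E, (crossings x u c t <= M%:E)%E &
  ((forall s, 0 <= s <= t -> y s < u) \/ (forall s, 0 <= s <= t -> u < y s) ->
    crossings x u c t = 0%E)].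
Proof.
have [M HM] := zigzag_uniform_bound; exists M%:R => u.
have c0 : (0 <= crossings x u c t)%E.
  exact: (@zigzag_crossings R x u c t [::] true).
split => //.
  have -> : M%:R = (M%:R + M%:R) / 2 :> R by lra.
  apply: crossings_le => l d sl ml zl; rewrite if_same ler_nat; exact: HM ml zl.
move=> hu; apply/eqP; rewrite eq_le c0 andbT.
have [d nd] : exists d : bool, forall s, 0 <= s <= t -> ~~ beyond x u (c / 2) d s.
  case: hu => hu; [exists true|exists false] => s /[dup] /hu ys /andP[s0 st];
    apply/negP => /beyond_level; rewrite s0 (le_trans st t_le) => /(_ isT);
    by rewrite leNgt ys.
rewrite -[leRHS]adde0; apply: leeD; apply: ge_ereal_sup => _ [n [f [g [ct ->]]]];
  rewrite big1// => i _; have [f0 fg gt _] := ct i (ltn_ord i).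
  have := nd (f i); have := nd (g i); rewrite f0 gt (le_trans (ltW fg) gt) (le_trans f0 (ltW fg)).
  by case: (d) => /(_ isT)/negbTE/= h1 /(_ isT)/negbTE/= h2; rewrite ?h1 ?h2 ?andbF.
have := nd (f i); have := nd (g i); rewrite f0 gt (le_trans (ltW fg) gt) (le_trans f0 (ltW fg)).
by case: (d) => /(_ isT)/negbTE/= h1 /(_ isT)/negbTE/= h2; rewrite ?h1 ?h2 ?andbF.
Qed.

End SkorokhodCrossings.

(** * Riemann sums against level indicators *)

Section IntegrableEFin.
Context d (T : measurableType d) {R : realType}.
Variable mu : {measure set T -> \bar R}.

Lemma integrableD_EFin (D : set T) (f g : T -> R) : measurable D ->
  mu.-integrable D (EFin \o f) -> mu.-integrable D (EFin \o g) ->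
  mu.-integrable D (EFin \o (fun x => f x + g x)).
Proof.
by move=> mD fi gi; have := integrableD mD fi gi; apply: eq_integrable.
Qed.

Lemma integrableB_EFin (D : set T) (f g : T -> R) : measurable D ->
  mu.-integrable D (EFin \o f) -> mu.-integrable D (EFin \o g) ->
  mu.-integrable D (EFin \o (fun x => f x - g x)).
Proof.
by move=> mD fi gi; have := integrableB mD fi gi; apply: eq_integrable.
Qed.

End IntegrableEFin.

Section ReflectedVariation.
Context {R : realType}.
Implicit Types (a b s r u : R).
Local Notation mu := (@lebesgue_measure R).

(** Splitting at [r-] lets the jump of [G] at [r] carry the weight [w r] and the rest of the
    increment the weight [w s]. With [w = x] the limit is the Stieltjes integral of the left limits
    of [x] plus the sum of products of jumps, the two terms that [deriv_integral] subtracts. *)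
Fixpoint riemann_sum (w : R -> R) (G : R * bool -> R) s (P : seq R) : R :=
  if P is r :: P' then
    w s * (G (r, false) - G (s, true)) + w r * (G (r, true) - G (r, false)) +
    riemann_sum w G r P'
  else 0.

Lemma riemann_sumD w w' G s P :
  riemann_sum (w \+ w') G s P = riemann_sum w G s P + riemann_sum w' G s P.
Proof. by elim: P s => [|r P IH] s /=; rewrite ?addr0// IH; ring. Qed.

Lemma riemann_sum_cst v G s P :
  riemann_sum (cst v) G s P = v * (G (last s P, true) - G (s, true)).
Proof. by elim: P s => [|r P IH] s /=; rewrite ?subrr ?mulr0// IH; ring. Qed.

Lemma eq_riemann_sum w w' G s P : (forall r, r \in s :: P -> w r = w' r) ->
  riemann_sum w G s P = riemann_sum w' G s P.
Proof.
elim: P s => [//|r P IH] s /= H; rewrite !H ?mem_head ?inE ?eqxx ?orbT//.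
by rewrite IH// => r' r'P; apply: H; rewrite inE r'P orbT.
Qed.

Fixpoint variation2 (G : R * bool -> R) p (Q : seq (R * bool)) : R :=
  if Q is p' :: Q' then `|G p' - G p| + variation2 G p' Q' else 0.

Definition level (y : R -> R) u (p : R * bool) : R := (u < value y p)%R%:R.

Lemma level_signed y u p p' :
  level y u p' - level y u p = signed_itv (value y p) (value y p') u.
Proof. by []. Qed.

Lemma level_dist y u p p' :
  `|level y u p' - level y u p| = (((u < value y p)%R != (u < value y p')%R) : nat)%:R.
Proof.
rewrite /level; case: (u < value y p)%R; case: (u < value y p')%R => /=;
  by rewrite ?subrr ?normr0 ?subr0 ?normr1 ?sub0r ?normrN ?normr1.
Qed.

Lemma variation2_level y u p Q : variation2 (level y u) p Q =
  (changes (fun p => u < value y p)%R p Q)%:R.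
Proof. by elim: Q p => [//|p' Q IH] p /=; rewrite IH level_dist natrD. Qed.

Context (f f2 : R -> R).
Context (lf2 : locally_integrable setT f2).
Context (f2E : forall a b,
  derive1 f b - derive1 f a = \int[mu]_u (signed_itv a b u * f2 u)).

Lemma integrable_level_scaled y k p p' :
  mu.-integrable setT (EFin \o (fun u => k * (level y u p' - level y u p) * f2 u)).
Proof.
rewrite (_ : _ \o _ = EFin \o (fun u => k * (signed_itv (value y p) (value y p') u * f2 u))).
  by apply: integrableZl_EFin => //; exact: integrable_signed_itv1.
by apply/funext => u; rewrite /= -level_signed mulrA.
Qed.

Lemma integral_level_scaled y k p p' :
  \int[mu]_u (k * (level y u p' - level y u p) * f2 u) =
  k * (derive1 f (value y p') - derive1 f (value y p)).
Proof.
rewrite f2E -RintegralZl//; last exact: integrable_signed_itv1.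
by apply: eq_Rintegral => u _; rewrite -level_signed mulrA.
Qed.

Lemma riemann_sum_integral y w s P :
  mu.-integrable setT (EFin \o (fun u => riemann_sum w (level y u) s P * f2 u)) /\
  riemann_sum w (derive1 f \o value y) s P =
  \int[mu]_u (riemann_sum w (level y u) s P * f2 u).
Proof.
elim: P s => [|r P IH] s.
  split => /=; last first.
    by under eq_Rintegral do rewrite mul0r; rewrite Rintegral_cst// mul0r.
  rewrite (_ : _ \o _ = cst 0%E); first exact: integrable0.
  by apply/funext => u /=; rewrite mul0r.
have [i3 e3] := IH r.
have i1 := integrable_level_scaled y (w s) (s, true) (r, false).
have i2 := integrable_level_scaled y (w r) (r, false) (r, true).
have i12 := integrableD_EFin measurableT i1 i2.
have i123 := integrableD_EFin measurableT i12 i3.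
have fE u : riemann_sum w (level y u) s (r :: P) * f2 u =
    w s * (level y u (r, false) - level y u (s, true)) * f2 u +
    w r * (level y u (r, true) - level y u (r, false)) * f2 u +
    riemann_sum w (level y u) r P * f2 u.
  by rewrite /= !mulrDl.
split; first by apply: eq_integrable i123 => // u _; rewrite [RHS]/= fE.
have -> : riemann_sum w (derive1 f \o value y) s (r :: P) =
    w s * (derive1 f (value y (r, false)) - derive1 f (value y (s, true))) +
    w r * (derive1 f (value y (r, true)) - derive1 f (value y (r, false))) +
    riemann_sum w (derive1 f \o value y) r P by [].
rewrite e3 -!integral_level_scaled -RintegralD//.
rewrite -RintegralD//; apply: eq_Rintegral => u _.
by rewrite fE.
Qed.

(** The triangle inequality under the integral, increment by increment. By [variation2_level] the
    integrand is [|f2|] times a number of level changes, so bounds on the latter control the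
    variation of [f'(y)]. *)
Lemma variation2_integral y p Q :
  mu.-integrable setT (EFin \o (fun u => variation2 (level y u) p Q * `|f2 u|)) /\
  variation2 (derive1 f \o value y) p Q <=
  \int[mu]_u (variation2 (level y u) p Q * `|f2 u|).
Proof.
elim: Q p => [|p' Q IH] p.
  split => /=; last first.
    by under eq_Rintegral do rewrite mul0r; rewrite Rintegral_cst// mul0r.
  rewrite (_ : _ \o _ = cst 0%E); first exact: integrable0.
  by apply/funext => u /=; rewrite mul0r.
have [i2 e2] := IH p'.
have i1 : mu.-integrable setT (EFin \o (fun u => `|level y u p' - level y u p| * `|f2 u|)).
  have := integrable_norm (integrable_signed_itv1 (value y p) (value y p') lf2).
  apply: eq_integrable => // u _ /=.
  by rewrite normrM -level_signed.
have i12 := integrableD_EFin measurableT i1 i2.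
split.
  by apply: eq_integrable i12 => // u _; rewrite /= mulrDl.
rewrite [X in _ <= Rintegral _ _ X](_ : _ = (fun u => `|level y u p' - level y u p| * `|f2 u| +
    variation2 (level y u) p' Q * `|f2 u|)); last first.
  by apply/funext => u /=; rewrite mulrDl.
rewrite RintegralD//=; apply: lerD => //.
rewrite f2E; apply: le_trans (le_normr_Rintegral _ _) _ => //.
  exact: integrable_signed_itv1.
rewrite le_eqVlt; apply/orP; left; apply/eqP.
by apply: eq_Rintegral => u _; rewrite normrM -level_signed.
Qed.

End ReflectedVariation.

(** * Unordered sums tested on finite lists *)

Section FamilySums.
Context {R : realType} {I : choiceType}.
Implicit Types (D : set I) (a b : I -> R) (l : seq I).

Lemma esum_le_seq D a K : (forall l, uniq l -> (forall i, i \in l -> D i) ->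
    \sum_(i <- l) a i <= K) -> (\esum_(i in D) (a i)%:E <= K%:E)%E.
Proof.
move=> H; apply: ge_ereal_sup => _ [F [finF FD] <-].
rewrite fsbig_finite//= sumEFin lee_fin; apply: H; first exact: finmap.fset_uniq.
by move=> i; rewrite in_fset_set// inE => /FD.
Qed.

Lemma esum_ge_seq D a l : (forall i, D i -> 0 <= a i) -> uniq l ->
  (forall i, i \in l -> D i) -> ((\sum_(i <- l) a i)%:E <= \esum_(i in D) (a i)%:E)%E.
Proof.
move=> a0 ul lD; apply: ereal_sup_ubound; exists [set` l].
  by split; [exact: finite_seq|move=> i /= /lD].
by rewrite -fsbig_seq// sumEFin.
Qed.

Lemma esum_split_seq D a l : (forall i, D i -> 0 <= a i) -> uniq l ->
  (forall i, i \in l -> D i) ->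
  (\esum_(i in D) (a i)%:E =
   (\sum_(i <- l) a i)%:E + \esum_(i in D `\` [set` l]) (a i)%:E)%E.
Proof.
move=> a0 ul lD.
rewrite (esumID [set` l] D) => [|i Di]; last by rewrite lee_fin a0.
congr (_ + _)%E.
rewrite setIidr; last by move=> i; exact: lD.
rewrite esum_fset//; last by move=> i; rewrite inE/= => il; rewrite lee_fin; apply/a0/lD.
by rewrite -fsbig_seq// sumEFin.
Qed.

End FamilySums.

(** Outside [l] the positive parts and the negative parts have sums in [[0, K]], so their difference
    is at most [K] in absolute value; in particular no [fine] is applied to an infinite value. *)
Lemma real_sum_approx {R : realType} (D : set R) (a : R -> R) (l : seq R) K :
  uniq l -> (forall i, i \in l -> D i) ->
  (forall m, uniq m -> (forall i, i \in m -> D i /\ i \notin l) ->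
    \sum_(i <- m) `|a i| <= K) ->
  `|real_sum D a - \sum_(i <- l) a i| <= K.
Proof.
move=> ul lD HK.
have tail (b : R -> R) : (forall i, 0 <= b i <= `|a i|) ->
    exists2 E : R, (\esum_(i in D `\` [set` l]) (b i)%:E)%E = E%:E & 0 <= E <= K.
  move=> b0a.
  have le : (\esum_(i in D `\` [set` l]) (b i)%:E <= K%:E)%E.
    apply: esum_le_seq => m um mD; apply: le_trans (HK m um _).
      by apply: ler_sum => i _; have /andP[] := b0a i.
    by move=> i /mD[Di /= /negP].
  have ge : (0 <= \esum_(i in D `\` [set` l]) (b i)%:E)%E.
    by apply: esum_ge0 => i _; rewrite lee_fin; have /andP[] := b0a i.
  exists (fine (\esum_(i in D `\` [set` l]) (b i)%:E)).
    by rewrite fineK// ge0_fin_numE// (le_lt_trans le) ?ltry.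
  rewrite fine_ge0//= -lee_fin fineK// ge0_fin_numE// (le_lt_trans le) ?ltry//.
have pos i : 0 <= Num.max (a i) 0 <= `|a i|.
  by rewrite le_max lexx orbT ge_max ler_norm normr_ge0.
have neg i : 0 <= Num.max (- a i) 0 <= `|a i|.
  by rewrite le_max lexx orbT ge_max -normrN ler_norm normr_ge0.
have [E eE /andP[E0 EK]] := tail _ pos.
have [E' eE' /andP[E'0 E'K]] := tail _ neg.
rewrite /real_sum (@esum_split_seq _ _ _ (fun s => Num.max (a s) 0) l)//; last first.
  by move=> i _; have /andP[] := pos i.
rewrite (@esum_split_seq _ _ _ (fun s => Num.max (- a s) 0) l)//; last first.
  by move=> i _; have /andP[] := neg i.
rewrite eE eE' -!EFinD /=.
have -> : \sum_(i <- l) a i =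
    \sum_(i <- l) Num.max (a i) 0 - \sum_(i <- l) Num.max (- a i) 0.
  rewrite -sumrB; apply: eq_bigr => i _.
  by case: (leP (a i) 0) => h; case: (leP (- a i) 0) => h'; rewrite ?subr0 ?sub0r ?opprK//; lra.
by rewrite ler_norml; apply/andP; split; lra.
Qed.

(** * Riemann sums for the reflected path and the variation of [f'(y)] *)

Section ReflectedPath.
Context {R : realType}.
Implicit Types (a b s r u : R).
Local Notation mu := (@lebesgue_measure R).
Context (T c : R) (x y phi : R -> R).
Context (c_gt0 : 0 < c) (T_gt0 : 0 < T).
Context (cx : cadlag T x) (cy : cadlag T y) (cphi : cadlag T phi).
Context (xE : forall s, 0 <= s <= T -> x s = y s + phi s).
Context (push : pushes_up T y phi (c / 2)).
Context (pushN : pushes_up T (\- y) (\- phi) (c / 2)).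

Definition crosses u s : bool := (u < y s)%R != (u < left_limit y s)%R.

Lemma crosses_term u s : (y s - u) * (level y u (s, true) - level y u (s, false)) =
  `|y s - u| * (crosses u s : nat)%:R.
Proof.
rewrite /level /crosses /value/=.
have [us|us] := ltP u (y s); have [ul|ul] := ltP u (left_limit y s);
  rewrite /= ?subrr ?mulr0 ?mulr1//.
  by rewrite subr0 mulr1 gtr0_norm// subr_gt0.
by rewrite ler0_norm ?subr_le0//; ring.
Qed.

(** The half-open intervals of [between] are exactly the levels at which the strict indicator
    [u < y] changes in the jump, upwards or downwards. *)
Lemma overshoot_crosses u s :
  `|y s - u| * \1_(between (left_limit y s) (y s)) u =
  `|y s - u| * (crosses u s : nat)%:R.
Proof.
congr (_ * _); rewrite indicE /between /crosses; congr (nat_of_bool _)%:R.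
case: (leP (left_limit y s) (y s)) => h; rewrite mem_setE in_itv/=.
  have [us|us] := ltP u (y s); have [ul|ul] := ltP u (left_limit y s) => //=.
  by move: (lt_le_trans ul h); rewrite ltNge us.
have [us|us] := ltP u (y s); have [ul|ul] := ltP u (left_limit y s) => //=.
by move: (lt_trans us h); rewrite ltNge ul.
Qed.

Lemma left_limit_gt (w : R -> R) u s r : cadlag T w -> 0 <= s -> s < r -> r <= T ->
  u < left_limit w r -> exists2 b, s < b < r & u < w b.
Proof.
move=> cw s0 sr rT ul; have r0 : 0 < r by exact: le_lt_trans sr.
have /cvgrPdist_lt/(_ (left_limit w r - u)) := left_limit_cvg cw r0 rT.
rewrite subr_gt0 => /(_ ul) /(near_left_exists sr)[b sbr hb]; exists b => //.
by move: hb; rewrite ltr_norml => /andP[_ ?]; lra.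
Qed.

(** If [w] climbs through [u] before [r], then [psi] equals [h] somewhere inside the interval, and
    small oscillation transports this to the left end [s], where the Riemann sum evaluates it. *)
Lemma push_near_left (w psi : R -> R) h e u s r : cadlag T w ->
  pushes_up T w psi h -> osc_le psi e s r -> 0 <= s -> s < r -> r <= T ->
  w s < u -> u < left_limit w r -> `|psi s - h| <= e.
Proof.
move=> cw [up _] osc s0 sr rT ws ul.
have [b /andP[sb br] ub] := left_limit_gt cw s0 sr rT ul.
have [r' /andP[sr' r'b] <-] := up s b s0 sb (le_trans (ltW br) rT) (lt_trans ws ub).
by apply: osc; rewrite ?lexx ?sr// (ltW sr') (le_lt_trans r'b).
Qed.

Lemma cadlagN (w : R -> R) : cadlag T w -> cadlag T (\- w).
Proof.
move=> cw; apply: (left_limit_comp cw _ (lexx 0) (ltW T_gt0)).1.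
exact: opp_continuous.
Qed.

Lemma mem_tail2 (A : eqType) (p q q' r : A) (l : seq A) : p \in r :: l -> p \in [:: q, q', r & l].
Proof. by rewrite !inE => ->; rewrite !orbT. Qed.

(** A change between [s] and [r-] has weight [phi s], within [e] of the barrier whose sign is that
    of the change; a change between [r-] and [r] has weight exactly at that barrier. Every product
    is thus close to [c / 2]. *)
Lemma riemann_sum_phi e u s P :
  chain (fun a b => osc_le phi e a b) s P -> 0 <= s -> last s P <= T ->
  (forall p, p \in (s, true) :: two_sided P -> value y p != u) ->
  `|riemann_sum phi (level y u) s P -
    c / 2 * (changes (fun p => u < value y p)%R (s, true) (two_sided P))%:R| <=
  e * (changes (fun p => u < value y p)%R (s, true) (two_sided P))%:R.
Proof.
elim: P s => [|r P IH] s; first by move=> *; rewrite /= !mulr0 subr0 normr0.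
move=> [sr osc cP] s0 lT yu.
have r0 : 0 < r by exact: le_lt_trans sr.
have rT : r <= T by exact: le_trans (chain_le cP) lT.
have {}IH := IH r cP (ltW r0) lT (fun p pP => yu p (mem_tail2 _ _ pP)).
have ys : y s != u by apply: (yu (s, true)); rewrite mem_head.
have yl : left_limit y r != u by apply: (yu (r, false)); rewrite !inE eqxx orbT.
have yr : y r != u by apply: (yu (r, true)); rewrite !inE eqxx !orbT.
have e0 : 0 <= e.
  by have := osc s s; rewrite lexx sr subrr normr0 => /(_ isT isT).
have H1 : `|phi s * (level y u (r, false) - level y u (s, true)) -
    c / 2 * ((u < y s)%R != (u < left_limit y r)%R)%:R| <=
    e * ((u < y s)%R != (u < left_limit y r)%R)%:R.
  rewrite /level /value/=; case: (ltP u (y s)) => us; case: (ltP u (left_limit y r)) => ul;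
    rewrite /= ?subrr ?mulr0 ?subr0 ?normr0//.
    rewrite sub0r !mulr1 mulrN1.
    apply: (push_near_left (cadlagN cy) pushN _ s0 sr rT (u := - u)) => //.
    - by move=> r1 r2 h1 h2; rewrite /= -opprD normrN; exact: osc.
    - by rewrite ltrN2.
    - by rewrite (left_limitN cy (ltW r0) rT) ltrN2 lt_neqAle yl.
  rewrite !mulr1; apply: (push_near_left cy push osc s0 sr rT _ ul).
  by rewrite lt_neqAle ys.
have H2 : phi r * (level y u (r, true) - level y u (r, false)) =
    c / 2 * ((u < left_limit y r)%R != (u < y r)%R)%:R.
  rewrite /level /value/=; case: (ltP u (y r)) => ur; case: (ltP u (left_limit y r)) => ul;
    rewrite /= ?subrr ?mulr0//.
    by rewrite subr0 !mulr1; apply: push.2 => //; exact: le_lt_trans ur.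
  rewrite sub0r mulr1 mulrN1; apply: pushN.2 => //.
  by rewrite (left_limitN cy (ltW r0) rT) ltrN2; exact: le_lt_trans ul.
rewrite [riemann_sum _ _ _ _]/= [changes _ _ _]/= H2 -/two_sided.
rewrite !natrD; move: H1 IH.
set n1 := ((u < y s)%R != _)%:R; set n2 := (_ != (u < y r)%R)%:R.
set N := (changes _ _ _)%:R; set RS := riemann_sum _ _ _ _.
have n20 : 0 <= e * n2 by rewrite mulr_ge0.
rewrite !ler_norml => /andP[? ?] /andP[? ?]; rewrite !mulrDr.
by apply/andP; split; lra.
Qed.

(** If the level changes between [s] and [r-], then [u] lies between two values of [y] at distance
    at most [e], so [y s - u] is negligible; the changes between [r-] and [r] give the overshoots
    exactly. *)
Lemma riemann_sum_level e u s P :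
  chain (fun a b => osc_le y e a b) s P -> 0 <= s -> last s P <= T ->
  (forall p, p \in (s, true) :: two_sided P -> value y p != u) ->
  `|riemann_sum (y \- cst u) (level y u) s P -
    \sum_(r <- P) `|y r - u| * (crosses u r : nat)%:R| <=
  e * (changes (fun p => u < value y p)%R (s, true) (two_sided P))%:R.
Proof.
elim: P s => [|r P IH] s; first by move=> *; rewrite big_nil /= subr0 mulr0 normr0.
move=> [sr osc cP] s0 lT yu.
have r0 : 0 < r by exact: le_lt_trans sr.
have rT : r <= T by exact: le_trans (chain_le cP) lT.
have {}IH := IH r cP (ltW r0) lT (fun p pP => yu p (mem_tail2 _ _ pP)).
have e0 : 0 <= e.
  by have := osc s s; rewrite lexx sr subrr normr0 => /(_ isT isT).
have H1 : `|(y s - u) * (level y u (r, false) - level y u (s, true))| <=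
    e * ((u < y s)%R != (u < left_limit y r)%R)%:R.
  have : `|y s - left_limit y r| <= e.
    by apply: (osc_left_limit cy s0 rT osc); rewrite lexx.
  rewrite ler_norml => /andP[? ?].
  rewrite normrM level_dist /value/=; case: ltP => us; case: ltP => ul; rewrite /= ?mulr0// !mulr1 ler_norml;
    by apply/andP; split; lra.
rewrite big_cons -crosses_term.
rewrite [riemann_sum _ _ _ _]/= [changes _ _ _]/= -/two_sided.
rewrite !natrD; move: H1 IH.
rewrite -[value y (s, true)]/(y s) -[value y (r, false)]/(left_limit y r) -[value y (r, true)]/(y r).
set n1 := ((u < y s)%R != _)%:R; set n2 := (_ != (u < y r)%R)%:R.
set N := (changes _ _ _)%:R; set RS := riemann_sum _ _ _ _.
have n20 : 0 <= e * n2 by rewrite mulr_ge0.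
rewrite !ler_norml => /andP[? ?] /andP[? ?]; rewrite !mulrDr.
by apply/andP; split; lra.
Qed.

Lemma count_crosses u s (l : seq R) :
  (count (crosses u) l <= changes (fun p => u < value y p)%R (s, true) (two_sided l))%N.
Proof.
elim: l s => [//|r l IH] s /=; rewrite {1}/crosses /value/= eq_sym.
by apply: leq_trans (leq_addl _ _); rewrite leq_add2l.
Qed.

Lemma changes_uniform_bound : exists M : nat, forall u p Q, path (@time_le R) p Q ->
  0 <= p.1 -> (last p Q).1 <= T -> (forall p', p' \in p :: Q -> value y p' != u) ->
  (changes (fun p' => u < value y p')%R p Q <= M)%N.
Proof.
have [M HM] := zigzag_uniform_bound c_gt0 T_gt0 (lexx T) cx.
exists M => u p Q pQ p0 lT yu.
have [_] := changes_bounds c_gt0 (lexx T) cy cphi xE push pushN pQ p0 lT yu.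
by apply => d l sl ml zl; exact: HM ml zl.
Qed.

Context (B : R).
Context (yB : forall s, 0 <= s <= T -> `|y s| <= B).

Lemma value_bounded p : 0 <= p.1 <= T -> `|value y p| <= B.
Proof.
case: p => s [] /= sT; rewrite /value/=; first exact: yB.
move: sT => /andP[]; rewrite le_eqVlt => /predU1P[<-|s0] sT.
  by rewrite left_limit0 yB// lexx ltW.
have := @left_limit_dist R T y s 0 B 0 cy (lexx 0) s0 sT.
rewrite sub0r normrN; apply => r /andP[r0 rs].
by rewrite sub0r normrN yB// r0 (ltW (lt_le_trans rs sT)).
Qed.

Lemma level_out u p p' : ~ `[- B, B]%classic u -> 0 <= p.1 <= T -> 0 <= p'.1 <= T ->
  (u < value y p)%R = (u < value y p')%R.
Proof.
rewrite /= in_itv/= => /negP; rewrite negb_and -!ltNge => /orP[uB|Bu].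
  move=> /value_bounded; rewrite ler_norml => /andP[h _].
  move=> /value_bounded; rewrite ler_norml => /andP[h' _].
  by rewrite (lt_le_trans uB h) (lt_le_trans uB h').
move=> /value_bounded/ler_normlW h /value_bounded/ler_normlW h'.
by rewrite !ltNge (le_trans h (ltW Bu)) (le_trans h' (ltW Bu)).
Qed.

Lemma path_time_in p Q p' : path (@time_le R) p Q -> 0 <= p.1 -> (last p Q).1 <= T ->
  p' \in p :: Q -> 0 <= p'.1 <= T.
Proof.
elim: Q p p' => [|q Q IH] p p' /=.
  by move=> _ p0 pT; rewrite inE => /eqP ->; rewrite p0.
move=> /andP[pq qQ] p0 lT; rewrite inE => /predU1P[->|].
  rewrite p0/=; have /andP[_ qT] := IH q q qQ (le_trans p0 (time_le_fst pq)) lT (mem_head _ _).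
  by apply: le_trans qT; exact: time_le_fst.
exact: (IH q p' qQ (le_trans p0 (time_le_fst pq)) lT).
Qed.

Lemma changes_out u p Q : ~ `[- B, B]%classic u -> path (@time_le R) p Q ->
  0 <= p.1 -> (last p Q).1 <= T -> changes (fun p' => u < value y p')%R p Q = 0%N.
Proof.
move=> uB pQ p0 lT; have H := path_time_in pQ p0 lT.
elim: Q p pQ H {p0 lT} => [//|q Q IH] p /= /andP[pq qQ] H.
rewrite (IH q)//; last by move=> p' p'Q; apply: H; rewrite inE p'Q orbT.
rewrite (@level_out u p q) ?eqxx//; first by apply: H; rewrite mem_head.
by apply: H; rewrite !inE eqxx orbT.
Qed.

Lemma values_negligible (Q : seq (R * bool)) :
  mu.-negligible [set u | exists2 p, p \in Q & value y p = u].
Proof.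
elim: Q => [|q Q IH].
  by apply: (negligibleS _ (negligible_set0 mu)) => u [].
apply: negligibleS (_ : mu.-negligible ([set value y q] `|` [set u | exists2 p, p \in Q & value y p = u])).
  move=> u [p]; rewrite inE => /predU1P[->|pQ] <-; first by left.
  by right; exists p.
apply: negligibleU => //; exists [set value y q]; split => //.
exact: lebesgue_measure_set1.
Qed.

Context (f f2 : R -> R).
Context (lf2 : locally_integrable setT f2).
Context (f2E : forall a b,
  derive1 f b - derive1 f a = \int[mu]_u (signed_itv a b u * f2 u)).

(** At most [M] changes occur, uniformly in the level, and none for levels outside [[- B, B]]. The
    finitely many levels equal to a value along the chain escape the bound but form a null set. *)
Lemma variation2_bounded : exists V : R, forall p Q, path (@time_le R) p Q ->
  0 <= p.1 -> (last p Q).1 <= T -> variation2 (derive1 f \o value y) p Q <= V.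
Proof.
have [M HM] := changes_uniform_bound.
exists (M%:R * \int[mu]_(u in `[- B, B]) `|f2 u|) => p Q pQ p0 lT.
have [iv le] := variation2_integral lf2 f2E y p Q; apply: le_trans le _.
have if2 := integrable_norm (locally_integrable_itv (- B) B lf2).
have ib : mu.-integrable setT (EFin \o ((fun u => M%:R * `|f2 u|) \_ `[- B, B])).
  rewrite -restrict_EFin; apply/integrable_restrict => //; rewrite setTI.
  exact: integrableZl_EFin.
rewrite -RintegralZl// [leRHS]Rintegral_mkcond.
apply: ae_le_Rintegral => //.
have := values_negligible (p :: Q); apply: negligibleS.
move=> u /=; apply: contra_notP => uQ _.
rewrite variation2_level patchE; case: ifPn => [_|/negP uB].
  apply: ler_wpM2r => //; rewrite ler_nat; apply: HM => //.
  by move=> p' p'Q; apply/eqP => e; apply: uQ; exists p'.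
by rewrite changes_out ?mul0r//; apply: contra_not uB; rewrite inE.
Qed.

(** Once sorted, the times form a partition whose two-sided variation contains every jump as one of
    its increments. *)
Lemma sum_jumps_le V t (l : seq R) : (forall p Q, path (@time_le R) p Q ->
    0 <= p.1 -> (last p Q).1 <= T -> variation2 (derive1 f \o value y) p Q <= V) ->
  t <= T -> uniq l -> (forall s, s \in l -> 0 < s <= t) ->
  \sum_(s <- l) `|jump_of (derive1 f) y s| <= V.
Proof.
move=> HV tT ul lt; pose l' := sort <=%R l.
have sl' : sorted <%R l'.
  by rewrite lt_sorted_uniq_le sort_uniq ul/= sort_le_sorted.
have ll' : perm_eq l l' by rewrite perm_sym perm_sort.
rewrite (perm_big _ ll')/=.
have pl' : path <%R 0 l'.
  rewrite path_sortedE; last exact: lt_trans.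
  rewrite sl' andbT; apply/allP => s; rewrite mem_sort => /lt.
  by case/andP.
have lastT : last 0 l' <= T.
  have : last 0 l' \in 0 :: l' by exact: mem_last.
  rewrite inE => /predU1P[->|]; first exact: ltW.
  by rewrite mem_sort => /lt /andP[_ st]; exact: le_trans tT.
apply: le_trans (HV (0, true) (two_sided l') (path_two_sided pl') (lexx 0) _); last first.
  by rewrite last_two_sided.
suff H s : \sum_(i <- l') `|jump_of (derive1 f) y i| <=
  variation2 (derive1 f \o value y) (s, true) (two_sided l') by exact: H.
elim: l' s {pl' lastT ll' sl'} => [|r l' IH] s /=; first by rewrite big_nil.
rewrite big_cons addrA; apply: lerD => //.
by rewrite /jump_of -[leLHS]add0r; apply: lerD.
Qed.

Lemma bounded_variation_derive1 : bounded_variation 0 T (derive1 f \o y).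
Proof.
have [V HV] := variation2_bounded; exists V => _ [l [pl /eqP ll] <-].
rewrite variation_zip//; last by split => //; exact/eqP.
have pQ : path (@time_le R) (0, true) [seq (r, true) | r <- l].
  elim: l 0 pl {ll} => [//|r l IH] s /= /andP[sr /IH ->].
  by rewrite /time_le/= sr.
apply: le_trans (HV _ _ pQ (lexx 0) _); last first.
  by rewrite (last_map (fun r => (r, true))) ll.
suff H s : \sum_(x0 <- zip l (s :: l))
     `|(derive1 f \o y) x0.1 - (derive1 f \o y) x0.2| <=
  variation2 (derive1 f \o value y) (s, true) [seq (r, true) | r <- l] by exact: H.
elim: l s {pQ pl ll} => [|r l IH] s; first by rewrite /= big_nil.
rewrite -[zip (r :: l) (s :: r :: l)]/((r, s) :: zip l (r :: l)) big_cons.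
by apply: lerD => //; exact: IH.
Qed.

Lemma cadlag_bv_derive1 : continuous (derive1 f) -> cadlag_bv T (derive1 f \o y).
Proof.
move=> cf; split; last exact: bounded_variation_derive1.
exact: (left_limit_comp cy cf (lexx 0) (ltW T_gt0)).1.
Qed.

End ReflectedPath.

(** * Left sums for Stieltjes integrals *)

Section StieltjesSums.
Context {R : realType}.
Implicit Types (a b s r t u e : R).

Fixpoint left_sum (w : R -> R) (m : R -> R) s (P : seq R) : R :=
  if P is r :: P' then w s * (m r - m s) + left_sum w m r P' else 0.

Lemma left_sumB w m m' s P :
  left_sum w m s P - left_sum w m' s P = left_sum w (m \- m') s P.
Proof. by elim: P s => [|r P IH] s /=; rewrite ?subrr// -IH; ring. Qed.

Lemma eq_left_sum w m m' s P : (forall r, r \in s :: P -> m r = m' r) ->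
  left_sum w m s P = left_sum w m' s P.
Proof.
elim: P s => [//|r P IH] s H /=; rewrite !H ?mem_head ?inE ?eqxx ?orbT//.
by rewrite IH// => r' r'P; apply: H; rewrite inE r'P orbT.
Qed.

Fixpoint step_fun (w : R -> R) s (P : seq R) v : R :=
  if P is r :: P' then if (v <= r)%R then w s else step_fun w r P' v else 0.

Lemma measurable_step_fun w s P : measurable_fun setT (step_fun w s P).
Proof.
elim: P s => [|r P IH] s; first exact: measurable_cst.
apply: measurable_fun_ifT => //.
by apply: measurable_fun_ler => //; exact: measurable_cst.
Qed.

Lemma step_fun_dist T x e s P v : cadlag T x ->
  chain (fun a b => osc_le x e a b) s P -> 0 <= s -> last s P <= T ->
  s < v <= last s P -> `|left_limit x v - step_fun x s P v| <= e.
Proof.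
move=> cx; elim: P s => [|r P IH] s.
  by move=> _ _ _ /= /andP[sv]; rewrite leNgt sv.
move=> [sr osc cP] s0 lT /andP[sv vl] /=.
have rT : r <= T by exact: le_trans (chain_le cP) lT.
have [vr|rv] := leP v r; last first.
  by apply: IH => //; [exact: le_trans (ltW sr)|rewrite rv].
rewrite distrC; apply: (left_limit_dist cx s0 sv (le_trans vr rT)) => r' /andP[sr' r'v].
by apply: osc; rewrite ?lexx// sr' (lt_le_trans r'v).
Qed.

Lemma cadlag_chain T x t e : cadlag T x -> 0 < e -> 0 <= t -> t <= T ->
  exists2 P, chain (fun a b => osc_le x e a b) 0 P & last 0 P = t.
Proof.
move=> cx e0 t0 tT; apply: locally_fine_chain => //.
have [h r l] := cadlag_osc cx e0; split => // s.
- by move=> s0 st; apply: r => //; exact: lt_le_trans tT.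
- by move=> s0 st; apply: l => //; exact: le_trans tT.
Qed.

(** The left limit is the uniform limit of step functions taking on []s, r]] the value of [x] at
    [s]. *)
Lemma measurable_left_limit (T : R) (x : R -> R) : cadlag T x -> 0 < T ->
  measurable_fun `]0, T]%classic (left_limit x).
Proof.
move=> cx T0.
have /choice[P hP] k : exists P, chain (fun a b => osc_le x k.+1%:R^-1 a b) 0 P /\ last 0 P = T.
  have k0 : 0 < k.+1%:R^-1 :> R by rewrite invr_gt0.
  by have [P cP lP] := cadlag_chain cx k0 (ltW T0) (lexx T); exists P.
apply: (measurable_fun_cvg (h := fun k => step_fun x 0 (P k))).
  by move=> k; apply: measurable_funTS; exact: measurable_step_fun.
move=> v; rewrite /= in_itv/= => /andP[v0 vT]; apply/cvgrPdist_le => e e0; near=> k.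
apply: (le_trans (step_fun_dist cx (hP k).1 (lexx 0) _ _)); rewrite ?(hP k).2 ?v0//.
rewrite invf_ple ?posrE//; apply: ltW.
near: k; exact: near_infty_ltS.
Unshelve. all: by end_near. Qed.

Lemma left_limit_bounded T x B : cadlag T x -> (forall s, 0 <= s <= T -> `|x s| <= B) ->
  forall s, 0 <= s <= T -> `|left_limit x s| <= B.
Proof.
move=> cx xB s /andP[]; rewrite le_eqVlt => /predU1P[<-|s0] sT.
  by rewrite left_limit0 xB// lexx.
have := @left_limit_dist R T x s 0 B 0 cx (lexx 0) s0 sT.
rewrite sub0r normrN; apply => r /andP[r0 rs].
by rewrite sub0r normrN xB// r0 (ltW (lt_le_trans rs sT)).
Qed.

Section Monotone.
Context (T : R) (x m : R -> R) (T_gt0 : 0 < T) (cx : cadlag T x)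
  (cm : cadlag_nondecreasing T m).
Local Notation nu := (stieltjes_measure T m).

Lemma integrable_left_limit a b : 0 <= a -> a <= b -> b <= T ->
  nu.-integrable `]a, b]%classic (EFin \o left_limit x).
Proof.
move=> a0 ab bT; have [B xB] := cadlag_bounded cx (ltW T_gt0).
have fin : (nu `]a, b]%classic < +oo)%E by rewrite stieltjes_measure_itv// ltry.
apply: measurable_bounded_integrable => //.
  apply: measurable_funS (measurable_left_limit cx T_gt0) => //.
  by move=> v; rewrite /= !in_itv/= => /andP[av vb]; rewrite (le_lt_trans a0 av) (le_trans vb).
exists B; split; first exact: num_real.
move=> M BM v; rewrite /= in_itv/= => /andP[av vb]; apply: le_trans (ltW BM).
apply: (left_limit_bounded cx xB).
by rewrite (ltW (le_lt_trans a0 av)) (le_trans vb).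
Qed.

(** The oscillation of [x] on [[s, r[] controls its left limits on all of []s, r]], right end
    included, and this is the interval of mass [m r - m s]. *)
Lemma stieltjes_left_sum e s P : chain (fun a b => osc_le x e a b) s P ->
  0 <= s -> last s P <= T ->
  `|\int[nu]_(v in `]s, last s P]) left_limit x v - left_sum x m s P| <=
  e * (m (last s P) - m s).
Proof.
elim: P s => [|r P IH] s.
  move=> _ s0 sT /=; rewrite !subrr mulr0 subr0 normr_le0.
  rewrite (_ : `]s, s]%classic = set0) ?Rintegral_set0//.
  by apply/seteqP; split => // v; rewrite /= in_itv/= => /andP[sv]; rewrite leNgt sv.
move=> [sr osc cP] s0 lT.
have rl := chain_le cP; rewrite [last s _]/= in lT *.
have r0 : 0 <= r by exact: le_trans (ltW sr).
have {}IH := IH r cP r0 lT.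
have rT : r <= T by exact: le_trans rl lT.
have -> : `]s, last r P]%classic = `]s, r]%classic `|` `]r, last r P]%classic.
  by rewrite -itv_bndbnd_setU// bnd_simp// ltW.
have iU : nu.-integrable (`]s, r]%classic `|` `]r, last r P]%classic) (EFin \o left_limit x).
  rewrite -itv_bndbnd_setU ?bnd_simp ?(ltW sr)//.
  by apply: integrable_left_limit => //; exact: le_trans (ltW sr) rl.
rewrite Rintegral_setU//; last first.
  rewrite disj_set2E; apply/eqP/seteqP; split => // v [] /=; rewrite !in_itv/= => /andP[_ vr] /andP[rv _].
  by move: vr; rewrite leNgt rv.
have i1 := integrable_left_limit s0 (ltW sr) rT.
have nuE : nu `]s, r]%classic = (m r - m s)%:E by rewrite stieltjes_measure_itv// ltW.
have ic k : nu.-integrable `]s, r]%classic (EFin \o cst k).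
  apply: measurable_bounded_integrable => //.
    by rewrite nuE ltry.
  exists `|k|; split; first exact: num_real.
  by move=> M kM v _ /=; exact: ltW.
have H1 : `|\int[nu]_(v in `]s, r]) left_limit x v - x s * (m r - m s)| <= e * (m r - m s).
  have cE k : \int[nu]_(v in `]s, r]) (cst k v) = k * (m r - m s).
    by rewrite Rintegral_cst//= nuE.
  rewrite -!cE -RintegralB//.
  have iB : nu.-integrable `]s, r]%classic (EFin \o (fun v => left_limit x v - cst (x s) v)).
    exact: integrableB_EFin.
  apply: le_trans (le_normr_Rintegral _ iB) _ => //.
  apply: le_Rintegral => //; first exact: integrable_norm.
  move=> v /=; rewrite in_itv/= => /andP[sv vr]; rewrite distrC.
  apply: (left_limit_dist cx s0 sv (le_trans vr rT)) => r' /andP[sr' r'v].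
  by apply: osc; rewrite ?lexx// sr' (lt_le_trans r'v).
rewrite /= -/left_sum.
move: H1 IH; rewrite !ler_norml => /andP[? ?] /andP[? ?].
have -> : e * (m (last r P) - m s) = e * (m (last r P) - m r) + e * (m r - m s) by ring.
by apply/andP; split; lra.
Qed.

End Monotone.

Lemma chain_jump T x e s P v : cadlag T x -> chain (fun a b => osc_le x e a b) s P ->
  0 <= s -> last s P <= T -> s < v <= last s P -> v \notin P -> `|jump x v| <= e.
Proof.
move=> cx; elim: P s => [|r P IH] s; first by move=> _ _ _ /= /andP[sv]; rewrite leNgt sv.
move=> [sr osc cP] s0 lT /andP[sv vl]; rewrite inE negb_or => /andP[vr vP].
have rT : r <= T by exact: le_trans (chain_le cP) lT.
have [vr'|rv|vE] := ltgtP v r; last by rewrite vE eqxx in vr.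
  by apply: (osc_jump cx s0 rT osc); rewrite sv.
by apply: (IH r) => //; [exact: le_trans (ltW sr)|rewrite rv].
Qed.

Lemma chain_osc_ge0 x e s r P : chain (fun a b => osc_le x e a b) s (r :: P) -> 0 <= e.
Proof.
by move=> [sr /(_ s s) + _]; rewrite lexx sr subrr normr0 => /(_ isT isT).
Qed.

Lemma chain_uniq Q s P : chain Q s P -> uniq P.
Proof.
move=> /chain_path/path_sorted; rewrite lt_sorted_uniq_le; by case/andP.
Qed.

(** At each point the two sums differ by [(x r - x s) * jump g r], and [x s] is within [e] of the
    left limit of [x] at [r]. *)
Lemma riemann_left_sum T x g e s P : cadlag T x -> cadlag T g ->
  chain (fun a b => osc_le x e a b) s P -> 0 <= s -> last s P <= T ->
  `|riemann_sum x (value g) s P - left_sum x g s P -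
    \sum_(r <- P) jump x r * jump g r| <= e * \sum_(r <- P) `|jump g r|.
Proof.
move=> cx cg; elim: P s => [|r P IH] s.
  by move=> *; rewrite !big_nil /= !subr0 normr0 mulr0.
move=> [sr osc cP] s0 lT.
have rT : r <= T by exact: le_trans (chain_le cP) lT.
have {}IH := IH r cP (le_trans s0 (ltW sr)) lT.
have H : `|x s - left_limit x r| <= e.
  by apply: (osc_left_limit cx s0 rT osc); rewrite lexx.
rewrite !big_cons /= -/riemann_sum -/left_sum [leRHS]mulrDr.
have -> : x s * (value g (r, false) - value g (s, true)) +
    x r * (value g (r, true) - value g (r, false)) + riemann_sum x (value g) r P -
    (x s * (g r - g s) + left_sum x g r P) -
    (jump x r * jump g r + \sum_(j <- P) jump x j * jump g j) =
    - ((x s - left_limit x r) * jump g r) + (riemann_sum x (value g) r P - left_sum x g r P -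
    \sum_(j <- P) jump x j * jump g j).
  by rewrite /value /jump /=; ring.
apply: le_trans (ler_normD _ _) _; apply: lerD => //.
by rewrite normrN normrM ler_wpM2r.
Qed.

Lemma eq_riemann_sumG w G G' s P : (forall r d, r \in s :: P -> G (r, d) = G' (r, d)) ->
  riemann_sum w G s P = riemann_sum w G' s P.
Proof.
elim: P s => [//|r P IH] s H /=; rewrite !H ?mem_head ?inE ?eqxx ?orbT//.
by rewrite (IH r)// => r' d r'P; apply: H; rewrite inE r'P orbT.
Qed.

(** Four errors of order [e] make up [C]: the left sums for the positive and the negative variation,
    the passage from left sums to two-sided sums, and the products of jumps off the partition, where
    jumps of [x] are at most [e]. *)
Lemma deriv_integral_approx T x (F y : R -> R) t (V : R) : 0 < T -> cadlag T x ->
  cadlag_bv T (F \o y) -> 0 < t -> t <= T ->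
  (forall s, 0 <= s <= T -> left_limit (F \o y) s = F (left_limit y s)) ->
  (forall l, uniq l -> (forall s, s \in l -> 0 < s <= t) ->
    \sum_(s <- l) `|jump_of F y s| <= V) ->
  exists C : R, forall e P, chain (fun a b => osc_le x e a b) 0 P -> last 0 P = t ->
    `|stieltjes_integral T (F \o y) (left_limit x) t +
      real_sum `]0, t] (fun s => jump x s * jump_of F y s) -
      riemann_sum x (F \o value y) 0 P| <= C * e.
Proof.
move=> T0 cx bvg t0 tT lim HV; set g := F \o y in bvg lim *.
pose p := fine \o pos_tv 0 g; pose n := fine \o neg_tv 0 g.
have cp := pos_tv_cadlag_nondecreasing bvg; have cn := neg_tv_cadlag_nondecreasing bvg.
exists (p t - p 0 + (n t - n 0) + V + V) => e P cP lP.
have e0 : 0 <= e.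
  by move: cP lP; case: (P) => [_ /= h|r P' cP _]; [move: t0; rewrite -h ltxx|exact: chain_osc_ge0 cP].
have lT : last 0 P <= T by rewrite lP.
have Ip := stieltjes_left_sum T0 cx cp cP (lexx 0) lT.
have In := stieltjes_left_sum T0 cx cn cP (lexx 0) lT.
rewrite lP -/p -/n in Ip In.
have Pin r : r \in P -> 0 < r <= t by move=> rP; rewrite -lP; exact: chain_mem cP rP.
have jE r : 0 < r <= t -> jump g r = jump_of F y r.
  by move=> /andP[r0 rt]; rewrite /jump /jump_of lim// (ltW r0) (le_trans rt).
have HVP : \sum_(r <- P) `|jump g r| <= V.
  apply: le_trans (HV P (chain_uniq cP) Pin); rewrite big_seq [leRHS]big_seq.
  by apply: ler_sum => r /Pin/jE ->.
have Ir := riemann_left_sum cx bvg.1 cP (lexx 0) lT.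
have Is : `|real_sum `]0, t]%classic (fun s => jump x s * jump_of F y s) -
    \sum_(r <- P) jump x r * jump_of F y r| <= e * V.
  apply: real_sum_approx; first exact: chain_uniq cP.
    by move=> r /Pin; rewrite /= in_itv.
  move=> m um mP; have mt s : s \in m -> 0 < s <= t.
    by move=> /mP[]; rewrite /= in_itv.
  apply: (@le_trans _ _ (\sum_(s <- m) e * `|jump_of F y s|)).
    rewrite big_seq [leRHS]big_seq; apply: ler_sum => s sm; rewrite normrM ler_wpM2r//.
    apply: (chain_jump cx cP (lexx 0) lT); first by rewrite lP; exact: mt.
    by have [] := mP s sm.
  by rewrite -mulr_sumr ler_wpM2l// HV.
have gE : left_sum x p 0 P - left_sum x n 0 P = left_sum x g 0 P.
  rewrite left_sumB; apply: eq_left_sum => r rP.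
  rewrite [RHS](bounded_variation_pos_neg_tvE bvg.2)//.
  rewrite in_itv/=; move: rP; rewrite inE => /predU1P[->|/Pin/andP[r0 rt]].
    by rewrite lexx ltW.
  by rewrite ltW// (le_trans rt).
have sE : \sum_(r <- P) jump x r * jump g r = \sum_(r <- P) jump x r * jump_of F y r.
  by rewrite big_seq [RHS]big_seq; apply: eq_bigr => r /Pin/jE ->.
have vE : riemann_sum x (value g) 0 P = riemann_sum x (F \o value y) 0 P.
  apply: eq_riemann_sumG => r d rP; have r0T : 0 <= r <= T.
    move: rP; rewrite inE => /predU1P[->|/Pin/andP[r0 rt]]; first by rewrite lexx ltW.
    by rewrite (ltW r0) (le_trans rt).
  by case: d => //; rewrite /= /value/= lim.
have eV : e * \sum_(r <- P) `|jump g r| <= e * V by rewrite ler_wpM2l.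
rewrite vE sE -gE in Ir; rewrite /stieltjes_integral -/p -/n.
have -> : (p t - p 0 + (n t - n 0) + V + V) * e =
  e * (p t - p 0) + e * (n t - n 0) + e * V + e * V by ring.
move: Ip In Ir Is; rewrite !ler_norml => /andP[? ?] /andP[? ?] /andP[? ?] /andP[? ?].
by apply/andP; split; lra.
Qed.

End StieltjesSums.

(** * Consequences of the support conditions *)

Section SkorokhodPush.
Context {R : realType}.
Implicit Types (a b d s t T r h : R) (x y phi m : R -> R).

(** Monotonicity on arbitrary sets, from the underlying outer measure: the null sets of the support
    condition come without a proof of measurability. *)
Lemma le_stieltjes_measure T m : {homo stieltjes_measure T m : A B / A `<=` B >-> (A <= B)%E}.
Proof.
move=> A B AB; rewrite /stieltjes_measure; case: pselect => // H.
exact: le_mu_ext.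
Qed.

Lemma stieltjes_measure_itv_gt T m N a b : cadlag_nondecreasing T m ->
  stieltjes_measure T m N = 0%E -> 0 <= a -> a < b -> b <= T -> m a < m b ->
  exists2 r, a < r <= b & ~ N r.
Proof.
move=> cm N0 a0 ab bT mab; apply: contrapT => H.
have : (stieltjes_measure T m `]a, b]%classic <= 0)%E.
  rewrite -N0; apply: le_stieltjes_measure => r /=; rewrite in_itv/= => arb.
  by apply: contrapT => Nr; apply: H; exists r.
by rewrite stieltjes_measure_itv ?(ltW ab)// lee_fin subr_le0 leNgt mab.
Qed.

(** A jump of size at least [d] is an atom of mass at least [d], by continuity from above along
    intervals shrinking to [s]; an atom cannot lie in a null set. *)
Lemma stieltjes_measure_set1_gt T m N s d : cadlag_nondecreasing T m ->
  stieltjes_measure T m N = 0%E -> 0 < s -> s <= T -> 0 < d ->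
  (\forall r \near s^'-, m r + d <= m s) -> ~ N s.
Proof.
move=> cm N0 s0 sT d0 ms Ns.
pose nu := stieltjes_measure T m.
pose F k : set R := `](s - s / k.+1%:R), s]%classic.
have lt_s k : 0 < s / k.+1%:R by rewrite divr_gt0.
have F0 k : 0 <= s - s / k.+1%:R.
  by rewrite subr_ge0 ler_pdivrMr// ler_peMr ?(ltW s0)// ler1n.
have FE k : nu (F k) = (m s - m (s - s / k.+1%:R))%:E.
  by rewrite /nu stieltjes_measure_itv// lerBlDr lerDl ltW.
have capF : \bigcap_k F k = [set s].
  apply/seteqP; split => [r Fr|_ -> k _]; last first.
    by rewrite /F/= in_itv/= lexx andbT ltrBlDr ltrDl.
  have := Fr 0%N I; rewrite /F/= in_itv/= => /andP[_ rs].
  apply/eqP; rewrite eq_le rs leNgt; apply/negP => rs'.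
  have sr0 : 0 < s - r by rewrite subr_gt0.
  near \oo => k.
  have := Fr k I; rewrite /F/= in_itv/= => /andP[+ _].
  rewrite ltrBlDr -ltrBlDl ltr_pdivlMr// mulrC -ltr_pdivlMr//.
  apply/negP; rewrite -leNgt; apply: ltW.
  by near: k; exact: near_infty_ltS.
have cvgF : nu (F k) @[k --> \oo] --> nu [set s].
  rewrite -capF; apply: nonincreasing_cvg_mu.
  - by rewrite FE ltry.
  - by move=> k; exact: measurable_itv.
  - by rewrite capF; exact: measurable_set1.
  - move=> i j ij; apply/subsetPset => r; rewrite /F/= !in_itv/= => /andP[h ->]; rewrite andbT.
    apply: le_lt_trans h; rewrite lerB// ler_pM2l// lef_pV2 ?posrE//.
    by rewrite ler_nat.
have nus : nu [set s] = 0%E.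
  apply/eqP; rewrite eq_le measure_ge0 andbT -N0.
  by apply: le_stieltjes_measure => _ ->.
suff : (d%:E <= nu [set s])%E by rewrite nus lee_fin leNgt d0.
apply: (closed_cvg (fun v => (d%:E <= v)%E)) cvgF.
  exact: closed_ereal_le_ereal.
move: ms; rewrite near_withinE => /(@nbhs_ballP _ R)[e/= e0 he].
near=> k; rewrite FE lee_fin.
have : m (s - s / k.+1%:R) + d <= m s.
  apply: he; last by rewrite ltrBlDr ltrDl.
  rewrite /ball/= opprB addrC subrK gtr0_norm// ltr_pdivrMr// mulrC -ltr_pdivrMr//.
  by near: k; exact: near_infty_ltS.
by lra.
Unshelve. all: by end_near. Qed.

(** As [yd] does not decrease, every increase of [y] is at most that of [yu], so [yu] charges the
    interval or has an atom at the jump, and some charged time lies in the support. *)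
Lemma pushes_up_difference T y yu yd phi h : cadlag T y ->
  cadlag_nondecreasing T yu -> cadlag_nondecreasing T yd ->
  (forall t, t \in `[0, T] -> y t = yu t - yd t) ->
  stieltjes_measure T yu [set t | t \in `]0, T] /\ phi t <> h] = 0%E ->
  pushes_up T y phi h.
Proof.
move=> cy cu cd yE N0.
have inT s : 0 <= s -> s <= T -> s \in `[0, T] by move=> s0 sT; rewrite in_itv/= s0.
have yd_le r s : 0 <= r -> r < s -> s <= T -> y s - y r <= yu s - yu r.
  move=> r0 rs sT; rewrite !yE ?inT ?(le_trans r0 (ltW rs)) ?(le_trans (ltW rs))//.
  have : yd r <= yd s.
    by apply: cd.2; rewrite ?inT ?(le_trans r0 (ltW rs)) ?(le_trans (ltW rs))// ltW.
  by move=> ?; lra.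
split=> [a b a0 ab bT yab|s s0 sT ys].
  have uab : yu a < yu b by have := yd_le a b a0 ab bT; lra.
  have [r /andP[ar rb] Nr] := stieltjes_measure_itv_gt cu N0 a0 ab bT uab.
  exists r; first by rewrite ar.
  by apply: contrapT => ne; apply: Nr; split => //; rewrite in_itv/= (le_lt_trans a0 ar) (le_trans rb).
(* Half of the jump leaves the other half for the distance between [y r] and its limit as [r] tends
   to [s] from the left. *)
pose d := (y s - left_limit y s) / 2.
have d0 : 0 < d by rewrite divr_gt0// subr_gt0.
apply: contrapT => ne.
apply: (stieltjes_measure_set1_gt cu N0 s0 sT d0) => //; last first.
  by split => //; rewrite in_itv/= s0.
have /cvgrPdist_le/(_ _ d0) := left_limit_cvg cy s0 sT.
move=> H; near=> r.
have r0 : 0 < r by near: r; exact: nbhs_left_gt.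
have rs : r < s by near: r; exact: nbhs_left_lt.
have := yd_le r s (ltW r0) rs sT.
have : `|left_limit y s - y r| <= d by near: r.
by rewrite ler_norml /d => /andP[? ?] ?; lra.
Unshelve. all: by end_near. Qed.

Lemma skorokhod_pushes T x c phi y : 0 < T -> skorokhod_solution T x c phi y ->
  [/\ cadlag T y /\ cadlag T phi,
      forall s, 0 <= s <= T -> x s = y s + phi s,
      forall s, 0 <= s <= T -> `|phi s| <= c / 2,
      pushes_up T y phi (c / 2) /\ pushes_up T (\- y) (\- phi) (c / 2) &
      phi 0 = 0].
Proof.
move=> T0 [[cphi [cNy _]] xE [yu [yd [cu cd yE Nu Nd]]] phi0].
have cy : cadlag T y.
  have := cadlagN T0 cNy; rewrite (_ : \- (\- y) = y)//.
  by apply/funext => s /=; rewrite opprK.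
split => //.
- by move=> s sT; have [<- _] := xE s sT; rewrite addrC subrK.
- by move=> s sT; have [_] := xE s sT; rewrite in_itv/= ler_norml.
split; first exact: pushes_up_difference yE Nu.
apply: (pushes_up_difference cNy cd cu) => [s sT|].
  by rewrite /= yE// opprB.
rewrite -[RHS]Nd; congr (stieltjes_measure T yd _).
apply/seteqP; split => s [sT ne]; split => // phiE; apply: ne.
  by rewrite /= phiE opprK.
by rewrite -phiE opprK.
Qed.

End SkorokhodPush.

(** * Overshoots of the reflected path *)

Section Overshoots.
Context {R : realType}.
Implicit Types (a b r s u : R).
Local Notation mu := (@lebesgue_measure R).
Context (T t c B : R) (x y phi : R -> R).
Context (c_gt0 : 0 < c) (t_gt0 : 0 < t) (t_le : t <= T).
Context (cx : cadlag T x) (cy : cadlag T y) (cphi : cadlag T phi).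
Context (xE : forall s, 0 <= s <= T -> x s = y s + phi s).
Context (push : pushes_up T y phi (c / 2)).
Context (pushN : pushes_up T (\- y) (\- phi) (c / 2)).
Context (yB : forall s, 0 <= s <= T -> `|y s| <= B).
Context (eps : nat -> R) (P : nat -> seq R).
Context (eps_cvg : eps n @[n --> \oo] --> 0).
Context (P_osc : forall k, chain (fun a b => osc_le y (eps k) a b) 0 (P k)).
Context (P_last : forall k, last 0 (P k) = t).
Local Notation partition_values := (@partition_values R y P).

Let T_gt0 : 0 < T. Proof. exact: lt_le_trans t_le. Qed.

(** A time missed by all partitions has a jump of size at most [eps k] for every [k]. Hence
    [partition_values] contains the values of [y] on both sides of every jump. *)
Lemma jump_in_partition s : 0 < s <= t -> jump y s != 0 -> exists k, s \in P k.
Proof.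
move=> st js; apply: contrapT => sP.
have : `|jump y s| <= 0.
  apply: (closed_cvg (fun v => `|jump y s| <= v)) eps_cvg; first exact: closed_ge.
  apply: nearW => k; apply: (chain_jump cy (P_osc k)) => //; rewrite ?P_last//.
  by apply/negP => sPk; apply: sP; exists k.
by rewrite normr_le0; exact/negP.
Qed.

Lemma crosses_jump u s : crosses y u s -> jump y s != 0.
Proof.
by apply: contraTneq; rewrite /jump /crosses => /eqP; rewrite subr_eq0 => /eqP ->; rewrite eqxx.
Qed.

Lemma crosses_dist u s : crosses y u s -> `|y s - u| <= `|jump y s|.
Proof.
rewrite /crosses /jump; case: ltP => us; case: ltP => ul //= _.
  by rewrite !gtr0_norm ?subr_gt0 ?(le_lt_trans ul)// lerD2l lerN2.
rewrite !ler0_norm ?subr_le0//; last exact: le_trans us (ltW ul).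
by rewrite !opprB lerD2r ltW.
Qed.

(** Every jump across [u] is a level change, so at most [M] terms are nonzero, whatever the length
    of the list; each is at most the size of its jump. *)
Lemma overshoot_sum_bound : exists M : nat, forall u (l : seq R) e, ~ partition_values u ->
  uniq l -> (forall s, s \in l -> 0 < s <= t /\ `|jump y s| <= e) -> 0 <= e ->
  \sum_(s <- l) `|y s - u| * (crosses y u s : nat)%:R <= e * M%:R.
Proof.
have [M HM] := changes_uniform_bound c_gt0 T_gt0 cx cy cphi xE push pushN.
exists M => u l e pu ul lt e0.
pose m := sort <=%R [seq s <- l | crosses y u s].
have mE s : (s \in m) = crosses y u s && (s \in l) by rewrite mem_sort mem_filter.
have sm : sorted <%R m.
  by rewrite lt_sorted_uniq_le sort_uniq filter_uniq//= sort_le_sorted.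
have pm : path <%R 0 m.
  rewrite path_sortedE; last exact: lt_trans.
  rewrite sm andbT; apply/allP => s; rewrite mE => /andP[_ /lt].
  by case=> /andP[].
have lastT : last 0 m <= T.
  have : last 0 m \in 0 :: m by exact: mem_last.
  rewrite inE => /predU1P[->|]; first exact: ltW.
  by rewrite mE => /andP[_ /lt[/andP[_ st] _]]; exact: le_trans t_le.
have cM : (count (crosses y u) m <= M)%N.
  apply: leq_trans (count_crosses y u 0 m) _; apply: HM => //.
  - exact: path_two_sided.
  - by rewrite last_two_sided.
  - move=> [s d]; rewrite inE => /predU1P[->|].
      apply/eqP => yu; apply: pu; exists 0%N, (0, true).
      by rewrite mem_head.
    rewrite mem_two_sided mE => /andP[cs /lt[st _]].
    have [k sk] := jump_in_partition st (crosses_jump cs).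
    apply/eqP => yu; apply: pu; exists k, (s, d).
    by rewrite inE mem_two_sided sk orbT.
have cl : count (crosses y u) l = count (crosses y u) m.
  rewrite (permP (permEl (perm_sort _ _))) count_filter.
  by apply: eq_count => s /=; rewrite andbb.
apply: (@le_trans _ _ (e * (count (crosses y u) l)%:R)); last first.
  by rewrite ler_wpM2l// ler_nat cl.
rewrite -sum1_count natr_sum mulr_sumr [leRHS]big_mkcond/=.
rewrite big_seq [leRHS]big_seq; apply: ler_sum => s /lt[_ se].
have [cs|] := boolP (crosses y u s); last by rewrite mulr0.
by rewrite !mulr1 (le_trans (crosses_dist cs)).
Qed.

Lemma jump_bounded s : 0 < s <= t -> `|jump y s| <= B + B.
Proof.
move=> /andP[s0 st]; have sT : 0 <= s <= T by rewrite ltW//= (le_trans st).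
apply: le_trans (ler_normB _ _) _; apply: lerD; first exact: yB.
exact: (value_bounded T_gt0 cy yB (p := (s, false))).
Qed.

(** [overshoot_sum_bound] is used twice: with jumps at most [2 B] for the whole sum, and with jumps
    at most [eps k] for the part off the partition [P k]. *)
Lemma overshoot_approx : exists M : R, 0 <= M /\ forall u, ~ partition_values u ->
  exists j : R, [/\ jump_overshoot y t u = j%:E, 0 <= j <= (B + B) * M,
    (~ `[- B, B]%classic u -> j = 0) &
    forall k, `|j - \sum_(r <- P k) `|y r - u| * (crosses y u r : nat)%:R| <= eps k * M].
Proof.
have [M HM] := overshoot_sum_bound; exists M%:R; split => // u pu.
have B0 : 0 <= B by apply: le_trans (normr_ge0 (y 0)) (yB _); rewrite lexx ltW.
pose a s := `|y s - u| * (crosses y u s : nat)%:R.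
have a0 s : 0 <= a s by rewrite mulr_ge0.
have JE : jump_overshoot y t u = (\esum_(s in `]0%R, t]) (a s)%:E)%E.
  by apply: eq_esum => s _; rewrite overshoot_crosses.
have Jle : (\esum_(s in `]0%R, t]) (a s)%:E <= ((B + B) * M%:R)%:E)%E.
  apply: esum_le_seq => l ul lt; apply: HM => //; last exact: addr_ge0.
  by move=> s /lt; rewrite /= in_itv/= => st; split => //; exact: jump_bounded.
have J0 : (0 <= \esum_(s in `]0%R, t]) (a s)%:E)%E.
  by apply: esum_ge0 => s _; rewrite lee_fin.
have Jfin : \esum_(s in `]0%R, t]) (a s)%:E \is a fin_num.
  by rewrite ge0_fin_numE// (le_lt_trans Jle) ?ltry.
exists (fine (\esum_(s in `]0%R, t]) (a s)%:E)); split.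
- by rewrite fineK.
- by rewrite fine_ge0//= -lee_fin fineK.
- move=> uB; rewrite esum1// => s; rewrite /= in_itv/= => /andP[s0 st].
  have sT : 0 <= s <= T by rewrite ltW//= (le_trans st).
  have := @level_out R T y T_gt0 cy B yB u (s, true) (s, false) uB sT sT.
  by rewrite /a /crosses /value/= => ->; rewrite eqxx mulr0.
move=> k.
have ePk : 0 <= eps k.
  have := P_osc k; case: (P k) (P_last k) => [/= h|r Q _ cQ]; last exact: chain_osc_ge0 cQ.
  by move: t_gt0; rewrite -h ltxx.
have Pin r : r \in P k -> 0 < r <= t.
  by move=> rP; rewrite -(P_last k); exact: chain_mem (P_osc k) rP.
have PkD r : r \in P k -> [set` `]0, t]] r by move=> /Pin; rewrite /= in_itv.
rewrite (esum_split_seq (fun s _ => a0 s) (chain_uniq (P_osc k)) PkD).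
set E := (\esum_(i in _ `\` _) _)%E.
have E0 : (0 <= E)%E by apply: esum_ge0 => s _; rewrite lee_fin.
have Ele : (E <= (eps k * M%:R)%:E)%E.
  apply: esum_le_seq => l ul lt; apply: HM => // s /lt[]; rewrite /= in_itv/= => st /negP sP.
  split => //; apply: (chain_jump cy (P_osc k)) => //; rewrite ?P_last//.
have Efin : E \is a fin_num by rewrite ge0_fin_numE// (le_lt_trans Ele) ?ltry.
rewrite fineD//= addrC addKr ger0_norm ?fine_ge0//.
by rewrite -lee_fin fineK.
Qed.

End Overshoots.

(** * The estimate for a fixed accuracy *)

Section AeIntegrable.
Context d (X : measurableType d) {R : realType}.
Variable mu : {measure set X -> \bar R}.

Lemma ae_imply (Q Q' : X -> Prop) : (forall x, Q x -> Q' x) ->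
  {ae mu, forall x, Q x} -> {ae mu, forall x, Q' x}.
Proof. exact: filterS. Qed.

Lemma ae_le_integrable (D : set X) (f g : X -> \bar R) : measurable D ->
  measurable_fun D f -> {ae mu, forall x, D x -> (`|f x| <= g x)%E} ->
  mu.-integrable D g -> mu.-integrable D f.
Proof.
move=> mD mf fg ig; apply/integrableP; split => //.
have /integrableP[mg] := ig; apply: le_lt_trans.
apply: ae_ge0_le_integral => //.
- exact: measurableT_comp.
- exact: measurableT_comp.
- by apply: filterS fg => x /[apply] h; apply: le_trans h (lee_abs _).
Qed.

End AeIntegrable.

Section ReflectedIntegral.
Context {R : realType}.
Implicit Types (a b r s u : R).
Local Notation mu := (@lebesgue_measure R).

Lemma ae_integrable_support (k g : R -> R) A B M : measurable_fun setT k ->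
  {ae mu, forall u, `|k u| <= M * \1_(`[A, B]) u} ->
  locally_integrable setT g -> mu.-integrable setT (EFin \o (k \* g)).
Proof.
move=> mk kM lg; have mg : measurable_fun setT g by case: lg.
have ib : mu.-integrable setT (EFin \o ((fun u => M * `|g u|) \_ `[A, B])).
  rewrite -restrict_EFin; apply/integrable_restrict => //; rewrite setTI.
  by apply: integrableZl_EFin => //; exact: integrable_norm (locally_integrable_itv A B lg).
apply: ae_le_integrable ib => //.
  by apply/measurable_EFinP; exact: measurable_funM.
apply: ae_imply kM => u kM _; rewrite /= lee_fin patchE normrM; move: kM; rewrite indicE.
case: ifP => _ /=; rewrite ?mulr1 ?mulr0 => h; first exact: ler_wpM2r.
have : 0 <= `|g u| by []; have : 0 <= `|k u| by [].
by rewrite le_eqVlt => /predU1P[<-|]; [rewrite mul0r|rewrite ltNge h].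
Qed.

Lemma ae_le_Rintegral_support (k g : R -> R) A B M : measurable_fun setT k ->
  {ae mu, forall u, `|k u| <= M * \1_(`[A, B]) u} ->
  locally_integrable setT g ->
  `|\int[mu]_u (k u * g u)| <= \int[mu]_(u in `[A, B]) (`|k u| * `|g u|).
Proof.
move=> mk kM lg; have ik := ae_integrable_support mk kM lg.
have mg : measurable_fun setT g by case: lg.
apply: le_trans (le_normr_Rintegral _ ik) _ => //.
rewrite [leRHS]Rintegral_mkcond le_eqVlt; apply/orP; left; apply/eqP.
have mkg : measurable_fun setT (fun u => `|k u| * `|g u|).
  by apply: measurable_funM; exact: measurableT_comp.
apply: ae_eq_Rintegral => //.
- by apply: measurableT_comp => //; exact: measurable_funM.
- by apply/measurable_restrict => //; exact: measurable_funTS.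
apply: ae_imply kM => u kM _; rewrite patchE; move: kM; rewrite indicE normrM.
case: ifP => // _ /=; rewrite mulr0 => h.
have : 0 <= `|k u| by [].
by rewrite le_eqVlt => /predU1P[<-|]; [rewrite mul0r|rewrite ltNge h].
Qed.

Lemma integral_fine_mul (k : R -> \bar R) (g : R -> R) :
  measurable_fun setT k -> measurable_fun setT g ->
  {ae mu, forall u, k u \is a fin_num} ->
  mu.-integrable setT (EFin \o (fun u => fine (k u) * g u)) ->
  (\int[mu]_u (k u * (g u)%:E))%E = (\int[mu]_u (fine (k u) * g u))%:E.
Proof.
move=> mk mg kfin ik; rewrite fineK ?integrable_fin_num//.
apply: ae_eq_integral => //.
- by apply: emeasurable_funM => //; exact/measurable_EFinP.
- exact: measurable_int ik.
- by apply: ae_imply kfin => u ku _ /=; rewrite EFinM fineK.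
Qed.

Lemma measurable_riemann_sum_level (w y : R -> R) s P :
  measurable_fun setT (fun u => riemann_sum w (level y u) s P).
Proof.
elim: P s => [|r P IH] s; first exact: measurable_cst.
apply: measurable_funD => //; apply: measurable_funD;
  (apply: measurable_funM; first exact: measurable_cst);
  exact: measurable_signed_itv.
Qed.

Lemma riemann_sum_cst_level (w : R -> R) g s P :
  riemann_sum w (fun=> g) s P = 0.
Proof. by elim: P s => [//|r P IH] s /=; rewrite IH; ring. Qed.

Context (T t c B : R) (x y phi : R -> R).
Context (c_gt0 : 0 < c) (t_gt0 : 0 < t) (t_le : t <= T).
Context (cx : cadlag T x) (cy : cadlag T y) (cphi : cadlag T phi).
Context (xE : forall s, 0 <= s <= T -> x s = y s + phi s).
Context (phi_le : forall s, 0 <= s <= T -> `|phi s| <= c / 2).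
Context (phi0 : phi 0 = 0).
Context (push : pushes_up T y phi (c / 2)).
Context (pushN : pushes_up T (\- y) (\- phi) (c / 2)).
Context (yB : forall s, 0 <= s <= T -> `|y s| <= B).
Context (f f2 : R -> R).
Context (f_diff : forall u, derivable f u 1) (f_C1 : continuous (derive1 f)).
Context (f2_weak : weak_derivative 2 f f2).
Context (mJ : measurable_fun setT (jump_overshoot y t)).
Context (mN : measurable_fun setT (fun u => crossings x u c t)).

Let T_gt0 : 0 < T. Proof. exact: lt_le_trans t_le. Qed.

Let lf2 : locally_integrable setT f2. Proof. by case: f2_weak. Qed.

Let mf2 : measurable_fun setT f2. Proof. by case: lf2. Qed.

Let f2E := fun a b => weak_derivative2_signed a b f_diff f_C1 f2_weak.

(** One sequence has to serve four purposes: the oscillation of [x] for the Stieltjes integral, that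
    of [y] for the overshoots, that of [phi] for the barrier term, and the mesh for the comparison
    with crossings. *)
Lemma fine_partitions : exists P : nat -> seq R, (forall k, last 0 (P k) = t) /\
  forall k, [/\ chain (fun a b => osc_le x k.+1%:R^-1 a b) 0 (P k),
    chain (fun a b => osc_le y k.+1%:R^-1 a b) 0 (P k),
    chain (fun a b => osc_le phi k.+1%:R^-1 a b) 0 (P k) &
    chain (fun a b => b - a <= k.+1%:R^-1) 0 (P k)].
Proof.
have /choice[P hP] k : exists P, chain (fun a b =>
    (osc_le x k.+1%:R^-1 a b /\ osc_le y k.+1%:R^-1 a b) /\
    (osc_le phi k.+1%:R^-1 a b /\ b - a <= k.+1%:R^-1)) 0 P /\ last 0 P = t.
  have k0 : 0 < k.+1%:R^-1 :> R by rewrite invr_gt0.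
  have restr Q : locally_fine 0 T Q -> locally_fine 0 t Q.
    move=> [h r l]; split => // s.
      by move=> s0 st; apply: r => //; exact: lt_le_trans t_le.
    by move=> s0 st; apply: l => //; exact: le_trans t_le.
  have [P cP lP] := @locally_fine_chain R 0 t _ (ltW t_gt0)
    (restr _ (locally_fineI (locally_fineI (cadlag_osc cx k0) (cadlag_osc cy k0))
      (locally_fineI (cadlag_osc cphi k0) (mesh_fine 0 T k0)))).
  by exists P.
exists P; split => k; first exact: (hP k).2.
by split; apply: sub_chain (hP k).1 => a b [[? ?] []].
Qed.

(** The telescoped part of the sums. Writing [u = y t - (y t - u)] splits it into an increment of
    [f'] and a Taylor remainder. *)
Lemma endpoint_integral : mu.-integrable setT
    (EFin \o (fun u => u * signed_itv (y 0) (y t) u * f2 u)) /\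
  \int[mu]_u (u * signed_itv (y 0) (y t) u * f2 u) =
  y t * derive1 f (y t) - y 0 * derive1 f (y 0) - (f (y t) - f (y 0)).
Proof.
have mid : measurable_fun setT (fun u : R => u) by exact: measurable_id.
have imn k b : mu.-integrable setT (EFin \o (fun u => k * (signed_itv (y 0) b u * f2 u))).
  by apply: integrableZl_EFin => //; exact: integrable_signed_itv1.
have bd u : `[Num.min (y 0) (y t), Num.max (y 0) (y t)]%classic u ->
    `|u| <= `|y 0| + `|y t|.
  rewrite /= in_itv/= ge_min le_max => /andP[/orP h1 /orP h2].
  have := ler_norm (y 0); have := ler_norm (y t); have := ler_norm (- y 0); have := ler_norm (- y t).
  rewrite !normrN ler_norml => ? ? ? ?; apply/andP; split;
    by case: h1; case: h2 => ? ?; have := normr_ge0 (y 0); have := normr_ge0 (y t); lra.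
have iu := integrable_signed_itv mid bd lf2.
split; first by apply: eq_integrable iu => // u _.
have -> : f (y t) - f (y 0) =
  (f (y t) - f (y 0) - derive1 f (y 0) * (y t - y 0)) + derive1 f (y 0) * (y t - y 0) by ring.
rewrite (taylor_signed (y 0) (y t) f_diff f_C1 f2_weak).
have -> : \int[mu]_u ((y t - u) * signed_itv (y 0) (y t) u * f2 u) =
    y t * (derive1 f (y t) - derive1 f (y 0)) -
    \int[mu]_u (u * signed_itv (y 0) (y t) u * f2 u).
  rewrite f2E -RintegralZl//; last exact: integrable_signed_itv1.
  rewrite -RintegralB//.
  by apply: eq_Rintegral => u _; ring.
by ring.
Qed.

(* The c / 2 comes from the difference of at most one between level changes and
   crossings. *)
Lemma kernel_approx : exists2 M : R, 0 <= M &
  exists P : nat -> seq R, [/\ forall k, last 0 (P k) = t,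
    forall k, chain (fun a b => osc_le x k.+1%:R^-1 a b) 0 (P k) &
    let K k u := riemann_sum x (level y u) 0 (P k) -
      (u * signed_itv (y 0) (y t) u + fine (jump_overshoot y t u) +
       c / 2 * fine (crossings x u c t)) in
    {ae mu, forall u, [/\ jump_overshoot y t u \is a fin_num,
      crossings x u c t \is a fin_num,
      `|fine (jump_overshoot y t u)| <= M * \1_(`[- B, B]) u,
      `|fine (crossings x u c t)| <= M * \1_(`[- B, B]) u &
      (forall k, `|K k u| <= M * \1_(`[- B, B]) u) /\
      \forall k \near \oo, `|K k u| <= c / 2 + k.+1%:R^-1 * M]}].
Proof.
have [P [lP fP]] := fine_partitions.
have Px k := let: And4 h _ _ _ := fP k in h.
have Py k := let: And4 _ h _ _ := fP k in h.
have Pphi k := let: And4 _ _ h _ := fP k in h.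
have Pm k := let: And4 _ _ _ h := fP k in h.
have eps0 : (n.+1%:R^-1 : R) @[n --> \oo] --> 0 by exact: cvg_harmonic.
have [MJ [MJ0 HJ]] := overshoot_approx c_gt0 t_gt0 t_le cx cy cphi xE push pushN yB eps0 Py lP.
have [MN HN] := crossings_bounded c_gt0 t_gt0 t_le cx xE phi_le.
have [MC HC] := changes_uniform_bound c_gt0 T_gt0 cx cy cphi xE push pushN.
have B0 : 0 <= B by apply: le_trans (normr_ge0 (y 0)) (yB _); rewrite lexx ltW.
have MN0 : 0 <= MN by have [h h' _] := HN 0; rewrite -lee_fin (le_trans h).
have BM0 : 0 <= (B + B) * MJ by rewrite mulr_ge0 ?addr_ge0.
have cMN0 : 0 <= c * MN by rewrite mulr_ge0// ltW.
have cMC0 : 0 <= c * MC%:R by rewrite mulr_ge0// ltW.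
(* One constant for all bounds: the first term dominates the overshoots, the second the crossings,
   and the bracket dominates [K k] for every [k]. *)
exists ((B + B) * MJ + MN + (MJ + MC%:R + MC%:R + c * MN + c * MC%:R)); first by rewrite !addr_ge0.
set M := _ + _ + _.
have MC0 : 0 <= MC%:R :> R by exact: ler0n.
have JM : (B + B) * MJ <= M by rewrite /M; lra.
have MNM : MN <= M by rewrite /M; lra.
exists P; split => // K.
have : mu.-negligible (partition_values y P `|` local_extrema y).
  apply: negligibleU; [exact: partition_values_negligible|exact: local_extrema_negligible].
apply: negligibleS => u /=; apply: contra_notP => hu.
have pu : ~ partition_values y P u by move=> h; apply: hu; left.
have lu : ~ local_extrema y u by move=> h; apply: hu; right.
have [j [jE /andP[j0 jle] jout japp]] := HJ u pu.
have [n0 nle nout] := HN u.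
have nfin : crossings x u c t \is a fin_num.
  by rewrite ge0_fin_numE// (le_lt_trans nle) ?ltry.
set nu := fine (crossings x u c t).
have nuE : crossings x u c t = nu%:E by rewrite fineK.
have nu0 : 0 <= nu by exact: fine_ge0.
have nuM : nu <= MN by rewrite -lee_fin -nuE.
have yv k p : p \in (0, true) :: two_sided (P k) -> value y p != u.
  by move=> pP; apply/eqP => e; apply: pu; exists k, p.
have pQ k : path (@time_le R) (0, true) (two_sided (P k)).
  exact: path_two_sided (chain_path (Px k)).
have lQ k : (last (0, true) (two_sided (P k))).1 = t by rewrite last_two_sided lP.
pose N k : R := (partition_changes y P k u)%:R.
have NM k : N k <= MC%:R.
  rewrite /N ler_nat; apply: HC => //; first by rewrite lQ.
  exact: yv.
(* The three errors are those of the sum of [y - u], of the overshoots off the partition, and of the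
   sum of [phi]. What does not become small is the difference between changes and crossings. *)
have Kapp k : `|K k u - c / 2 * (N k - nu)| <= k.+1%:R^-1 * (N k + MJ + N k).
  rewrite /K; have -> : riemann_sum x (level y u) 0 (P k) =
      riemann_sum (y \- cst u) (level y u) 0 (P k) + u * signed_itv (y 0) (y t) u +
      riemann_sum phi (level y u) 0 (P k).
    have <- : riemann_sum (cst u) (level y u) 0 (P k) = u * signed_itv (y 0) (y t) u.
      by rewrite riemann_sum_cst lP.
    rewrite -!riemann_sumD; apply: eq_riemann_sum => r rP /=.
    rewrite subrK xE//; move: rP; rewrite inE => /predU1P[->|/(chain_mem (Px k))].
      by rewrite lexx ltW.
    by rewrite lP => /andP[r0 rt]; rewrite ltW//= (le_trans rt).
  have lPT : last 0 (P k) <= T by rewrite lP.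
  have h1 := riemann_sum_level cy (Py k) (lexx 0) lPT (yv k).
  have h2 := @riemann_sum_phi R T c y phi T_gt0 cy push pushN _ u 0 (P k) (Pphi k) (lexx 0) lPT (yv k).
  have h3 := japp k.
  rewrite jE -/(fine j%:E) /= -/nu; move: h1 h2 h3; rewrite -/(partition_changes y P k u) -/(N k).
  set e := _^-1; set S := \sum_(_ <- _) _.
  by rewrite !mulrDr !ler_norml => /andP[? ?] /andP[? ?] /andP[? ?]; apply/andP; split; lra.
have e1 k : 0 <= (k.+1%:R^-1 : R) <= 1 by rewrite invr_ge0 ler0n/= invf_le1// ler1n.
have N0 k : 0 <= N k by exact: ler0n.
have cN k : 0 <= c * N k <= c * MC%:R by rewrite mulr_ge0 ?(ltW c_gt0)//= ler_wpM2l// ltW.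
have cnu : 0 <= c * nu <= c * MN by rewrite mulr_ge0 ?(ltW c_gt0)//= ler_wpM2l// ltW.
have eN k : k.+1%:R^-1 * (N k + MJ + N k) <= k.+1%:R^-1 * M.
  have /andP[ek0 _] := e1 k; rewrite ler_wpM2l// /M.
  by have := NM k; lra.
have eN1 k : k.+1%:R^-1 * (N k + MJ + N k) <= MC%:R + MJ + MC%:R.
  have /andP[ek0 ek1] := e1 k.
  apply: (@le_trans _ _ (1 * (N k + MJ + N k))); last by rewrite mul1r; have := NM k; lra.
  by rewrite ler_wpM2r// !addr_ge0.
have out : ~ `[- B, B]%classic u -> [/\ j = 0, nu = 0 &
    forall p, 0 <= p.1 <= T -> (u < value y p)%R = (u < value y (0, true))%R].
  move=> uB; split; first exact: jout.
    apply/EFin_inj; rewrite -nuE nout//.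
    move: uB; rewrite /= in_itv/= => /negP; rewrite negb_and -!ltNge => /orP[uB|uB]; [right|left];
      move=> s /andP[s0 st]; have := yB (introT andP (conj s0 (le_trans st t_le)));
      rewrite ler_norml => /andP[? ?]; lra.
  move=> p pT; apply: (level_out T_gt0 cy yB uB) => //=.
  by rewrite lexx ltW.
have KM k : `|K k u| <= M * \1_(`[- B, B]) u.
  rewrite indicE; have [uB|uB] := boolP (u \in `[- B, B]%classic); rewrite ?mulr1 ?mulr0.
    have hb : `|c / 2 * (N k - nu)| <= c * MN + c * MC%:R.
      have -> : c / 2 * (N k - nu) = c * N k / 2 - c * nu / 2 by ring.
      move: (cN k) cnu; rewrite ler_norml => /andP[? ?] /andP[? ?].
      by apply/andP; split; lra.
    rewrite -[K k u](subrK (c / 2 * (N k - nu))).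
    apply: le_trans (ler_normD _ _) _; apply: le_trans (lerD (Kapp k) hb) _.
    by apply: le_trans (lerD (eN1 k) (lexx _)) _; rewrite /M; lra.
  have {uB}/out[j_0 nu_0 lev] : ~ `[- B, B]%classic u by move=> h; apply/(negP uB); rewrite inE.
  rewrite /K (@eq_riemann_sumG _ x _ (fun=> level y u (0, true))); last first.
    move=> r d rP; rewrite /level lev//=; move: rP; rewrite inE => /predU1P[->|/(chain_mem (Px k))].
      by rewrite lexx ltW.
    by rewrite lP => /andP[r0 rt]; rewrite ltW//= (le_trans rt).
  rewrite riemann_sum_cst_level jE /= j_0 -/nu nu_0.
  have -> : signed_itv (y 0) (y t) u = 0.
    rewrite -[y 0]/(value y (0, true)) -[y t]/(value y (t, true)) /signed_itv lev/= ?subrr//.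
    by rewrite ltW.
  by rewrite !mulr0 !addr0 subrr normr0.
split => //.
- by rewrite jE.
- rewrite jE /= indicE; have [uB|uB] := boolP (u \in `[- B, B]%classic); rewrite ?mulr1 ?mulr0.
    by rewrite ger0_norm// (le_trans jle).
  have {uB}/out[-> _ _] : ~ `[- B, B]%classic u by move=> h; apply/(negP uB); rewrite inE.
  by rewrite normr0.
- rewrite -/nu indicE; have [uB|uB] := boolP (u \in `[- B, B]%classic); rewrite ?mulr1 ?mulr0.
    by rewrite ger0_norm// (le_trans nuM).
  have {uB}/out[_ -> _] : ~ `[- B, B]%classic u by move=> h; apply/(negP uB); rewrite inE.
  by rewrite normr0.
split => //.
have := crossings_le_partition_changes c_gt0 t_gt0 t_le cx cy xE phi_le eps0 Pm lP pu lu.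
apply: filterS => k; rewrite nuE lee_fin -natr1 -/(N k) => nuN.
have Nnu : N k - 1 <= nu.
  have lQt : (last (0, true) (two_sided (P k))).1 <= t by rewrite lQ.
  have [+ _] := @changes_bounds R T t c x y phi c_gt0 t_le cy cphi xE push pushN u
    (two_sided (P k)) (0, true) (pQ k) (lexx 0) lQt (yv k).
  rewrite nuE lee_fin; rewrite -/(partition_changes y P k u) => h.
  by rewrite lerBlDr (le_trans _ (lerD h (lexx 1)))// natr1 ler_nat leqSpred.
(* The crossings are at least the changes minus one for every [k], and at most the changes plus one
   for large [k]. *)
have h : `|c / 2 * (N k - nu)| <= c / 2.
  have N1 : `|N k - nu| <= 1 by rewrite ler_norml; apply/andP; split; lra.
  by rewrite normrM gtr0_norm ?divr_gt0// -[leRHS]mulr1 ler_wpM2l// divr_ge0// ltW.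
rewrite -[K k u](subrK (c / 2 * (N k - nu))) addrC [leRHS]addrC addrC.
by apply: le_trans (ler_normD _ _) _; apply: lerD h; exact: le_trans (Kapp k) (eN k).
Qed.

Lemma deriv_integral_estimate : exists Jr Nr : R,
  [/\ (\int[mu]_u (jump_overshoot y t u * (f2 u)%:E))%E = Jr%:E,
      (\int[mu]_u (c%:E * crossings x u c t * (f2 u)%:E))%E = Nr%:E &
      `|deriv_integral T f y x t -
        (f (y t) - f (y 0) + derive1 f (y t) * phi t - Jr - Nr / 2)| <=
      c / 2 * \int[mu]_(u in `[- B, B]) `|f2 u|].
Proof.
have [M M0 [P [lP Px H]]] := kernel_approx.
set j := fun u => fine (jump_overshoot y t u).
set nu := fun u => fine (crossings x u c t).
have mj : measurable_fun setT j by exact: measurableT_comp.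
have mnu : measurable_fun setT nu by exact: measurableT_comp.
have ij : mu.-integrable setT (EFin \o (j \* f2)).
  by apply: (@ae_integrable_support _ _ (- B) B M) => //; apply: ae_imply H => u [].
have inu : mu.-integrable setT (EFin \o (nu \* f2)).
  by apply: (@ae_integrable_support _ _ (- B) B M) => //; apply: ae_imply H => u [].
have [iE eE] := endpoint_integral.
pose kappa u := u * signed_itv (y 0) (y t) u + j u + c / 2 * nu u.
have icnu := integrableZl_EFin (c / 2) measurableT inu.
have iEj := integrableD_EFin measurableT iE ij.
have ikappa : mu.-integrable setT (EFin \o (kappa \* f2)).
  apply: eq_integrable (integrableD_EFin measurableT iEj icnu) => // u _.
  by rewrite /= /kappa; congr EFin; ring.
have kappaE : \int[mu]_u (kappa u * f2 u) =
    y t * derive1 f (y t) - y 0 * derive1 f (y 0) - (f (y t) - f (y 0)) +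
    \int[mu]_u (j u * f2 u) + c / 2 * \int[mu]_u (nu u * f2 u).
  rewrite -eE -RintegralZl// -RintegralD// -RintegralD//.
  by apply: eq_Rintegral => u _; rewrite /kappa /=; ring.
exists (\int[mu]_u (j u * f2 u)), (c * \int[mu]_u (nu u * f2 u)); split.
- by rewrite integral_fine_mul//; apply: ae_imply H => u [].
- rewrite -RintegralZl//; transitivity (\int[mu]_u ((c%:E * crossings x u c t) * (f2 u)%:E))%E.
    by [].
  rewrite integral_fine_mul//.
  + congr EFin; apply: ae_eq_Rintegral => //.
    * by apply: measurable_funM => //; apply: measurableT_comp => //; exact: measurable_funeM.
    * by apply: measurable_funM => //; exact: measurable_funM.
    * by apply: ae_imply H => u [_ nfin _ _ _] _; rewrite fineM//= mulrA.
  + exact: measurable_funeM.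
  + by apply: ae_imply H => u [_ nfin _ _ _]; rewrite fin_numM.
  + apply: ae_le_integrable (integrable_norm (integrableZl_EFin c measurableT inu)) => //.
      apply/measurable_EFinP; apply: measurable_funM => //; apply: measurableT_comp => //.
      exact: measurable_funeM.
    by apply: ae_imply H => u [_ nfin _ _ _] _; rewrite /= fineM//= mulrA.
set S := stieltjes_integral T (derive1 f \o y) (left_limit x) t +
  real_sum `]0, t] (fun s => jump x s * jump_of (derive1 f) y s).
have [C HC] : exists C, forall k, `|S - riemann_sum x (derive1 f \o value y) 0 (P k)| <=
    C * k.+1%:R^-1.
  have [V HV] := variation2_bounded c_gt0 T_gt0 cx cy cphi xE push pushN yB lf2 f2E.
  have lim s : 0 <= s <= T -> left_limit (derive1 f \o y) s = derive1 f (left_limit y s).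
    by move=> /andP[s0 sT]; exact: (left_limit_comp cy f_C1 s0 sT).2.
  have bv := cadlag_bv_derive1 c_gt0 T_gt0 cx cy cphi xE push pushN yB lf2 f2E f_C1.
  have [C HC] := deriv_integral_approx T_gt0 cx bv t_gt0 t_le lim
    (fun l ul lt => sum_jumps_le T_gt0 HV t_le ul lt).
  by exists C => k; apply: HC.
suff main : `|S - \int[mu]_u (kappa u * f2 u)| <= c / 2 * \int[mu]_(u in `[- B, B]) `|f2 u|.
  (* The boundary terms of the integration by parts meet those of [endpoint_integral]: [y 0 = x 0]
     since [phi 0 = 0], and [x t - y t = phi t] leaves [f'(y t) * phi t]. *)
  rewrite /deriv_integral -distrC; apply: le_trans main; rewrite le_eqVlt.
  apply/orP; left; apply/eqP; congr (`|_|); rewrite kappaE /S.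
  have y0 : y 0 = x 0 by rewrite xE ?phi0 ?addr0// lexx ltW.
  have xt : x t = y t + phi t by rewrite xE// ltW.
  by rewrite -y0 xt; ring.
pose K k u := riemann_sum x (level y u) 0 (P k) - kappa u.
have mkappa : measurable_fun setT kappa.
  apply: measurable_funD; last exact: measurable_funM.
  apply: measurable_funD => //; apply: measurable_funM; first exact: measurable_id.
  exact: measurable_signed_itv.
have mK k : measurable_fun setT (K k).
  by apply: measurable_funB => //; exact: measurable_riemann_sum_level.
have KB k : {ae mu, forall u, `|K k u| <= M * \1_(`[- B, B]) u}.
  by apply: ae_imply H => u [_ _ _ _ [KM _]]; exact: KM.
(* The kernels need not converge, but their excess over [c / 2] tends to [0] almost everywhere and
   is dominated by [M * |f2|] on [[- B, B]]. *)
pose h k u := Num.max (`|K k u| - c / 2) 0 * `|f2 u|.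
have mh k : measurable_fun `[- B, B]%classic (h k).
  apply: measurable_funTS; apply: measurable_funM; last exact: measurableT_comp.
  apply: measurable_maxr => //; apply: measurable_funB => //; exact: measurableT_comp.
have if2 := integrable_norm (locally_integrable_itv (- B) B lf2).
have iM : mu.-integrable `[- B, B] (EFin \o (fun u => M * `|f2 u|)) by exact: integrableZl_EFin.
have hM : {ae mu, forall u, `[- B, B]%classic u -> forall k, `|h k u| <= M * `|f2 u|}.
  apply: ae_imply H => u [_ _ _ _ [KM _]] uB k.
  rewrite /h normrM normr_id ler_wpM2r//.
  have := KM k; rewrite indicE mem_set// mulr1 -/(K k u) => KMk.
  by rewrite ger0_norm ?le_max ?lexx ?orbT// ge_max M0 andbT lerBlDr (le_trans KMk)// lerDl divr_ge0// ltW.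
have ih k : mu.-integrable `[- B, B] (EFin \o h k).
  apply: ae_le_integrable iM => //; first by apply/measurable_EFinP; exact: mh.
  by apply: ae_imply hM => u hu uB; rewrite /= lee_fin; exact: hu.
have h0 : (\int[mu]_(u in `[- B, B]) h k u) @[k --> \oo] --> (0 : R).
  have -> : 0 = \int[mu]_(u in `[- B, B]) (cst 0 u) :> R by rewrite Rintegral_cst// mul0r.
  apply: Rintegral_dominated_cvg iM hM => //.
  apply: ae_imply H => u [_ _ _ _ [_ Kn]] uB.
  have eps0 : (M * `|f2 u| * n.+1%:R^-1) @[n --> \oo] --> (0 : R).
    by rewrite -[X in _ --> X](mulr0 (M * `|f2 u|)); apply: cvgM; [exact: cvg_cst|exact: cvg_harmonic].
  apply: (squeeze_cvgr _ (cvg_cst 0) eps0).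
  apply: filterS Kn => k Kk; rewrite -/(K k u) in Kk.
  rewrite /h mulr_ge0 ?le_max ?lexx ?orbT//= mulrAC ler_wpM2r// ge_max.
  by rewrite [M / _]mulrC lerBlDl Kk mulr_ge0.
have Kle k : `|riemann_sum x (derive1 f \o value y) 0 (P k) - \int[mu]_u (kappa u * f2 u)| <=
    \int[mu]_(u in `[- B, B]) h k u + c / 2 * \int[mu]_(u in `[- B, B]) `|f2 u|.
  have [iR ->] := riemann_sum_integral lf2 f2E y x 0 (P k).
  rewrite -RintegralB//.
  have -> : \int[mu]_u (riemann_sum x (level y u) 0 (P k) * f2 u - kappa u * f2 u) =
      \int[mu]_u (K k u * f2 u) by apply: eq_Rintegral => u _; rewrite /K mulrBl.
  apply: le_trans (ae_le_Rintegral_support (mK k) (KB k) lf2) _.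
  have ic : mu.-integrable `[- B, B] (EFin \o (fun u => c / 2 * `|f2 u|)) by exact: integrableZl_EFin.
  rewrite -RintegralZl// -RintegralD//.
  apply: ae_le_Rintegral => //.
  - apply: ae_le_integrable iM => //.
      apply/measurable_EFinP; apply: measurable_funTS; apply: measurable_funM; last exact: measurableT_comp.
      by apply: measurableT_comp => //; exact: mK.
    apply: ae_imply (KB k) => u; rewrite indicE => + uB; rewrite mem_set// mulr1 => KMk.
    by rewrite /= lee_fin ger0_norm ?mulr_ge0// ler_wpM2r.
  - exact: integrableD_EFin.
  - apply: nearW => u uB; rewrite /h -mulrDl ler_wpM2r//.
    by rewrite -lerBlDr le_max lexx.
have cvgR : C * k.+1%:R^-1 + (\int[mu]_(u in `[- B, B]) h k u +
    c / 2 * \int[mu]_(u in `[- B, B]) `|f2 u|) @[k --> \oo] -->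
    (C * 0 + (0 + c / 2 * \int[mu]_(u in `[- B, B]) `|f2 u|)).
  apply: cvgD; last by apply: cvgD => //; exact: cvg_cst.
  by apply: cvgM; [exact: cvg_cst|exact: cvg_harmonic].
rewrite mulr0 !add0r in cvgR.
apply: (closed_cvg (fun v => `|S - \int[mu]_u (kappa u * f2 u)| <= v)) cvgR.
  exact: closed_ge.
apply: nearW => k; rewrite -(subrKA (riemann_sum x (derive1 f \o value y) 0 (P k))).
by apply: le_trans (ler_normD _ _) _; apply: lerD.
Qed.

End ReflectedIntegral.

(** * Products of functions with conjugate exponents *)

Section ConjugateExponents.
Context d (X : measurableType d) {R : realType}.
Variable mu : {measure set X -> \bar R}.

Lemma integrable_mul_bounded (f g : X -> R) : measurable_fun setT g ->
  mu.-integrable setT (EFin \o f) -> ('N[mu]_(+oo%E) [EFin \o g] < +oo)%E ->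
  (0 < mu setT)%E -> mu.-integrable setT (EFin \o (f \* g)).
Proof.
move=> mg fi + mu0; rewrite unlock mu0 => gy.
have mf : measurable_fun setT f by apply/measurable_EFinP; exact: measurable_int fi.
have [M gM] : exists M, {ae mu, forall x, `|g x| <= M}.
  have [|M HM] := @ess_supr_bounded _ _ R mu (fun x => `|g x|); last by exists M.
  apply: le_lt_trans gy; rewrite le_eqVlt; apply/orP; left; apply/eqP.
  by apply: eq_ess_sup; exact: nearW.
have iMf := integrableZl measurableT M (integrable_norm fi).
apply: ae_le_integrable iMf => //.
  by apply/measurable_EFinP; exact: measurable_funM.
apply: filterS gM => u gM _; rewrite /= lee_fin normrM mulrC.
by rewrite ler_wpM2r.
Qed.

Lemma Lnorm_fin_ae (p : \bar R) (h : X -> \bar R) : (1 <= p)%E -> (0 < mu setT)%E ->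
  measurable_fun setT h -> ('N[mu]_p [h] < +oo)%E ->
  {ae mu, forall x, h x \is a fin_num}.
Proof.
move=> p1 mu0 mh; rewrite unlock; case: p p1 => [r|_|//]; last first.
  rewrite mu0 => hy; have := @ess_sup_ge _ _ R mu (abse \o h).
  by apply: filterS => u hu; rewrite fin_num_abs; exact: le_lt_trans hy.
rewrite lee_fin => r1; have r0 : 0 < r by exact: lt_le_trans r1.
move=> /lty_poweRy; rewrite invr_eq0 gt_eqF// => /(_ isT) hy.
have mhr : measurable_fun setT (fun u => `|h u| `^ r)%E.
  apply: (@measurableT_comp _ _ _ _ _ _ (fun v => v `^ r)%E); first exact: measurable_poweR.
  exact: measurableT_comp.
have : mu.-integrable setT (fun u => `|h u| `^ r)%E.
  apply/integrableP; split => //; apply: le_lt_trans hy.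
  rewrite le_eqVlt; apply/orP; left; apply/eqP; apply: eq_integral => u _.
  by rewrite gee0_abs// poweR_ge0.
move=> /(integrable_ae measurableT); apply: filterS => u /(_ I).
by rewrite ge0_fin_numE ?poweR_ge0// fin_num_abs; apply: lty_poweRy; rewrite gt_eqF.
Qed.

Lemma Lnorm_fine (p : \bar R) (h : X -> \bar R) : (1 <= p)%E -> (0 < mu setT)%E ->
  measurable_fun setT h -> ('N[mu]_p [h] < +oo)%E ->
  ('N[mu]_p [EFin \o (fine \o h)] < +oo)%E.
Proof.
move=> p1 mu0 mh hy; have hfin := Lnorm_fin_ae p1 mu0 mh hy; move: hy.
rewrite unlock; case: p p1 => [r|_|//]; last first.
  rewrite mu0; apply: le_lt_trans; apply: le_ess_sup.
  by apply: filterS hfin => u hu /=; rewrite -{2}(fineK hu).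
rewrite lee_fin => r1; have r0 : 0 < r by exact: lt_le_trans r1.
congr (_ < _)%E; congr (_ `^ _)%E; have mf : measurable_fun setT (fine \o h).
  exact: measurableT_comp.
apply: ae_eq_integral => //.
- apply: (@measurableT_comp _ _ _ _ _ _ (fun v => v `^ r)%E); first exact: measurable_poweR.
  exact: measurableT_comp.
- apply: (@measurableT_comp _ _ _ _ _ _ (fun v => v `^ r)%E); first exact: measurable_poweR.
  by apply: measurableT_comp => //; exact/measurable_EFinP.
- by apply: filterS hfin => u hu _ /=; rewrite -{1}(fineK hu).
Qed.

(** For finite exponents this is the inequality of Hoelder; an infinite exponent forces the other
    one to be [1], and an integrable function is multiplied by an essentially bounded one. Both
    cannot be infinite since [0 + 0 <> 1]. *)
Lemma conjugate_integrable (p q : \bar R) (h : X -> \bar R) (g : X -> R) :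
  (1 <= p)%E -> (1 <= q)%E -> (p^-1 + q^-1 = 1)%E -> (0 < mu setT)%E ->
  measurable_fun setT h -> ('N[mu]_p [h] < +oo)%E -> g \in Lfun mu q ->
  mu.-integrable setT (EFin \o ((fine \o h) \* g)).
Proof.
move=> p1 q1 pq mu0 mh /(Lnorm_fine p1 mu0 mh) hy /andP[/set_mem mg /set_mem gy].
have {}mg : measurable_fun setT g := mg.
have {}gy : ('N[mu]_q [EFin \o g] < +oo)%E := gy.
have mf : measurable_fun setT (fine \o h) by exact: measurableT_comp.
have L1 (k : X -> R) : measurable_fun setT k -> ('N[mu]_1 [EFin \o k] < +oo)%E ->
    mu.-integrable setT (EFin \o k).
  by move=> mk; rewrite Lnorm1 => ky; apply/integrableP; split => //; exact/measurable_EFinP.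
case: p p1 pq hy => [r|_|//]; case: q q1 gy => [s|_|//].
- rewrite !lee_fin => s1 gy r1 pq hy.
  have r0 : 0 < r by exact: lt_le_trans r1.
  have s0 : 0 < s by exact: lt_le_trans s1.
  apply: L1; first exact: measurable_funM.
  have pq' : r^-1 + s^-1 = 1 by move: pq; rewrite !inver !gt_eqF// -EFinD => -[].
  apply: (le_lt_trans (@hoelder _ _ _ mu _ _ _ _ mf mg r0 s0 pq')).
  apply: lte_mul_pinfty => //; first exact: Lnorm_ge0.
  by rewrite ge0_fin_numE// Lnorm_ge0.
- move=> gy r1; rewrite invey adde0 => /eqP; rewrite inve_eq1 => /eqP -> hy.
  exact: integrable_mul_bounded (L1 _ mf hy) gy mu0.
- move=> s1 gy; rewrite invey add0e => /eqP; rewrite inve_eq1 => /eqP sE hy.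
  rewrite sE in gy; have := integrable_mul_bounded mf (L1 _ mg gy) hy mu0.
  by apply: eq_integrable => // u _ /=; rewrite mulrC.
- by rewrite invey adde0 => _ /eqP; rewrite eq_sym onee_eq0.
Qed.

End ConjugateExponents.

(** * The sum of the jump terms *)

Section JumpSum.
Context {R : realType}.
Implicit Types (a b r s u : R) (l : seq R).
Local Notation mu := (@lebesgue_measure R).
Context (T t : R) (x f f2 : R -> R).
Context (t_gt0 : 0 < t) (t_le : t <= T) (cx : cadlag T x).
Context (f_diff : forall u, derivable f u 1) (f_C1 : continuous (derive1 f)).
Context (f2_weak : weak_derivative 2 f f2).
Context (mJ : measurable_fun setT (jump_overshoot x t)).
Context (J_fin : {ae mu, forall u, jump_overshoot x t u \is a fin_num}).
Context (J_int : mu.-integrable setT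
  (EFin \o (fun u => fine (jump_overshoot x t u) * f2 u))).

Let lf2 : locally_integrable setT f2. Proof. by case: f2_weak. Qed.

Let mf2 : measurable_fun setT f2. Proof. by case: lf2. Qed.

(** The kernel of the Taylor remainder over the jump at [s]. It is nonnegative for jumps of either
    sign and coincides with the summand of [jump_overshoot]. *)
Definition overshoot s u : R := (x s - u) * signed_itv (left_limit x s) (x s) u.

Lemma overshootE s u : overshoot s u = `|x s - u| * \1_(between (left_limit x s) (x s)) u.
Proof. by rewrite overshoot_crosses -crosses_term. Qed.

Lemma overshoot_ge0 s u : 0 <= overshoot s u.
Proof. by rewrite overshootE mulr_ge0// indicE. Qed.

Lemma overshoot_eq0 s u : jump x s = 0 -> overshoot s u = 0.
Proof.
by move/eqP; rewrite subr_eq0 => /eqP xE; rewrite /overshoot /signed_itv xE subrr mulr0.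
Qed.

Lemma measurable_overshoot s : measurable_fun setT (overshoot s).
Proof.
apply: measurable_funM; last exact: measurable_signed_itv.
by apply: measurable_funB => //; exact: measurable_id.
Qed.

Lemma integrable_overshoot s : mu.-integrable setT (EFin \o (fun u => overshoot s u * f2 u)).
Proof.
have mB : measurable_fun setT (fun u : R => x s - u).
  by apply: measurable_funB => //; exact: measurable_id.
by apply: (integrable_signed_itv mB _ lf2) => u /dist_min_max[h _]; exact: h.
Qed.

Lemma tanaka_jump_term_integral s :
  tanaka_jump_term f x s = \int[mu]_u (overshoot s u * f2 u).
Proof. exact: (taylor_signed (left_limit x s) (x s) f_diff f_C1 f2_weak). Qed.

Lemma sum_overshoot_integral l :
  [/\ mu.-integrable setT (EFin \o (fun u => (\sum_(s <- l) overshoot s u) * f2 u)),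
      mu.-integrable setT (EFin \o (fun u => (\sum_(s <- l) overshoot s u) * `|f2 u|)),
      \sum_(s <- l) tanaka_jump_term f x s =
        \int[mu]_u ((\sum_(s <- l) overshoot s u) * f2 u) &
      \sum_(s <- l) `|tanaka_jump_term f x s| <=
        \int[mu]_u ((\sum_(s <- l) overshoot s u) * `|f2 u|)].
Proof.
elim: l => [|s l [i1 i2 e le]].
  have i0 : mu.-integrable setT (EFin \o (fun=> 0 : R)) by exact: integrable0.
  have sE (g : R -> R) : (fun u => (\sum_(s <- [::]) overshoot s u) * g u) = (fun=> 0).
    by apply/funext => u; rewrite big_nil mul0r.
  by rewrite !sE !big_nil Rintegral_cst// mul0r; split.
have sE (g : R -> R) : (fun u => (\sum_(r <- s :: l) overshoot r u) * g u) =
    (fun u => overshoot s u * g u + (\sum_(r <- l) overshoot r u) * g u).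
  by apply/funext => u; rewrite big_cons mulrDl.
have j1 := integrable_overshoot s.
have j2 : mu.-integrable setT (EFin \o (fun u => overshoot s u * `|f2 u|)).
  have := integrable_norm j1; apply: eq_integrable => // u _.
  by rewrite /= normrM (ger0_norm (overshoot_ge0 _ _)).
rewrite !sE !big_cons; split.
- exact: integrableD_EFin.
- exact: integrableD_EFin.
- by rewrite RintegralD// e tanaka_jump_term_integral.
rewrite RintegralD//; apply: lerD => //.
rewrite tanaka_jump_term_integral; apply: le_trans (le_normr_Rintegral _ j1) _ => //.
rewrite le_eqVlt; apply/orP; left; apply/eqP; apply: eq_Rintegral => u _.
by rewrite /= normrM (ger0_norm (overshoot_ge0 _ _)).
Qed.

Let J u := fine (jump_overshoot x t u).

Lemma jump_overshootE u : jump_overshoot x t u = (\esum_(s in `]0%R, t]) (overshoot s u)%:E)%E.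
Proof. by apply: eq_esum => s _; rewrite overshootE. Qed.

Lemma sum_overshoot_le l u : jump_overshoot x t u \is a fin_num -> uniq l ->
  (forall s, s \in l -> 0 < s <= t) -> \sum_(s <- l) overshoot s u <= J u.
Proof.
move=> Jf ul lt; rewrite -lee_fin /J fineK// jump_overshootE.
apply: (esum_ge_seq _ ul) => [s _|s /lt]; last by rewrite /= in_itv.
exact: overshoot_ge0.
Qed.

(** Each jump time eventually belongs to [P k], as jumps off the partition are at most
    [1 / (k + 1)]. A finite list nearly exhausting the sum at [u] is therefore eventually contained
    in [P k], up to times without jump, which contribute nothing. The partitions do not depend on
    [u]. *)
Lemma overshoot_partitions : exists P : nat -> seq R,
  [/\ forall k, uniq (P k), forall k s, s \in P k -> 0 < s <= t &
      forall u, jump_overshoot x t u \is a fin_num ->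
        \sum_(s <- P k) overshoot s u @[k --> \oo] --> J u].
Proof.
have /choice[P hP] k : exists P, chain (fun a b => osc_le x k.+1%:R^-1 a b) 0 P /\ last 0 P = t.
  have k0 : 0 < k.+1%:R^-1 :> R by rewrite invr_gt0.
  by have [P cP lP] := cadlag_chain cx k0 (ltW t_gt0) t_le; exists P.
have Pt k s : s \in P k -> 0 < s <= t.
  by move=> sP; have [cP <-] := hP k; exact: chain_mem cP sP.
exists P; split => // [k|u Jf]; first exact: chain_uniq (hP k).1.
have inP s : 0 < s <= t -> jump x s != 0 -> \forall k \near \oo, s \in P k.
  move=> st js; near=> k; apply: contraT => sP.
  have := chain_jump cx (hP k).1 (lexx 0) _ _ sP; rewrite (hP k).2 => /(_ t_le st).
  rewrite leNgt => /negP[]; rewrite invf_plt ?posrE ?normr_gt0//.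
  near: k; exact: near_infty_ltS.
apply/cvgrPdist_le => e e0.
have [l [ul lt le]] : exists l, [/\ uniq l, forall s, s \in l -> 0 < s <= t &
    J u - e < \sum_(s <- l) overshoot s u].
  have : ((J u - e)%:E < jump_overshoot x t u)%E.
    by rewrite -[ltRHS](fineK Jf) lte_fin ltrBlDr ltrDl.
  rewrite jump_overshootE => /ereal_sup_gt[_ [F [finF FD] <-]].
  rewrite fsbig_finite//= sumEFin lte_fin => h.
  exists (finmap.enum_fset (fset_set F)); split => //; first exact: finmap.fset_uniq.
  by move=> s; rewrite in_fset_set// inE => /FD; rewrite /= in_itv.
have lP : \forall k \near \oo, forall s, s \in l -> jump x s != 0 -> s \in P k.
  elim: l lt {ul le} => [|s l IH] lt; first exact: nearW.
  have {}IH := IH (fun s' s'l => lt s' (mem_subseq (subseq_cons l s) s'l)).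
  have [js|js] := eqVneq (jump x s) 0.
    apply: filterS IH => k hk s'; rewrite inE => /predU1P[->|]; first by rewrite js eqxx.
    exact: hk.
  apply: filterS2 (inP s (lt s (mem_head _ _)) js) IH => k sk hk s'.
  by rewrite inE => /predU1P[-> //|]; exact: hk.
apply: filterS lP => k hk.
have lek : \sum_(s <- l) overshoot s u <= \sum_(s <- P k) overshoot s u.
  have -> : \sum_(s <- l) overshoot s u = \sum_(s <- [seq s <- l | s \in P k]) overshoot s u.
    rewrite big_filter [RHS]big_mkcond/= big_seq [RHS]big_seq; apply: eq_bigr => s sl.
    case: ifPn => // sP; apply: overshoot_eq0; apply/eqP; apply: contraR sP.
    exact: hk.
  rewrite -lee_fin.
  have -> : (\sum_(s <- P k) overshoot s u)%:E = (\esum_(s in [set` P k]) (overshoot s u)%:E)%E.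
    rewrite esum_fset; [|exact: finite_seq|by move=> s _; rewrite lee_fin overshoot_ge0].
    by rewrite -fsbig_seq ?sumEFin//; exact: chain_uniq (hP k).1.
  apply: esum_ge_seq => [s _||s]; first exact: overshoot_ge0.
    exact: filter_uniq.
  by rewrite mem_filter => /andP[].
have Pk := sum_overshoot_le Jf (chain_uniq (hP k).1) (Pt k).
by rewrite ger0_norm ?subr_ge0//; lra.
Unshelve. all: by end_near. Qed.

(** Finite sums of jump terms are integrals of finite sums of overshoots, which [J] dominates; this
    gives summability. Both the sum of all jump terms and the integral of [J] are within [D k] of
    the sum over [P k], and [D k] tends to [0] by dominated convergence. *)
Lemma tanaka_jump_integral : summable `]0, t] (fun s => (tanaka_jump_term f x s)%:E) /\
  tanaka_jump f x t = \int[mu]_u (J u * f2 u).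
Proof.
have [P [uP Pt PJ]] := overshoot_partitions.
have mJr : measurable_fun setT J by exact: measurableT_comp.
have J0 u : 0 <= J u.
  by apply: fine_ge0; rewrite jump_overshootE; apply: esum_ge0 => s _; rewrite lee_fin overshoot_ge0.
have iJ : mu.-integrable setT (EFin \o (fun u => J u * `|f2 u|)).
  have := integrable_norm J_int; apply: eq_integrable => // u _.
  by rewrite /= normrM (ger0_norm (J0 u)).
split.
  apply: (@le_lt_trans _ _ (\int[mu]_u (J u * `|f2 u|))%:E); last exact: ltry.
  apply: (@esum_le_seq _ _ _ (fun s => `|tanaka_jump_term f x s|)) => l ul lt.
  have [_ i2 _ le] := sum_overshoot_integral l; apply: le_trans le _.
  apply: ae_le_Rintegral => //; apply: ae_imply J_fin => u Jf _.
  by rewrite ler_wpM2r// sum_overshoot_le.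
pose S k u := \sum_(s <- P k) overshoot s u.
have mS k : measurable_fun setT (S k).
  by apply: measurable_sum => s; exact: measurable_overshoot.
have SJ k : {ae mu, forall u, 0 <= S k u <= J u}.
  apply: ae_imply J_fin => u Jf; rewrite sum_overshoot_le ?sumr_ge0 ?uP// => [s _|s].
    exact: overshoot_ge0.
  exact: Pt.
pose D k := \int[mu]_u ((J u - S k u) * `|f2 u|).
have iD k : mu.-integrable setT (EFin \o (fun u => (J u - S k u) * `|f2 u|)).
  have [_ i2 _ _] := sum_overshoot_integral (P k).
  have := integrableB_EFin measurableT iJ i2; apply: eq_integrable => // u _.
  by rewrite /= mulrBl.
have D0 : D k @[k --> \oo] --> (0 : R).
  have -> : 0 = \int[mu]_u (cst 0 u) :> R by rewrite Rintegral_cst// mul0r.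
  apply: Rintegral_dominated_cvg iJ _ => //.
  - move=> k; apply: measurable_funM; last exact: measurableT_comp.
    by apply: measurable_funB => //; exact: mS.
  - apply: ae_imply J_fin => u /PJ Ju _.
    rewrite -[X in _ --> X](mul0r `|f2 u|) -{1}(subrr (J u)).
    by apply: cvgM; [apply: cvgB => //; exact: cvg_cst|exact: cvg_cst].
  - apply: ae_imply J_fin => u Jf _ k.
    have SJk : S k u <= J u by apply: sum_overshoot_le => //; exact: Pt.
    rewrite normrM normr_id ler_wpM2r// ger0_norm ?subr_ge0// gerBl sumr_ge0// => s _.
    exact: overshoot_ge0.
have H1 k : `|tanaka_jump f x t - \sum_(s <- P k) tanaka_jump_term f x s| <= D k.
  apply: real_sum_approx => //; first by move=> s /Pt; rewrite /= in_itv.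
  move=> m um mP; have [_ i2 _ le] := sum_overshoot_integral m; apply: le_trans le _.
  apply: ae_le_Rintegral => //; apply: ae_imply J_fin => u Jf _.
  (* As [m] is disjoint from [P k], the overshoots over both lists together stay below [J], so those
     over [m] are at most [J - S k]. *)
  rewrite ler_wpM2r// lerBrDr -big_cat sum_overshoot_le//.
    rewrite cat_uniq um uP andbT; apply/hasPn => s sP.
    by apply/negP => /mP[_]; rewrite sP.
  move=> s; rewrite mem_cat => /orP[/mP[]|/Pt//].
  by rewrite /= in_itv.
have H2 k : `|\sum_(s <- P k) tanaka_jump_term f x s - \int[mu]_u (J u * f2 u)| <= D k.
  have [i1 _ -> _] := sum_overshoot_integral (P k).
  rewrite distrC -RintegralB//.
  have iB : mu.-integrable setT (EFin \o (fun u => J u * f2 u - S k u * f2 u)).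
    exact: integrableB_EFin.
  apply: le_trans (le_normr_Rintegral _ iB) _ => //.
  apply: ae_le_Rintegral => //; first exact: integrable_norm.
  by apply: ae_imply (SJ k) => u /andP[_ h] _; rewrite -mulrBl normrM ger0_norm// subr_ge0.
apply/eqP; rewrite -subr_eq0 -normr_le0.
have D00 : D k + D k @[k --> \oo] --> (0 : R) by rewrite -[X in _ --> X]addr0; exact: cvgD.
apply: (closed_cvg (fun v => `|tanaka_jump f x t - \int[mu]_u (J u * f2 u)| <= v)) D00.
  exact: closed_ge.
apply: nearW => k; rewrite -(subrKA (\sum_(s <- P k) tanaka_jump_term f x s)).
by apply: le_trans (ler_normD _ _) _; apply: lerD.
Qed.

End JumpSum.

(** * Passage to the limit *)

Lemma lebesgue_measureT_gt0 {R : realType} : (0 < @lebesgue_measure R setT)%E.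
Proof. by rewrite -set_itvNyy lebesgue_measure_itv/= addye// lt0y. Qed.

Section ZeroTime.
Context {R : realType}.
Implicit Types (T : R) (f x y h g : R -> R).

Lemma itv00 : `]0, 0]%classic = set0 :> set R.
Proof.
by apply/seteqP; split => // s; rewrite /= in_itv/= => /andP[s0]; rewrite leNgt s0.
Qed.

Lemma real_sum_set0 (a : R -> R) : real_sum set0 a = 0.
Proof. by rewrite /real_sum !esum_set0 subrr. Qed.

Lemma deriv_integral0 T f y x : deriv_integral T f y x 0 = 0.
Proof.
rewrite /deriv_integral /stieltjes_integral itv00 !Rintegral_set0 real_sum_set0.
by rewrite !subrr.
Qed.

End ZeroTime.

Section Convergence.
Context {R : realType}.
Local Notation mu := (@lebesgue_measure R).
Context (T : R) (c : nat -> R) (p q : \bar R) (x : R -> R)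
  (phi xn : nat -> R -> R) (f f2 l : R -> R) (t : R).
Context (T_gt0 : 0 < T) (c_gt0 : forall n, 0 < c n).
Context (c_cvg0 : c n @[n --> \oo] --> 0).
Context (p_ge1 : (1 <= p)%E) (q_ge1 : (1 <= q)%E) (pq_conj : (p^-1 + q^-1 = 1)%E).
Context (t_gt0 : 0 < t) (t_le : t <= T) (cx : cadlag T x).
Context (xn_sol : forall n, skorokhod_solution T x (c n) (phi n) (xn n)).
Context (f_diff : forall u, derivable f u 1) (f_C1 : continuous (derive1 f)).
Context (f2_Lq : f2 \in Lfun mu q) (f2_weak : weak_derivative 2 f f2).
Context (cross_cvg : weak_Lp_cvg p q (scaled_crossings c x t) (EFin \o l)).
Context (over_cvg : weak_Lp_cvg p q (fun n => jump_overshoot (xn n) t)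
  (jump_overshoot x t)).

Lemma in_Lp_dual (h : R -> \bar R) : in_Lp p h ->
  [/\ measurable_fun setT h, {ae mu, forall u, h u \is a fin_num},
      mu.-integrable setT (EFin \o (fun u => fine (h u) * f2 u)) &
      (\int[mu]_u (h u * (f2 u)%:E))%E = (\int[mu]_u (fine (h u) * f2 u))%:E].
Proof.
move=> [mh hp]; have T0 := @lebesgue_measureT_gt0 R.
have hfin := Lnorm_fin_ae p_ge1 T0 mh hp.
have hi : mu.-integrable setT (EFin \o (fun u => fine (h u) * f2 u)).
  exact: conjugate_integrable p_ge1 q_ge1 pq_conj T0 mh hp f2_Lq.
split => //; apply: integral_fine_mul => //.
by case: f2_weak => _ [].
Qed.

Lemma reflected_distance n s : 0 <= s <= T -> `|x s - xn n s| <= c n / 2.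
Proof.
have [_ xE phi_le _ _] := skorokhod_pushes T_gt0 (xn_sol n).
by move=> sT; rewrite (xE s sT) addrAC subrr add0r phi_le.
Qed.

Lemma cvg_weak (h : nat -> R -> \bar R) (k : R -> \bar R) : weak_Lp_cvg p q h k ->
  fine (\int[mu]_u (h n u * (f2 u)%:E)%E) @[n --> \oo] -->
  \int[mu]_u (fine (k u) * f2 u).
Proof.
move=> [_ /in_Lp_dual[_ _ _ kE] /(_ _ f2_Lq)]; rewrite kE.
exact: fine_cvg.
Qed.

(** The main expression [E n] converges: [f2] is an admissible test function for both weak limits,
    and [xn n t] tends to [x t] because [|x - xn n| <= c n / 2], so the boundary term with [f']
    vanishes. The distance to the integral is at most [c n / 2 * F]. *)
Lemma deriv_integral_cvg : deriv_integral T f (xn n) x t @[n --> \oo] -->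
  f (x t) - f (x 0) - 2^-1 * \int[mu]_u (l u * f2 u) -
  \int[mu]_u (fine (jump_overshoot x t u) * f2 u).
Proof.
have [B xB] := cadlag_bounded cx (ltW T_gt0).
(* As soon as [c n <= 1], all paths [xn n] stay in [[- (B + 1), B + 1]]; this makes the error
   constant independent of [n]. *)
pose F := \int[mu]_(u in `[- (B + 1), B + 1]) `|f2 u|.
pose N n := fine (\int[mu]_u (scaled_crossings c x t n u * (f2 u)%:E)%E).
pose J n := fine (\int[mu]_u (jump_overshoot (xn n) t u * (f2 u)%:E)%E).
pose E n := f (xn n t) - f (x 0) + derive1 f (xn n t) * (x t - xn n t) - J n - N n / 2.
have tT : 0 <= t <= T by rewrite ltW.
have c20 : c n / 2 @[n --> \oo] --> (0 : R).
  by rewrite -[X in _ --> X](mul0r 2^-1); apply: cvgM => //; exact: cvg_cst.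
have DE : \forall n \near \oo, `|deriv_integral T f (xn n) x t - E n| <= c n / 2 * F.
  have c1 : \forall n \near \oo, c n <= 1.
    have /cvgrPdist_le/(_ 1 ltr01) := c_cvg0; apply: filterS => n.
    by rewrite sub0r normrN; apply: le_trans (ler_norm _).
  apply: filterS c1 => n cn1.
  have [[cy cphi] xE phi_le [push pushN] phi0] := skorokhod_pushes T_gt0 (xn_sol n).
  have yB s : 0 <= s <= T -> `|xn n s| <= B + 1.
    move=> sT; rewrite -[xn n s](subrK (x s)) addrC.
    apply: le_trans (ler_normD _ _) _; apply: lerD; first exact: xB.
    rewrite distrC; apply: le_trans (reflected_distance n sT) _.
    by rewrite ler_pdivrMr// mul1r (le_trans cn1)// ler1n.
  have mJ : measurable_fun setT (jump_overshoot (xn n) t) by case: over_cvg => /(_ n)[].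
  (* Membership of the scaled counts in L^p includes their measurability; dividing by [c n > 0]
     passes it on to the counts. *)
  have mN : measurable_fun setT (fun u => crossings x u (c n) t).
    have [/(_ n)[msc _] _ _] := cross_cvg.
    rewrite (_ : (fun u => _) = (fun u => ((c n)^-1)%:E * scaled_crossings c x t n u)%E).
      exact: measurable_funeM.
    by apply/funext => u; rewrite /scaled_crossings muleA -EFinM mulVf ?mul1e// gt_eqF.
  have [Jr [Nr [JE NE]]] := deriv_integral_estimate (c_gt0 n) t_gt0 t_le cx cy cphi xE phi_le
    phi0 push pushN yB f_diff f_C1 f2_weak mJ mN.
  apply: le_trans; rewrite le_eqVlt; apply/orP; left; apply/eqP; congr (`|_ - _|).
  have x0 : x 0 = xn n 0 by rewrite xE ?phi0 ?addr0// lexx ltW.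
  have xt : x t - xn n t = phi n t by rewrite (xE t tT) addrAC subrr add0r.
  by rewrite /E /J /N JE /scaled_crossings NE x0 xt.
have xnt : xn n t @[n --> \oo] --> x t.
  apply/cvgrPdist_le => e e0; have /cvgrPdist_le/(_ _ e0) := c20.
  apply: filterS => n; rewrite sub0r normrN => h.
  by apply: le_trans (reflected_distance n tT) (le_trans (ler_norm _) h).
have cf : continuous f by move=> u; exact/differentiable_continuous/derivable1_diffP.
have EL : E n @[n --> \oo] --> f (x t) - f (x 0) - 2^-1 * \int[mu]_u (l u * f2 u) -
    \int[mu]_u (fine (jump_overshoot x t u) * f2 u).
  have -> : f (x t) - f (x 0) - 2^-1 * \int[mu]_u (l u * f2 u) -
      \int[mu]_u (fine (jump_overshoot x t u) * f2 u) =
      f (x t) - f (x 0) + derive1 f (x t) * (x t - x t) -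
      \int[mu]_u (fine (jump_overshoot x t u) * f2 u) - \int[mu]_u (l u * f2 u) / 2.
    by ring.
  apply: cvgB; last by apply: cvgM; [exact: cvg_weak cross_cvg|exact: cvg_cst].
  apply: cvgB; last exact: cvg_weak over_cvg.
  apply: cvgD; first by apply: cvgB; [apply: continuous_cvg => //; exact: cf|exact: cvg_cst].
  apply: cvgM; first by apply: continuous_cvg => //; exact: f_C1.
  by apply: cvgB => //; exact: cvg_cst.
have D0 : deriv_integral T f (xn n) x t - E n @[n --> \oo] --> (0 : R).
  apply/cvgr0Pnorm_le => e e0.
  have : c n / 2 * F @[n --> \oo] --> (0 : R).
    by rewrite -[X in _ --> X](mul0r F); apply: cvgM => //; exact: cvg_cst.
  move=> /cvgr0Pnorm_le/(_ _ e0); apply: filterS2 DE => n h h'.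
  by apply: le_trans h (le_trans (ler_norm _) h').
rewrite (_ : (fun n => _) = (fun n => deriv_integral T f (xn n) x t - E n + E n)).
  by rewrite -[X in _ --> X]add0r; exact: cvgD.
by apply/funext => n; rewrite subrK.
Qed.

End Convergence.

Theorem proposition2p25 (R : realType) (T : R) (c : nat -> R) (p q : \bar R)
    (x : R -> R) (L : R -> R -> R) (phi xn : nat -> R -> R) (f f2 : R -> R)
    (T_gt0 : 0 < T)
    (c_gt0 : forall n, 0 < c n)
    (c_cvg0 : c n @[n --> \oo] --> 0)
    (p_ge1 : (1 <= p)%E) (q_ge1 : (1 <= q)%E)
    (pq_conj : (p^-1 + q^-1 = 1)%E)
    (x_LS : LS_class T p q c x)
    (L_lt : interval_crossing_local_time T p q c x L)
    (xn_sol : forall n, skorokhod_solution T x (c n) (phi n) (xn n))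
    (f_W2q : sobolev 2 q f)
    (f_diff : forall u, derivable f u 1)
    (f_C1 : continuous (derive1 f))
    (f2_Lq : f2 \in Lfun (@lebesgue_measure R) q)
    (f2_weak : weak_derivative 2 f f2) :
  forall t, t \in `[0, T] ->
    [/\ cvg (deriv_integral T f (xn n) x t @[n --> \oo]),
        summable `]0, t] (fun s => (tanaka_jump_term f x s)%:E) &
        f (x t) - f (x 0) =
          lim (deriv_integral T f (xn n) x t @[n --> \oo])
          + 2^-1 * (\int[lebesgue_measure]_u (L t u * f2 u))
          + tanaka_jump f x t].
Proof.
move=> t; rewrite in_itv/= => /andP[]; rewrite le_eqVlt => /predU1P[<-|t0] tT.
  (* Weak convergence is available for positive times only; at [t = 0] all terms vanish, the local
     time by the convention [L 0 = 0]. *)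
  have D0 : (fun n => deriv_integral T f (xn n) x 0) = (fun=> 0).
    by apply/funext => n; exact: deriv_integral0.
  rewrite D0; split; first exact: is_cvg_cst.
    by rewrite /summable itv00 esum_set0.
  rewrite lim_cst// /tanaka_jump itv00 real_sum_set0 subrr addr0 add0r.
  under eq_Rintegral do rewrite L_lt.1 mul0r.
  by rewrite Rintegral_cst// mul0r mulr0.
have tin : t \in `]0, T] by rewrite in_itv/= t0.
have [cx _ over] := x_LS; have [_ cross] := L_lt.
have {}over := over _ _ xn_sol t tin; have {}cross := cross t tin.
have [|mJ Jfin Ji _] := in_Lp_dual p_ge1 q_ge1 pq_conj f2_Lq f2_weak (h := jump_overshoot x t).
  by case: over.
have [sJ ->] := tanaka_jump_integral t0 tT cx f_diff f_C1 f2_weak mJ Jfin Ji.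
have lim := deriv_integral_cvg T_gt0 c_gt0 c_cvg0 p_ge1 q_ge1 pq_conj t0 tT cx xn_sol
  f_diff f_C1 f2_Lq f2_weak cross over.
split => //; first by apply/cvg_ex; eexists; exact: lim.
by rewrite (cvg_lim _ lim)//; ring.
Qed.
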